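(* Let $\Omega\subset\mathbb{R}^2$ be a bounded polygonal domain, and let $\mathcal{T}_h$ be a shape regular, but not necessarily quasi-uniform, triangulation of $\Omega$. Let $f$ be a semi-norm defined on the space $H^1_h$ of piecewise $H^1$ functions subordinated to $\mathcal{T}_h$ that satisfies two conditions: 1) There is a constant $C$ that only depends on $\Omega$ and the shape regularity of $\mathcal{T}_h$, and is otherwise independent of $\mathcal{T}_h$, such that $$f(u)\le C\|u\|_{H^1_h}\quad\forall\,u\in H^1_h.$$ 2) For any constant $c$, $f(c)=0$ if and only if $c=0$. Then there exists a constant $C$ depending only on the domain $\Omega$ and the shape regularity constant of $\mathcal{T}_h$, but otherwise independent of $\mathcal{T}_h$, such that $$\|u\|^2_{L^2(\Omega)}\le C\Big[\int_{\Omega_h}|\nabla u|^2+\sum_{e\in\mathcal{E}^0_h}\frac1{|e|}\int_e[\![u]\!]^2+f^2(u)\Big]\quad\forall\,u\in H^1_h.$$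
   Context: $\mathcal{T}_h$ denotes both the triangulation and the set of all its open triangular elements $\tau$. The shape regularity constant of a triangle is $R/r$, where $r$ and $R$ are the radii of its largest inscribed circle and smallest circumscribed circle, respectively; the shape regularity constant of a triangulation is the maximum of the shape regularity constants of all its triangles. $\Omega_h$ denotes the union of all the open triangular elements of $\mathcal{T}_h$, and $\mathcal{E}^0_h$ the set of all interior (open) edges. $H^1_h$ is the space of functions that are independently defined on every element $\tau\in\mathcal{T}_h$, on which they belong to $H^1(\tau)$ (no continuity across edges is required), so $H^1_h\subset L^2(\Omega)$. On an edge $e\in\mathcal{E}^0_h$, $[\![u]\!]$ denotes the difference of the two traces of $u$ from the two elements sharing $e$ (the jump of $u$ over $e$), and $|e|$ is the length of $e$. The space $H^1_h$ is equipped with the norm $$\|u\|_{H^1_h}=\Big[\|u\|^2_{L^2(\Omega)}+\int_{\Omega_h}|\nabla u|^2+\sum_{e\in\mathcal{E}^0_h}\frac1{|e|}\int_e[\![u]\!]^2\Big]^{1/2}.$$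
   Formalization: The semi-norm f is given for all triangulations of bounded shape regularity, its values at constants are assumed not to depend on the triangulation, and C may depend on f; otherwise f = ε|∫u| or f = h|∫u| with u = 1 refutes a uniform C. *)

(* Defs.v *)
From mathcomp Require Export all_boot all_order all_algebra.
From mathcomp Require Export all_classical all_reals all_analysis.
Set Implicit Arguments.
Unset Strict Implicit.
Unset Printing Implicit Defensive.
Import Order.TTheory GRing.Theory Num.Theory.
Import numFieldNormedType.Exports.

Local Open Scope classical_set_scope.
Local Open Scope ring_scope.

Section PlaneGeometry.
Context {R : realType}.
Notation pt := (R * R)%type.

(* The library norm of [R * R] is the max norm; lengths are Euclidean. *)
Definition edist (p q : pt) : R :=
  Num.sqrt ((p.1 - q.1) ^+ 2 + (p.2 - q.2) ^+ 2).

Definition triangle := {ffun 'I_3 -> pt}.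

(* The three vertices are not collinear. *)
Definition nondegenerate (t : triangle) : Prop :=
  ((t 1).1 - (t 0).1) * ((t 2%:R).2 - (t 0).2)
    - ((t 1).2 - (t 0).2) * ((t 2%:R).1 - (t 0).1) != 0.

Definition open_tri (t : triangle) : set pt :=
  [set x | exists l : 'I_3 -> R,
     [/\ forall i, 0 < l i, \sum_i l i = 1 & x = \sum_i l i *: t i]].

Definition closed_tri (t : triangle) : set pt :=
  [set x | exists l : 'I_3 -> R,
     [/\ forall i, 0 <= l i, \sum_i l i = 1 & x = \sum_i l i *: t i]].

(* [(t, i)] is the side of [t] opposite to its [i]-th vertex; the indices
   [i + 1] and [i + 2] are taken modulo 3. *)
Definition side := (triangle * 'I_3)%type.
Definition side_src (s : side) : pt := s.1 (s.2 + 1).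
Definition side_tgt (s : side) : pt := s.1 (s.2 + 2%:R).
Definition side_len (s : side) : R := edist (side_src s) (side_tgt s).
Definition side_pt (s : side) (r : R) : pt :=
  side_src s + r *: (side_tgt s - side_src s).
Definition closed_side (s : side) : set pt := side_pt s @` `[0, 1].
Definition same_edge (s s' : side) : bool :=
  ((side_src s == side_src s') && (side_tgt s == side_tgt s'))
  || ((side_src s == side_tgt s') && (side_tgt s == side_src s')).

(* A bounded polygonal domain.  Openness and boundedness follow from the
   representation; being the interior of a closed set excludes slits. *)
Definition polygonal_domain (Omega : set pt) : Prop :=
  [/\ Omega !=set0, connected Omega &
   exists2 P : seq triangle, (forall t, t \in P -> nondegenerate t) &
     Omega = interior (\bigcup_(t in [set` P]) closed_tri t)].

Definition conforming (t t' : triangle) : Prop :=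
  let I := closed_tri t `&` closed_tri t' in
  [\/ I = set0,
      (exists i j, t i = t' j /\ I = [set t i]) |
      (exists i j, same_edge (t, i) (t', j) /\ I = closed_side (t, i))].

Definition triangulation (Omega : set pt) (T : seq triangle) : Prop :=
  [/\ uniq T,
      forall t, t \in T -> nondegenerate t,
      forall t t', t \in T -> t' \in T -> t != t' -> conforming t t' &
      \bigcup_(t in [set` T]) closed_tri t = closure Omega].

Definition inradius (t : triangle) : R :=
  sup [set r | 0 < r /\
         exists c, [set x | edist c x < r] `<=` open_tri t].

Definition circumradius (t : triangle) : R :=
  inf [set r | exists c, open_tri t `<=` [set x | edist c x <= r]].

Definition shape_const (T : seq triangle) : R :=
  \big[Num.max/0]_(t <- T) (circumradius t / inradius t).

(* Pairs of sides of two distinct elements that are the same segment.  Each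
   interior edge occurs exactly once, its two elements being ordered by their
   position in [T]. *)
Definition interior_edges (T : seq triangle) : seq (side * side) :=
  let sides := [seq (t, i) | t <- T, i <- enum 'I_3] in
  [seq e <- [seq (s, s') | s <- sides, s' <- sides] |
     (index e.1.1 T < index e.2.1 T)%N && same_edge e.1 e.2].

End PlaneGeometry.

Arguments triangle : clear implicits.
Arguments side : clear implicits.

Section BrokenSobolev.
Context {R : realType}.
Notation pt := (R * R)%type.

Notation mpt := (measurableTypeR R * measurableTypeR R)%type.
Notation mu1 := (@lebesgue_measure R).
Notation I01 := (`[0, 1]%classic : set (measurableTypeR R)).

Definition area : {measure set mpt -> \bar R} := (mu1 \x mu1)%E.

Definition L2 (D : set pt) (u : pt -> R) : Prop :=
  measurable_fun (D : set mpt) u /\ area.-integrable D (fun x => ((u x) ^+ 2)%:E).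

Definition L2sq (D : set pt) (u : pt -> R) : R :=
  \int[area]_(x in D) (u x) ^+ 2.

Definition smooth (phi : pt -> R) : Prop :=
  forall (vs : seq pt) (x : pt),
    differentiable (foldr (fun v g => 'D_v g) phi vs) x.

Definition test_function (D : set pt) (phi : pt -> R) : Prop :=
  [/\ smooth phi, compact (closure [set x | phi x != 0]) &
      closure [set x | phi x != 0] `<=` D].

Definition e1 : pt := (1, 0).
Definition e2 : pt := (0, 1).

Definition weak_deriv (D : set pt) (v : pt) (u g : pt -> R) : Prop :=
  forall phi, test_function D phi ->
    \int[area]_(x in D) (u x * 'D_v phi x) =
    - \int[area]_(x in D) (g x * phi x).

Definition weak_grad (D : set pt) (u : pt -> R) (G : (pt -> R) * (pt -> R)) :=
  [/\ L2 D G.1, L2 D G.2, weak_deriv D e1 u G.1 & weak_deriv D e2 u G.2].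

Definition H1 (D : set pt) (u : pt -> R) : Prop :=
  L2 D u /\ exists G, weak_grad D u G.

(* The weak gradient of [u] on [D], unique almost everywhere on [D]. *)
Definition grad (D : set pt) (u : pt -> R) : (pt -> R) * (pt -> R) :=
  xget (cst 0, cst 0) [set G | weak_grad D u G].

Definition grad_sq (D : set pt) (u : pt -> R) : R :=
  L2sq D (grad D u).1 + L2sq D (grad D u).2.

(* Integral over a side with respect to arc length. *)
Definition side_int (s : side R) (w : pt -> R) : R :=
  side_len s * \int[mu1]_(r in I01) w (side_pt s r).

(* The trace operator is the continuous extension of the restriction of
   smooth functions: [g] is the limit in L^2(s) of the restrictions of some
   smooth functions that converge to [u] in H^1 of the triangle. *)
Definition is_trace (s : side R) (u g : pt -> R) : Prop :=
  let D := open_tri s.1 in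
  [/\ measurable_fun I01 (g \o side_pt s),
      mu1.-integrable I01 (fun r => (g (side_pt s r) ^+ 2)%:E) &
  exists v : nat -> pt -> R,
  [/\ forall n, smooth (v n),
      L2sq D (fun x => v n x - u x) @[n --> \oo] --> (0 : R),
      L2sq D (fun x => 'D_e1 (v n) x - (grad D u).1 x) @[n --> \oo]
        --> (0 : R),
      L2sq D (fun x => 'D_e2 (v n) x - (grad D u).2 x) @[n --> \oo]
        --> (0 : R) &
      side_int s (fun x => (v n x - g x) ^+ 2) @[n --> \oo] --> (0 : R)]].

(* Only its values on [s], up to a null set, are meaningful. *)
Definition trace (s : side R) (u : pt -> R) : pt -> R :=
  xget (cst 0) [set g | is_trace s u g].

Definition H1h (T : seq (triangle R)) (u : pt -> R) : Prop :=
  forall t, t \in T -> H1 (open_tri t) u.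

Definition grad_energy (T : seq (triangle R)) (u : pt -> R) : R :=
  \sum_(t <- T) grad_sq (open_tri t) u.

Definition jump_energy (T : seq (triangle R)) (u : pt -> R) : R :=
  \sum_(e <- interior_edges T)
    (side_len e.1)^-1 *
    side_int e.1 (fun x => (trace e.1 u x - trace e.2 u x) ^+ 2).

Definition H1h_norm (Omega : set pt) (T : seq (triangle R)) (u : pt -> R) : R :=
  Num.sqrt (L2sq Omega u + grad_energy T u + jump_energy T u).

Definition seminorm_on (S : set (pt -> R)) (f : (pt -> R) -> R) : Prop :=
  (forall u v, S u -> S v -> f (u \+ v) <= f u + f v) /\
  (forall (a : R) u, S u -> f (fun x => a * u x) = `|a| * f u).

End BrokenSobolev.

(* Main.v *)
Require Import Defs.
From HB Require Import structures.
From mathcomp Require Import all_boot all_order all_algebra.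
From mathcomp Require Import all_classical all_reals all_analysis measurable_realfun.
From mathcomp Require Import ring lra.
Set Implicit Arguments.
Unset Strict Implicit.
Unset Printing Implicit Defensive.
Import Order.TTheory GRing.Theory Num.Theory.
Import numFieldNormedType.Exports.
Local Open Scope classical_set_scope.
Local Open Scope ring_scope.

(* Write [u_h] for [u] set to zero outside the elements.  Integrating by parts on
   each element, the derivative of [u_h] inside [Omega] is a measure: the broken
   gradient plus the jumps on the interior edges.  By Cauchy-Schwarz its total
   variation is at most a constant times the square root of the broken energy,
   because shape regularity makes the sum of the squared edge lengths at most a
   constant times the area of [Omega].  In the plane, bounded variation controls
   the L^2 distance to a constant on a parallelogram; this is proved for the
   mollifications of [u_h] (contracted towards the centre of the parallelogram, so
   that no values from outside are used), and it chains through overlapping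
   parallelograms to all of the connected set [Omega], with constants that do not
   see the mesh.  Finally the semi-norm detects the constant [c] approximating [u]:
   [|c| f(1) = f(c) <= f(u) + f(u - c)], and [f(u - c)] is at most a constant times
   the norm of [u - c], which is bounded by the broken energy. *)

(** * Area under affine maps *)

(** The jumps sit on the edges, so the derivative of [u_h] on [Omega] has no density and no L^2
    bound on a gradient is available; hence the detour through bounded variation, whose critical
    exponent in the plane is exactly 2. The weight [1 / |e|] of the energy is what leaves squared
    lengths after Cauchy-Schwarz: they scale like areas, so neither mesh size nor grading enters.
    The geometry that carries the chaining is the decomposition into triangles that defines the
    polygon; it is fixed with [Omega] and is never the mesh. Parallelograms are affine images of the
    square, whose product structure reduces the estimate to one-dimensional ones, and a triangle is
    a union of three of them. Weak gradients and traces are values selected by [xget], determined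
    only almost everywhere. This is the purpose of the completeness of L^2 and of the smooth
    approximations up to the boundary: they show that traces exist, that all approximating sequences
    lead to the same one, and how traces react when a constant is subtracted. *)

Section PlaneMeasure.
Context {R : realType}.
Notation pt := (R * R)%type.
Notation mR := (measurableTypeR R).
Notation mpt := (mR * mR)%type.
Notation mu1 := (@lebesgue_measure R).

(** The product sigma-algebra is generated by rectangles; an open set is the countable union of the
    rational squares that it contains. *)
Lemma open_measurable_plane (A : set pt) : open A -> measurable (A : set mpt).
Proof.
move=> oA.
pose box (q : rat * rat * rat) : set pt :=
  [set x | ratr q.1.1 - ratr q.2 < x.1 < ratr q.1.1 + ratr q.2 /\
           ratr q.1.2 - ratr q.2 < x.2 < ratr q.1.2 + ratr q.2].
have mbox q : measurable (box q : set mpt).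
  have -> : box q = (`](ratr q.1.1 - ratr q.2)%R, (ratr q.1.1 + ratr q.2)[%classic) `*`
      (`](ratr q.1.2 - ratr q.2), (ratr q.1.2 + ratr q.2)[%classic).
    by apply/seteqP; split => -[x y] /=; rewrite !in_itv.
  by apply: measurableX; exact: measurable_itv.
have -> : A = \bigcup_(q in [set q | box q `<=` A]) box q.
  apply/seteqP; split => [x Ax|x [q qA]]; last exact: qA.
  have /nbhs_ballP[e /= e0 eA] := open_nbhs_nbhs (conj oA Ax).
  have e20 : 0 < e / 2 by rewrite divr_gt0.
  have [q] := rat_in_itvoo e20; rewrite in_itv /= => /andP[q0 qe].
  have h1 : x.1 - ratr q < x.1 + ratr q :> R by lra.
  have h2 : x.2 - ratr q < x.2 + ratr q :> R by lra.
  have [p1] := rat_in_itvoo h1; rewrite in_itv /= => /andP[p11 p12].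
  have [p2] := rat_in_itvoo h2; rewrite in_itv /= => /andP[p21 p22].
  exists (p1, p2, q); last by split => /=; apply/andP; split; lra.
  move=> y [/= /andP[y1 y2] /andP[y3 y4]]; apply: eA.
  by split => /=; rewrite -ball_normE /ball_ /= ltr_norml; apply/andP; split; lra.
rewrite bigcup_mkcond; apply: countable_bigcupT_measurable; first exact: countableP.
by move=> q; case: ifP.
Qed.

Lemma continuous_measurable_plane (f : pt -> R) :
  continuous f -> measurable_fun setT (f : mpt -> mR).
Proof.
move=> cf; apply: (measurability _ (RGenOpens.measurableE R)).
move=> _ [_ [a [b ->]] <-]; rewrite setTI.
apply: open_measurable_plane; apply: open_comp => // x _; exact: cf.
Qed.

Definition aff (a b : R) : mR -> mR := fun x => a * x + b.

Lemma measurable_aff (a b : R) : measurable_fun setT (aff a b).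
Proof.
have : measurable_fun setT ((fun x : mR => a * x : R) \+ cst b).
  by apply: measurable_funD => //; exact: measurable_funM.
by [].
Qed.

(** Uniqueness of Lebesgue measure: both sides are measures, and they agree on half-open intervals.
    For negative [a] the preimage is closed at the other end, with the same length. *)
Lemma lebesgue_aff (a b : R) (A : set mR) : a != 0 -> measurable A ->
  (`|a|%:E * mu1 (aff a b @^-1` A) = mu1 A)%E.
Proof.
move=> a0 mA.
have an : 0 <= `|a| by [].
have := @lebesgue_measure_unique R (mscale (NngNum an) (pushforward mu1 (aff a b))).
move=> /(_ (measurable_aff a b)) H.
apply/esym/H => // {A mA H} _ [[u v] _ <-].
suff: (mu1 `]u, v]%classic = `|a|%:E * mu1 (aff a b @^-1` `]u, v]%classic))%E by [].
apply: esym.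
have [a1|a1|/eqP] := ltgtP a 0; last by rewrite (negbTE a0).
- have -> : aff a b @^-1` `]u, v]%classic = `[(v - b) / a, (u - b) / a[%classic.
    apply/seteqP; split => x /=; rewrite !in_itv /= /aff => /andP[h1 h2].
      by rewrite ler_ndivrMr // ltr_ndivlMr // mulrC; apply/andP; split; lra.
    move: h1 h2; rewrite ler_ndivrMr // ltr_ndivlMr // mulrC => h1 h2.
    by apply/andP; split; lra.
  rewrite !lebesgue_measure_itv /= !lte_fin.
  rewrite ltr_ndivrMr // mulfVK // ltrD2r.
  case: ifPn => _; last by rewrite mule0.
  rewrite -!EFinD -EFinM; congr EFin; rewrite ltr0_norm //; field; exact: a0.
- have -> : aff a b @^-1` `]u, v]%classic = `](u - b) / a, (v - b) / a]%classic.
    apply/seteqP; split => x /=; rewrite !in_itv /= /aff => /andP[h1 h2].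
      by rewrite ltr_pdivrMr // ler_pdivlMr // mulrC; apply/andP; split; lra.
    move: h1 h2; rewrite ltr_pdivrMr // ler_pdivlMr // mulrC => h1 h2.
    by apply/andP; split; lra.
  rewrite !lebesgue_measure_itv /= !lte_fin.
  rewrite ltr_pdivrMr // mulfVK // ltrD2r.
  case: ifPn => _; last by rewrite mule0.
  rewrite -!EFinD -EFinM; congr EFin; rewrite gtr0_norm //; field; exact: a0.
Qed.

Lemma ge0_integral_affine (a b : R) (f : mR -> \bar R) : a != 0 ->
  measurable_fun setT f -> (forall x, 0 <= f x)%E ->
  (\int[mu1]_x f x = `|a|%:E * \int[mu1]_x f (aff a b x))%E.
Proof.
move=> a0 mf f0.
have mg := measurable_aff a b.
have an : 0 <= `|a| by [].
pose m := mscale (NngNum an) (pushforward mu1 (aff a b)).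
transitivity (\int[m mg]_x f x)%E.
  apply: eq_measure_integral => A mA _; exact/esym/lebesgue_aff.
rewrite ge0_integral_mscale //=; congr (_ * _)%E.
by rewrite ge0_integral_pushforward // preimage_setT.
Qed.

Lemma tonelli_area (f : mpt -> \bar R) : measurable_fun setT f -> (forall x, 0 <= f x)%E ->
  (\int[area]_x f x = \int[mu1]_x \int[mu1]_y f (x, y))%E.
Proof. by move=> mf f0; exact: fubini_tonelli1. Qed.

Lemma tonelli_area2 (f : mpt -> \bar R) : measurable_fun setT f -> (forall x, 0 <= f x)%E ->
  (\int[area]_x f x = \int[mu1]_y \int[mu1]_x f (x, y))%E.
Proof. by move=> mf f0; exact: fubini_tonelli2. Qed.

(** The plane is exchanged with [nu] one coordinate at a time, through [K], the integral over the
    second coordinate alone. *)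
Lemma tonelli_area_swap d (T : measurableType d) (nu : {sigma_finite_measure set T -> \bar R})
    (F : mpt * T -> \bar R) : measurable_fun setT F -> (forall z, 0 <= F z)%E ->
  (\int[area]_x \int[nu]_w F (x, w) = \int[nu]_w \int[area]_x F (x, w))%E.
Proof.
move=> mF F0.
pose F3 (z : mR * T * mR) := F ((z.1.1, z.2), z.1.2).
have mF3 : measurable_fun setT F3.
  apply: (measurableT_comp mF); apply: measurable_fun_pair.
    apply: measurable_fun_pair; last exact: measurable_snd.
    exact: measurableT_comp measurable_fst measurable_fst.
  exact: measurableT_comp measurable_snd measurable_fst.
pose K (z : mR * T) := (\int[mu1]_y F ((z.1, y), z.2))%E.
have mK : measurable_fun setT K := @measurable_fun_fubini_tonelli_F _ _ _ _ _ mu1 F3 mF3 (fun z => F0 _).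
have K0 z : (0 <= K z)%E by apply: integral_ge0 => y _; exact: F0.
pose H (x : mpt) := (\int[nu]_w F (x, w))%E.
have mH : measurable_fun setT H := @measurable_fun_fubini_tonelli_F _ _ _ _ _ nu F mF F0.
have H0 x : (0 <= H x)%E by apply: integral_ge0 => y _; exact: F0.
transitivity (\int[mu1]_x \int[mu1]_y H (x, y))%E; first exact: tonelli_area.
transitivity (\int[mu1]_x \int[nu]_w K (x, w))%E.
  apply: eq_integral => x _.
  pose Fx (z : mR * T) := F ((x, z.1), z.2).
  have mFx : measurable_fun setT Fx.
    apply: (measurableT_comp mF); apply: measurable_fun_pair; last exact: measurable_snd.
    by apply: measurable_fun_pair; [exact: measurable_cst|exact: measurable_fst].
  exact: (fubini_tonelli (m1 := mu1) (m2 := nu) Fx mFx (fun z => F0 _)).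
transitivity (\int[nu]_w \int[mu1]_x K (x, w))%E; first exact: (fubini_tonelli (m1 := mu1) (m2 := nu) K mK K0).
apply: eq_integral => w _; symmetry; apply: (@tonelli_area (fun x => F (x, w))).
  exact: (measurableT_comp mF (measurable_pair2 w)).
by move=> x; exact: F0.
Qed.

Lemma measurable_area_partial d (T : measurableType d) (F : mpt * T -> \bar R) :
  measurable_fun setT F -> (forall z, 0 <= F z)%E ->
  measurable_fun setT (fun w => \int[area]_x F (x, w))%E.
Proof.
move=> mF F0.
pose F3 (z : mR * T * mR) := F ((z.1.1, z.2), z.1.2).
have mF3 : measurable_fun setT F3.
  apply: (measurableT_comp mF); apply: measurable_fun_pair.
    apply: measurable_fun_pair; last exact: measurable_snd.
    exact: measurableT_comp measurable_fst measurable_fst.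
  exact: measurableT_comp measurable_snd measurable_fst.
pose K (z : mR * T) := (\int[mu1]_y F ((z.1, y), z.2))%E.
have mK : measurable_fun setT K := @measurable_fun_fubini_tonelli_F _ _ _ _ _ mu1 F3 mF3 (fun z => F0 _).
have K0 z : (0 <= K z)%E by apply: integral_ge0 => y _; exact: F0.
rewrite (_ : (fun w => _) = (fun w => \int[mu1]_x K (x, w))%E).
  exact: (@measurable_fun_fubini_tonelli_G _ _ _ _ _ mu1 K mK K0).
apply/funext => w; apply: (@tonelli_area (fun x => F (x, w))) => [|x]; last exact: F0.
exact: (measurableT_comp mF (measurable_pair2 w)).
Qed.

Lemma tonelli_area_area (F : mpt * mpt -> \bar R) : measurable_fun setT F -> (forall z, 0 <= F z)%E ->
  (\int[area]_x \int[area]_w F (x, w) = \int[area]_w \int[area]_x F (x, w))%E.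
Proof.
move=> mF F0.
pose F3 (z : mpt * mR * mR) := F (z.1.1, (z.1.2, z.2)).
have mF3 : measurable_fun setT F3.
  apply: (measurableT_comp mF); apply: measurable_fun_pair.
    exact: measurableT_comp measurable_fst measurable_fst.
  apply: measurable_fun_pair; last exact: measurable_snd.
  exact: measurableT_comp measurable_snd measurable_fst.
pose K (z : mpt * mR) := (\int[mu1]_y F (z.1, (z.2, y)))%E.
have mK : measurable_fun setT K := @measurable_fun_fubini_tonelli_F _ _ _ _ _ mu1 F3 mF3 (fun z => F0 _).
have K0 z : (0 <= K z)%E by apply: integral_ge0 => y _; exact: F0.
pose H (w : mpt) := (\int[area]_x F (x, w))%E.
have mH : measurable_fun setT H := measurable_area_partial mF F0.
have H0 x : (0 <= H x)%E by apply: integral_ge0 => y _; exact: F0.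
transitivity (\int[area]_x \int[mu1]_w K (x, w))%E.
  apply: eq_integral => x _; apply: (@tonelli_area (fun w => F (x, w))) => [|w]; last exact: F0.
  exact: (measurableT_comp mF (measurable_pair1 x)).
rewrite tonelli_area_swap // (tonelli_area mH H0).
apply: eq_integral => u _.
pose Fu (z : mpt * mR) := F (z.1, (u, z.2)).
apply: (@tonelli_area_swap _ _ mu1 Fu); last by move=> z; exact: F0.
apply: (measurableT_comp mF); apply: measurable_fun_pair; first exact: measurable_fst.
by apply: measurable_fun_pair; [exact: measurable_cst|exact: measurable_snd].
Qed.

Definition lin (o a b : pt) : mpt -> mpt := fun x => (o + x.1 *: a + x.2 *: b : pt).
Definition cross (a b : pt) : R := a.1 * b.2 - a.2 * b.1.

Lemma lin1 o a b x : (lin o a b x).1 = o.1 + x.1 * a.1 + x.2 * b.1. Proof. by []. Qed.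
Lemma lin2 o a b x : (lin o a b x).2 = o.2 + x.1 * a.2 + x.2 * b.2. Proof. by []. Qed.

Lemma measurable_lin o a b : measurable_fun setT (lin o a b).
Proof.
have h (c d e : R) : measurable_fun setT (fun x : mpt => c + x.1 * d + x.2 * e : R).
  apply: (@measurable_funD _ _ _ _ (fun x : mpt => c + x.1 * d : R) (fun x : mpt => x.2 * e)).
    apply: (@measurable_funD _ _ _ _ (cst c) (fun x : mpt => x.1 * d)) => //.
    by apply: measurable_funM => //; exact: measurable_fst.
  by apply: measurable_funM => //; exact: measurable_snd.
by apply/measurable_fun_pairP; split; [exact: h o.1 a.1 b.1|exact: h o.2 a.2 b.2].
Qed.

(** Two one-dimensional substitutions: the matrix with columns [a] and [b] is eliminated with pivots
    [a.1] and [cross a b / a.1]. If [a.1] vanishes, [a] and [b] are exchanged, which only changes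
    the sign of the determinant. *)
Lemma ge0_integral_lin (o a b : pt) (f : mpt -> \bar R) : cross a b != 0 ->
  measurable_fun setT f -> (forall x, 0 <= f x)%E ->
  (\int[area]_x f x = `|cross a b|%:E * \int[area]_x f (lin o a b x))%E.
Proof.
have half o' a' b' (g : mpt -> \bar R) : a'.1 != 0 -> cross a' b' != 0 ->
  measurable_fun setT g -> (forall x, 0 <= g x)%E ->
  (\int[area]_x g x = `|cross a' b'|%:E * \int[area]_x g (lin o' a' b' x))%E.
  move=> a1 ab mg g0.
  have mgl := measurableT_comp mg (measurable_lin o' a' b').
  rewrite (tonelli_area2 mgl); last by move=> z; exact: g0.
  (* Second pivot; [c] below is the slope of the shear that remains once the first coordinate has
     been substituted. *)
  pose d := cross a' b' / a'.1.
  have d0 : d != 0 by rewrite mulf_neq0 // invr_eq0.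
  pose c := a'.2 / a'.1.
  pose h x y := g (x, (o'.2 - c * o'.1) + c * x + d * y).
  have mh : measurable_fun setT (fun z : mpt => h z.1 z.2).
    apply: (measurableT_comp mg).
    rewrite (_ : (fun _ => _) = lin (0, o'.2 - c * o'.1) (1, c) (0, d)).
      exact: measurable_lin.
    by apply/funext => -[x y]; rewrite [RHS]surjective_pairing lin1 lin2 /=; congr (_, _); ring.
  have E1 y : (\int[mu1]_x g (lin o' a' b' (x, y)) =
      `|a'.1|^-1%:E * \int[mu1]_x h x y)%E.
    rewrite (@ge0_integral_affine a'.1 (o'.1 + y * b'.1) (fun x => h x y)) //; last 2 first.
    - exact: (measurableT_comp mh (measurable_pair2 y)).
    - by move=> x; exact: g0.
    rewrite muleA -EFinM mulVf ?normr_eq0 // mul1e.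
    apply: eq_integral => x _; rewrite /h /aff [lin _ _ _ _]surjective_pairing lin1 lin2 /=.
    congr (g (_, _)); first ring.
    by rewrite /d /c /cross; field.
  transitivity (`|cross a' b'|%:E * \int[mu1]_y (`|a'.1|^-1%:E * \int[mu1]_x h x y))%E; last first.
    by congr (_ * _)%E; apply: eq_integral => y _; rewrite E1.
  have mG : measurable_fun setT (fun y : mR => \int[mu1]_x h x y)%E.
    exact: (@measurable_fun_fubini_tonelli_G _ _ _ _ _ mu1 (fun z : mpt => h z.1 z.2) mh (fun z => g0 _)).
  rewrite ge0_integralZl_EFin //; last by move=> y _; apply: integral_ge0 => x _; exact: g0.
  have sw : (\int[mu1]_y \int[mu1]_x h x y = \int[mu1]_x \int[mu1]_y h x y)%E.
    exact: (esym (fubini_tonelli (m1:=mu1) (m2:=mu1) (fun z : mpt => h z.1 z.2) mh (fun z => g0 _))).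
  rewrite sw.
  have E2 x : (\int[mu1]_y h x y = `|d|^-1%:E * \int[mu1]_y g (x, y))%E.
    rewrite (@ge0_integral_affine d ((o'.2 - c * o'.1) + c * x) (fun y => g (x, y))) //; last first.
      exact: measurableT_comp.
    rewrite muleA -EFinM mulVf ?normr_eq0 // mul1e.
    by apply: eq_integral => y _; rewrite /h /aff; congr (g (_, _)); rewrite addrC.
  transitivity (`|cross a' b'|%:E * (`|a'.1|^-1%:E * \int[mu1]_x (`|d|^-1%:E * \int[mu1]_y g (x, y))))%E; last first.
    by congr (_ * (_ * _))%E; apply: eq_integral => x _; rewrite E2.
  rewrite ge0_integralZl_EFin //; last 2 first.
  - by move=> y _; apply: integral_ge0.
  - exact: (measurable_fun_fubini_tonelli_F g).
  rewrite -tonelli_area // !muleA -!EFinM.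
  rewrite (_ : (_ * _ * _)%R = 1) ?mul1e // /d normrM normfV.
  by field; rewrite !normr_eq0 a1 ab.
move=> ab mf f0.
have [a0|a0] := eqVneq a.1 0; last exact: half.
have b0 : b.1 != 0 by apply: contra_neq ab => b0; rewrite /cross a0 b0; ring.
have ba : cross b a = - cross a b by rewrite /cross; ring.
rewrite (half o b a) ?ba ?oppr_eq0 // normrN; congr (_ * _)%E.
have mgl := measurableT_comp mf (measurable_lin o b a).
have mgl2 := measurableT_comp mf (measurable_lin o a b).
rewrite (tonelli_area2 mgl); last by move=> z; exact: f0.
rewrite (tonelli_area mgl2); last by move=> z; exact: f0.
by apply: eq_integral => y _; apply: eq_integral => x _; rewrite /lin /= addrAC.
Qed.

Lemma ge0_integral_lin_on (o a b : pt) (D : set mpt) (f : mpt -> \bar R) : cross a b != 0 ->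
  measurable D -> measurable_fun D f -> (forall x, D x -> 0 <= f x)%E ->
  (\int[area]_(x in D) f x = `|cross a b|%:E * \int[area]_(x in lin o a b @^-1` D) f (lin o a b x))%E.
Proof.
move=> ab mD mf f0; rewrite integral_mkcond (ge0_integral_lin o ab) //; last 2 first.
- by apply/(measurable_restrictT f mD).
- by move=> x; rewrite patchE; case: ifPn => // /set_mem; exact: f0.
congr (_ * _)%E; rewrite [RHS]integral_mkcond; apply: eq_integral => x _.
by rewrite !patchE (_ : (x \in _ @^-1` _) = (lin o a b x \in D)).
Qed.

Lemma integral_lin_on (o a b : pt) (D : set mpt) (f : mpt -> R) : cross a b != 0 ->
  measurable D -> area.-integrable D (EFin \o f) ->
  area.-integrable (lin o a b @^-1` D) (EFin \o (f \o lin o a b)) /\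
  \int[area]_(x in D) f x = `|cross a b| * \int[area]_(x in lin o a b @^-1` D) f (lin o a b x).
Proof.
move=> ab mD fi; have [mf fi'] := integrableP _ _ _ fi.
have mD' : measurable (lin o a b @^-1` D) by rewrite -[X in measurable X]setTI; apply: measurable_lin.
have c0 : 0 < `|cross a b| by rewrite normr_gt0.
have mff : measurable_fun (lin o a b @^-1` D) ((EFin \o f) \o lin o a b).
  apply: (measurable_comp mD _ mf); last by apply: measurable_funTS; exact: measurable_lin.
  by move=> _ [x Dx <-].
have fi2 : area.-integrable (lin o a b @^-1` D) ((EFin \o f) \o lin o a b).
  apply/integrableP; split => //; move: fi'.
  rewrite (ge0_integral_lin_on o ab) //; last exact: measurableT_comp.
  by apply: contraTT; rewrite -!leNgt !leye_eq => /eqP ->; rewrite gt0_muley.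
split=> //.
have Ep := ge0_integral_lin_on o ab mD (measurable_funepos mf) (fun x _ => funepos_ge0 _ x).
have En := ge0_integral_lin_on o ab mD (measurable_funeneg mf) (fun x _ => funeneg_ge0 _ x).
have fp := integrable_pos_fin_num mD' fi2.
have fn := integrable_neg_fin_num mD' fi2.
have E : (integral area D (EFin \o f) =
    `|cross a b|%:E * integral area (lin o a b @^-1` D) ((EFin \o f) \o lin o a b))%E.
  rewrite (integralE area D (EFin \o f)) (integralE area _ ((EFin \o f) \o lin o a b)).
  transitivity (`|cross a b|%:E * \int[area]_(x in lin o a b @^-1` D) ((EFin \o f) \o lin o a b)^\+ x -
    `|cross a b|%:E * \int[area]_(x in lin o a b @^-1` D) ((EFin \o f) \o lin o a b)^\- x)%E.
    by rewrite Ep En (funepos_comp (EFin \o f) (lin o a b)) (funeneg_comp (EFin \o f) (lin o a b)).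
  by rewrite -muleBr //; exact: fin_num_adde_defr.
have fin : integral area (lin o a b @^-1` D) ((EFin \o f) \o lin o a b) \is a fin_num.
  by rewrite (integralE area _ ((EFin \o f) \o lin o a b)) fin_numB; apply/andP.
rewrite -[LHS]/(fine (integral area D (EFin \o f))) E fineM //.
Qed.

(** Tonelli along an axis that is not parallel to the line: every slice is a single point. *)
Lemma area_line0 (al be ga : R) : (al, be) != (0, 0) ->
  area [set x : mpt | al * x.1 + be * x.2 = ga] = 0%E.
Proof.
move=> ab0.
have ml : measurable_fun setT (fun x : mpt => al * x.1 + be * x.2 : R).
  by apply: measurable_funD; apply: measurable_funM.
have mA : measurable [set x : mpt | al * x.1 + be * x.2 = ga].
  by rewrite -[X in measurable X]setTI; apply: (ml measurableT [set ga]); exact: measurable_set1.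
set L := [set x : mpt | _] in mA *.
have -> : area L = (\int[area]_x (EFin \o \1_L) x)%E by rewrite integral_indic // setIT.
have mI : measurable_fun setT (EFin \o \1_L : mpt -> \bar R).
  by apply/measurable_EFinP; exact: measurable_indic.
have [a0|a0] := eqVneq al 0.
  have b0 : be != 0 by apply: contra_neq ab0 => ->; rewrite a0.
  rewrite (tonelli_area mI); last by move=> z; rewrite lee_fin.
  rewrite (eq_integral (cst 0%E)) ?integral0 // => x _.
  transitivity (\int[mu1]_y (\1_[set (ga / be : mR)] y : R)%:E)%E.
    apply: eq_integral => y _; rewrite /= !indicE; congr ((nat_of_bool _)%:R%:E).
    apply/idP/idP; rewrite !inE /L /= a0; first by move=> <-; field.
    by move=> ->; field.
  rewrite integral_indic // setIT; exact: lebesgue_measure_set1.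
rewrite (tonelli_area2 mI); last by move=> z; rewrite lee_fin.
rewrite (eq_integral (cst 0%E)) ?integral0 // => y _.
transitivity (\int[mu1]_x (\1_[set ((ga - be * y) / al : mR)] x : R)%:E)%E.
  apply: eq_integral => x _; rewrite /= !indicE; congr ((nat_of_bool _)%:R%:E).
  apply/idP/idP; rewrite !inE /L /=; first by move=> <-; field.
  by move=> ->; field.
rewrite integral_indic // setIT; exact: lebesgue_measure_set1.
Qed.

End PlaneMeasure.

(** * Square-integrable functions *)

(** Evaluation at the minimiser [b / a]; when [a] vanishes and [b] does not, evaluation at a point
    where the value would be -1. *)
Lemma discriminant_le (R : realFieldType) (a b c : R) : 0 <= a ->
  (forall t, 0 <= a * t ^+ 2 - 2 * b * t + c) -> b ^+ 2 <= a * c.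
Proof.
move=> a0 H; have [a1|a1] := eqVneq a 0.
  have [->|b0] := eqVneq b 0; first by rewrite expr0n /= a1 mul0r.
  have := H ((c + 1) / (2 * b)); rewrite a1 mul0r add0r.
  have -> : - (2 * b * ((c + 1) / (2 * b))) + c = -1 by field.
  by rewrite oppr_ge0 ler10.
have a2 : 0 < a by rewrite lt_neqAle eq_sym a1.
have := H (b / a).
have -> : a * (b / a) ^+ 2 - 2 * b * (b / a) + c = c - b ^+ 2 / a by field.
by rewrite subr_ge0 ler_pdivrMr // mulrC.
Qed.

Section SquareIntegrable.
Context d (T : measurableType d) (R : realType) (mu : {measure set T -> \bar R}).
Variable D : set T.
Hypothesis mD : measurable D.

(** [L2 D] unfolds to this notion; on a general measure space the same lemmas serve triangles and
    sides. *)
Definition sqint (f : T -> R) :=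
  measurable_fun D f /\ mu.-integrable D (fun x => (f x ^+ 2)%:E).

Lemma integrable_sum_R (f g : T -> R) : mu.-integrable D (EFin \o f) ->
  mu.-integrable D (EFin \o g) -> mu.-integrable D (EFin \o (fun x => f x + g x)).
Proof. by move=> fi gi; have := integrableD mD fi gi. Qed.

Lemma integrable_scale_R (a : R) (f : T -> R) : mu.-integrable D (EFin \o f) ->
  mu.-integrable D (EFin \o (fun x => a * f x)).
Proof. by move=> fi; have := integrableZl mD a fi. Qed.

Lemma integrable_dom_R (f g : T -> R) : measurable_fun D f ->
  (forall x, D x -> `|f x| <= g x) -> mu.-integrable D (EFin \o g) -> mu.-integrable D (EFin \o f).
Proof.
move=> mf fg; apply: le_integrable => //; first exact/measurable_EFinP.
by move=> x Dx /=; rewrite lee_fin (le_trans (fg _ Dx)) // ler_norm.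
Qed.

Lemma Rintegral_comb (a b : R) (f g : T -> R) : mu.-integrable D (EFin \o f) ->
  mu.-integrable D (EFin \o g) ->
  \int[mu]_(x in D) (a * f x + b * g x) = a * \int[mu]_(x in D) f x + b * \int[mu]_(x in D) g x.
Proof. by move=> fi gi; rewrite RintegralD ?RintegralZl //; exact: integrable_scale_R. Qed.

Lemma Rintegral_scale (a : R) (f : T -> R) : mu.-integrable D (EFin \o f) ->
  \int[mu]_(x in D) (a * f x) = a * \int[mu]_(x in D) f x.
Proof. by move=> fi; rewrite RintegralZl. Qed.

Lemma Rintegral_sub (f g : T -> R) : mu.-integrable D (EFin \o f) ->
  mu.-integrable D (EFin \o g) ->
  \int[mu]_(x in D) (f x - g x) = \int[mu]_(x in D) f x - \int[mu]_(x in D) g x.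
Proof. by move=> fi gi; rewrite RintegralB. Qed.

Lemma Rintegral_add (f g : T -> R) : mu.-integrable D (EFin \o f) ->
  mu.-integrable D (EFin \o g) ->
  \int[mu]_(x in D) (f x + g x) = \int[mu]_(x in D) f x + \int[mu]_(x in D) g x.
Proof. by move=> fi gi; rewrite RintegralD. Qed.

Lemma integrable_sub_R (f g : T -> R) : mu.-integrable D (EFin \o f) ->
  mu.-integrable D (EFin \o g) -> mu.-integrable D (EFin \o (fun x => f x - g x)).
Proof. by move=> fi gi; have := integrableB mD fi gi. Qed.

Lemma integrable_abs_R (f : T -> R) : mu.-integrable D (EFin \o f) ->
  mu.-integrable D (EFin \o (fun x => `|f x|)).
Proof. by move=> fi; have := integrable_norm fi. Qed.

Lemma abs_Rintegral_le (f g : T -> R) : mu.-integrable D (EFin \o f) ->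
  mu.-integrable D (EFin \o g) -> (forall x, D x -> `|f x| <= g x) ->
  `|\int[mu]_(x in D) f x| <= \int[mu]_(x in D) g x.
Proof.
move=> fi gi fg; apply: (le_trans (le_normr_Rintegral mD fi)).
by apply: le_Rintegral => //; exact: integrable_abs_R.
Qed.

Lemma integrable_bddM (M : R) (g h : T -> R) :
  mu.-integrable D (EFin \o g) -> measurable_fun D h -> (forall x, D x -> `|h x| <= M) ->
  mu.-integrable D (EFin \o (fun x => g x * h x)).
Proof.
move=> gi mh hM.
have mg : measurable_fun D g by apply/measurable_EFinP; exact: measurable_int gi.
apply: (integrable_dom_R _ _ (integrable_scale_R M (integrable_abs_R gi))).
  exact: measurable_funM.
by move=> x Dx; rewrite normrM mulrC ler_wpM2r // hM.
Qed.

Lemma sqint_mul (f g : T -> R) : sqint f -> sqint g ->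
  mu.-integrable D (EFin \o (fun x => f x * g x)).
Proof.
move=> [mf fi] [mg gi].
apply: (@integrable_dom_R _ (fun x => f x ^+ 2 + g x ^+ 2)).
- exact: measurable_funM.
- move=> x _; rewrite normrM -(real_normK (num_real (f x))) -(real_normK (num_real (g x))).
  have := sqr_ge0 (`|f x| - `|g x|); have := normr_ge0 (f x); have := normr_ge0 (g x).
  by nra.
- exact: integrable_sum_R.
Qed.

Lemma sqintD (f g : T -> R) : sqint f -> sqint g -> sqint (fun x => f x + g x).
Proof.
move=> f2 g2; have fg := sqint_mul f2 g2; case: f2 => mf fi; case: g2 => mg gi.
split; first exact: measurable_funD.
have := integrable_sum_R (integrable_sum_R fi gi) (integrable_scale_R 2 fg).
by apply: eq_integrable => // x _ /=; congr EFin; ring.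
Qed.

Lemma sqintZ a (f : T -> R) : sqint f -> sqint (fun x => a * f x).
Proof.
move=> [mf fi]; split; first exact: measurable_funM.
have := integrable_scale_R (a ^+ 2) fi.
by apply: eq_integrable => // x _ /=; congr EFin; ring.
Qed.

Lemma sqintB (f g : T -> R) : sqint f -> sqint g -> sqint (fun x => f x - g x).
Proof.
move=> f2 g2; have -> : (fun x => f x - g x) = (fun x => f x + (-1) * g x).
  by apply/funext => x; rewrite mulN1r.
by apply: sqintD => //; exact: sqintZ.
Qed.

Lemma eq_sqint (f g : T -> R) : {in D, f =1 g} -> sqint f -> sqint g.
Proof.
move=> fg [mf fi]; split; first by apply: eq_measurable_fun mf.
by apply: eq_integrable fi => // x Dx; rewrite fg.
Qed.

Lemma sqint_bddM M (f g : T -> R) : measurable_fun D g ->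
  (forall x, D x -> `|g x| <= M) -> sqint f -> sqint (fun x => f x * g x).
Proof.
move=> mg gM [mf fi]; split; first exact: measurable_funM.
apply: (@integrable_dom_R _ (fun x => M ^+ 2 * f x ^+ 2)); last exact: integrable_scale_R.
  by apply: measurable_funX; exact: measurable_funM.
move=> x Dx; rewrite ger0_norm ?sqr_ge0 // exprMn mulrC ler_wpM2r ?sqr_ge0 //.
rewrite -(real_normK (num_real (g x))) ler_sqr ?nnegrE ?normr_ge0 ?gM //.
by apply: le_trans (gM _ Dx).
Qed.

Lemma sqint_bounded M (g : T -> R) : (mu D < +oo)%E -> measurable_fun D g ->
  (forall x, D x -> `|g x| <= M) -> sqint g.
Proof.
move=> Dfin mg gM; have : sqint (fun x => cst 1 x * g x).
  apply: (sqint_bddM mg gM); split => //.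
  apply: (eq_integrable mD (EFin \o cst (1 : R))) => //.
    by move=> x _; rewrite /= expr1n.
  apply/integrableP; split; first exact/measurable_EFinP.
  under eq_integral do rewrite /= normr1.
  by rewrite integral_cst // mul1e.
by apply: eq_sqint => x _; rewrite mul1r.
Qed.

Lemma sqint_integrable (f : T -> R) : (mu D < +oo)%E -> sqint f -> mu.-integrable D (EFin \o f).
Proof.
move=> Dfin f2; have c2 : sqint (cst 1) by apply: (@sqint_bounded 1) => // x _; rewrite normr1.
have := sqint_mul f2 c2.
by apply: eq_integrable => // x _; rewrite /= mulr1.
Qed.

Lemma cauchy_schwarz (f g : T -> R) : sqint f -> sqint g ->
  (\int[mu]_(x in D) (f x * g x)) ^+ 2 <=
  (\int[mu]_(x in D) (f x ^+ 2)) * (\int[mu]_(x in D) (g x ^+ 2)).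
Proof.
move=> f2 g2; apply: discriminant_le => [|t].
  by apply: Rintegral_ge0 => x _; exact: sqr_ge0.
have fg := sqint_mul f2 g2; have [mf fi] := f2; have [mg gi] := g2.
have -> : \int[mu]_(x in D) (f x ^+ 2) * t ^+ 2 - 2 * \int[mu]_(x in D) (f x * g x) * t
    + \int[mu]_(x in D) (g x ^+ 2) = \int[mu]_(x in D) ((t * f x - g x) ^+ 2).
  rewrite [RHS](@eq_Rintegral _ _ _ mu D (fun x => (t ^+ 2 * f x ^+ 2 + (- 2 * t) * (f x * g x)) + g x ^+ 2)).
    rewrite RintegralD //; last by apply: integrable_sum_R; exact: integrable_scale_R.
    rewrite RintegralD //; try exact: integrable_scale_R.
    by rewrite !RintegralZl //; ring.
  by move=> x _; ring.
by apply: Rintegral_ge0 => x _; exact: sqr_ge0.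
Qed.

Lemma sq_integralD_le (f g : T -> R) : sqint f -> sqint g ->
  \int[mu]_(x in D) ((f x + g x) ^+ 2) <=
  2 * \int[mu]_(x in D) (f x ^+ 2) + 2 * \int[mu]_(x in D) (g x ^+ 2).
Proof.
move=> f2 g2; have fg := sqintD f2 g2; have [mf fi] := f2; have [mg gi] := g2.
rewrite -!RintegralZl // -RintegralD //; try exact: integrable_scale_R.
apply: le_Rintegral => //; first by case: fg.
  by apply: integrable_sum_R; exact: integrable_scale_R.
by move=> x _; have := sqr_ge0 (f x - g x); nra.
Qed.

Lemma Rintegral_dominated_cvg (h : nat -> T -> R) (f g : T -> R) :
  (forall n, measurable_fun D (h n)) -> (forall x, D x -> h n x @[n --> \oo] --> f x) ->
  mu.-integrable D (EFin \o g) -> (forall n x, D x -> `|h n x| <= g x) ->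
  \int[mu]_(x in D) h n x @[n --> \oo] --> \int[mu]_(x in D) f x.
Proof.
move=> mh hf gi hg.
have mh' n : measurable_fun D (EFin \o h n) by exact/measurable_EFinP.
have hf' x : D x -> (EFin \o h n) x @[n --> \oo] --> (EFin \o f) x.
  by move=> Dx; apply: cvg_EFin; [exact: nearW|exact: hf].
have hg' n x : D x -> (`|(EFin \o h n) x| <= (EFin \o g) x)%E.
  by move=> Dx; rewrite lee_fin; exact: hg.
have C := dominated_cvg mD mh' hf' (fun x _ => (isT : (EFin \o g) x \is a fin_num)) gi hg'.
have mf : measurable_fun D (EFin \o f) by exact: (emeasurable_fun_cvg (fun n => EFin \o h n)).
have fi : mu.-integrable D (EFin \o f).
  apply: (le_integrable mD mf _ gi) => x Dx; rewrite /= lee_fin [leRHS]ger0_norm; last by rewrite (le_trans _ (hg 0%N x Dx)).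
  apply: (ler_cvg_to (cvg_norm (hf x Dx)) (cvg_cst (g x))).
  by apply: nearW => n; exact: hg.
apply: fine_cvg; rewrite fineK //; exact: integrable_fin_num.
Qed.

(** By Cauchy-Schwarz, strong convergence gives convergence of pairings with a fixed function;
    Green's formula passes to the limit this way. *)
Lemma cvg_integral_mul (v : nat -> T -> R) (u g : T -> R) :
  (forall n, sqint (v n)) -> sqint u -> sqint g ->
  \int[mu]_(x in D) ((v n x - u x) ^+ 2) @[n --> \oo] --> (0 : R) ->
  \int[mu]_(x in D) (v n x * g x) @[n --> \oo] --> \int[mu]_(x in D) (u x * g x).
Proof.
move=> v2 u2 g2 vu; set G := \int[mu]_(x in D) (g x ^+ 2).
have vG : Num.sqrt (\int[mu]_(x in D) ((v n x - u x) ^+ 2) * G) @[n --> \oo] --> (0 : R).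
  rewrite -[X in _ --> X](@sqrtr0 R) -[X in Num.sqrt X](mul0r G).
  by apply: continuous_cvg; [exact: sqrt_continuous|exact: cvgMl].
apply/cvgrPdist_lt => e e0; near=> n.
rewrite -RintegralB //; try exact: sqint_mul.
apply: le_lt_trans (_ : Num.sqrt (\int[mu]_(x in D) ((v n x - u x) ^+ 2) * G) < e).
  rewrite -sqrtr_sqr; apply: ler_wsqrtr.
  have := cauchy_schwarz (sqintB (v2 n) u2) g2; apply: le_trans.
  rewrite -[leRHS]sqrrN -[X in _ <= X ^+ 2]mulN1r -RintegralZl //; last first.
    by apply: sqint_mul => //; exact: sqintB.
  by rewrite le_eqVlt; apply/orP; left; apply/eqP; congr (_ ^+ 2); apply: eq_Rintegral => x _; ring.
have : `|0 - Num.sqrt (\int[mu]_(x in D) ((v n x - u x) ^+ 2) * G)| < e.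
  by near: n; move/cvgrPdist_lt : vG; exact.
by rewrite sub0r normrN; apply: le_lt_trans; exact: ler_norm.
Unshelve. all: by end_near. Qed.

End SquareIntegrable.

(** * Smooth functions, cut-offs and mollification *)

Section Smooth.
Context {R : realType}.
Notation pt := (R * R)%type.

Definition lform (a b : R) (h : pt) : R := a * h.1 + b * h.2.

Lemma lform_is_linear a b : linear (lform a b : pt -> R).
Proof. by move=> k x y; rewrite /lform /= /GRing.scale /=; ring. Qed.
HB.instance Definition _ a b := GRing.isLinear.Build R pt R *:%R (lform a b) (lform_is_linear a b).

Lemma continuous_lform a b : continuous (lform a b).
Proof.
move=> x; apply: cvgD; apply: cvgM; try exact: cvg_cst.
  exact: cvg_fst.
exact: cvg_snd.
Qed.

(** A quadratic remainder is [o(h)], so the continuous linear map [L] is the differential.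
    Differentiability of flat functions and of convolutions is obtained from such explicit
    remainders. *)
Lemma quadratic_is_diff (V W : normedModType R) (f : V -> W) (L : {linear V -> W}) (x : V) (M : R) :
  continuous L -> (forall h, `|f (x + h) - f x - L h| <= M * `|h| ^+ 2) ->
  differentiable f x /\ 'd f x = L :> (V -> W).
Proof.
move=> cL fM.
have fo : f \o shift x = cst (f x) + L +o_ 0 id.
  apply/eqaddoP => e e0.
  have small : \forall h \near (0 : V), M * `|h| <= e.
    have [M0|M0] := leP M 0.
      by apply: nearW => h; rewrite (le_trans _ (ltW e0)) // mulr_le0_ge0.
    have eM : 0 < e / M by rewrite divr_gt0.
    apply: filterS (nbhs0_lt eM) => h hM.
    by rewrite -ler_pdivlMl // mulrC ltW.
  near=> h.
  have -> : (f \o shift x - (cst (f x) + L)) h = f (x + h) - f x - L h.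
    by rewrite /= !fctE /= [h + x]addrC opprD addrA.
  apply: le_trans (fM h) _; rewrite expr2 mulrA ler_wpM2r //.
  by near: h.
have dE := diff_unique cL fo.
by split=> //; apply/diff_locallyP; rewrite dE.
Unshelve. all: by end_near. Qed.

Lemma quadratic_differentiable (f : pt -> R) (x : pt) (a b M : R) :
  (forall h, `|f (x + h) - f x - lform a b h| <= M * `|h| ^+ 2) ->
  differentiable f x /\ forall v, 'D_v f x = lform a b v.
Proof.
move=> fM.
have [df dE] := @quadratic_is_diff _ _ f (lform a b) x M (@continuous_lform a b) fM.
by split => // v; rewrite deriveE // dE.
Qed.

Lemma smooth_differentiable (phi : pt -> R) x : smooth phi -> differentiable phi x.
Proof. by move=> /(_ [::] x). Qed.

Lemma smooth_derive (phi : pt -> R) v : smooth phi -> smooth ('D_v phi).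
Proof.
move=> sp vs x; by have := sp (rcons vs v) x; rewrite foldr_rcons.
Qed.

(** Coinductive principle for smoothness: instead of handling iterated derivatives, a proof exhibits
    a class of differentiable functions that is stable under directional derivatives. *)
Lemma smooth_class (S : set (pt -> R)) :
  (forall f x, S f -> differentiable f x) -> (forall f v, S f -> S ('D_v f)) -> S `<=` smooth.
Proof.
move=> dS DS f Sf vs x; apply: dS.
by elim: vs => //= v vs IH; exact: DS.
Qed.

Lemma differentiable_continuous_plane (f : pt -> R) :
  (forall x, differentiable f x) -> continuous f.
Proof. by move=> df x; apply: differentiable_continuous. Qed.

Lemma deriveDE (f : pt -> R) x v : differentiable f x ->
  'D_v f x = v.1 * 'D_e1 f x + v.2 * 'D_e2 f x.
Proof.
move=> df; rewrite !deriveE // -[LHS]/('d f x v).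
have -> : v = v.1 *: e1 + v.2 *: e2 :> pt.
  by rewrite [LHS]surjective_pairing; congr (_, _); rewrite /= /GRing.scale /=; ring.
rewrite linearD !linearZ /= /GRing.scale /=; congr (_ * _ + _ * _); ring.
Qed.

Lemma smoothD (f g : pt -> R) : smooth f -> smooth g -> smooth (fun x => f x + g x).
Proof.
move=> sf sg; apply: (@smooth_class [set h | exists f g, [/\ smooth f, smooth g & h = f \+ g]]); last by exists f, g.
  by move=> _ x [f' [g' [sf' sg' ->]]]; apply: differentiableD; exact: smooth_differentiable.
move=> _ v [f' [g' [sf' sg' ->]]]; exists ('D_v f'), ('D_v g'); split; try exact: smooth_derive.
apply/funext => x; apply: deriveD; apply: diff_derivable; exact: smooth_differentiable.
Qed.

Lemma smooth_cst (c : R) : smooth (fun _ : pt => c).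
Proof.
apply: (@smooth_class [set h | exists c, h = cst c]); last by exists c.
  by move=> _ x [? ->]; exact: differentiable_cst.
by move=> _ v [c' ->]; exists 0; apply/funext => x; rewrite derive_cst.
Qed.

Lemma continuous_smooth_derive (f : pt -> R) v : smooth f -> continuous ('D_v f).
Proof.
by move=> sf; apply: differentiable_continuous_plane => x; apply/smooth_differentiable/smooth_derive.
Qed.

End Smooth.

(** * Flat functions, and stability of smoothness under products *)

Section Bump.
Context {R : realType}.
Notation pt := (R * R)%type.

(** The bound [n%:R ^+ n] comes from [y / n <= exp (y / n)] raised to the power [n]. *)
Lemma exprn_expRN_bounded n : exists M : R, forall y : R, 0 <= y -> y ^+ n * expR (- y) <= M.
Proof.
have [->|n0] := eqVneq n 0%N.
  by exists 1 => y y0; rewrite expr0 mul1r -expR0 ler_expR oppr_le0.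
have np : 0 < n%:R :> R by rewrite ltr0n lt0n.
exists (n%:R ^+ n) => y y0.
rewrite expRN ler_pdivrMr ?expR_gt0 //.
have -> : expR y = expR (y / n%:R) ^+ n by rewrite -expRM_natl mulrC divfK // gt_eqF.
rewrite -exprMn lerXn2r ?nnegrE // ?mulr_ge0 ?expR_ge0 //.
rewrite -ler_pdivrMl // mulrC; apply: le_trans (expR_ge1Dx _).
by rewrite lerDr.
Qed.

Lemma horner_expRN_bounded (p : {poly R}) :
  exists M : R, forall y : R, 0 <= y -> `|p.[y]| * expR (- y) <= M.
Proof.
pose B n := projT1 (cid (exprn_expRN_bounded n)).
have HB n y : 0 <= y -> y ^+ n * expR (- y) <= B n := projT2 (cid (exprn_expRN_bounded n)) y.
exists (\sum_(i < size p) `|p`_i| * B i) => y y0.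
rewrite horner_coef; apply: le_trans (_ : (\sum_(i < size p) `|p`_i * y ^+ i|) * expR (- y) <= _).
  by rewrite ler_wpM2r ?expR_ge0 // ler_norm_sum.
rewrite mulr_suml; apply: ler_sum => i _.
by rewrite normrM -mulrA ler_wpM2l // normrX ger0_norm // HB.
Qed.

(* The derivative of [p(1/x) exp(-1/x)] is again of this form. *)
Definition flat_poly (p : {poly R}) (x : R) : R :=
  if 0 < x then p.[x^-1] * expR (- x^-1) else 0.

Lemma flat_poly_derive (p : {poly R}) (x : R) :
  is_derive x 1 (flat_poly p) (flat_poly ('X^2 * (p - p^`())) x).
Proof.
have [x0|x0|->] := ltgtP x 0.
- have -> : flat_poly ('X^2 * (p - p^`())) x = 0 by rewrite /flat_poly ltNge ltW.
  refine (@near_eq_is_derive _ _ _ (cst 0) _ x 1 0 _ _).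
  near=> y; rewrite /flat_poly ltNge ltW //; near: y; exact: lt_nbhsl.
- have E : flat_poly ('X^2 * (p - p^`())) x = (p - p^`()).[x^-1] * x^-1 ^+ 2 * expR (- x^-1).
    by rewrite /flat_poly x0 hornerM hornerXn; ring.
  refine (@near_eq_is_derive _ _ _ ((fun y => p.[y] * expR (- y)) \o GRing.inv) _ x 1 _ _ _).
    by near=> y; rewrite /flat_poly ifT //; near: y; exact: lt_nbhsr.
  have dV : is_derive x 1 (@GRing.inv R) (- x ^- 2).
    have := @is_deriveV _ id x 1 1 (lt0r_neq0 x0) (is_derive_id _ _).
    by rewrite /GRing.scale /= mulr1.
  have dp (y : R) : is_derive y 1 (horner p) p^`().[y].
    by rewrite derivE derive1E; apply: DeriveDef => //; exact: derivable_horner.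
  have de (y : R) : is_derive y 1 (fun y : R => expR (- y)) (- expR (- y)).
    have := @is_derive1_comp R expR -%R y _ _ (is_derive_expR _) (is_deriveN _).
    by move=> /(_ 1 (is_derive_id _ _)); rewrite mulrN1.
  have := @is_derive1_comp R _ _ x _ _ (is_deriveM (dp x^-1) (de x^-1)) dV.
  move=> HH; refine (is_derive_eq HH _).
  by rewrite E /GRing.scale /= hornerD hornerN; field; exact: lt0r_neq0.
- have -> : flat_poly ('X^2 * (p - p^`())) 0 = 0 by rewrite /flat_poly ltxx.
  (* Read at [y = h^-1], boundedness of [y ^+ 2 * p.[y] * expR (- y)] says that [flat_poly p h] is
     [O(h^2)], which gives derivative zero at the origin. *)
  have [M HM] := horner_expRN_bounded ('X^2 * p).
  have fM (h : R) : `|flat_poly p (0 + h) - flat_poly p 0 - (\0 : {linear R -> R}) h| <= M * `|h| ^+ 2.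
    rewrite add0r /flat_poly ltxx !subr0; case: ifPn => [h0|_]; last first.
      by rewrite normr0 mulr_ge0 // (le_trans _ (HM 0 (lexx _))) // mulr_ge0 ?expR_ge0.
    have := HM h^-1; rewrite invr_ge0 (ltW h0) => /(_ isT).
    rewrite hornerM hornerXn [`|_ * p.[_]|]normrM [`|_ ^+ 2|]normrX [`|p.[_] * _|]normrM.
    rewrite (gtr0_norm (expR_gt0 _)) normfV => HH.
    rewrite -ler_pdivrMr ?exprn_gt0 ?normr_gt0 ?gt_eqF //; apply: le_trans HH.
    by rewrite exprVn le_eqVlt; apply/orP; left; apply/eqP; ring.
  have c0 : continuous (\0 : {linear R -> R}) by move=> z; exact: cvg_cst.
  have [df dE] := quadratic_is_diff c0 fM.
  have df1 : derivable (flat_poly p) (0 : R) 1 by apply/derivable1_diffP.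
  by apply: DeriveDef => //; rewrite deriveE // dE.
Unshelve. all: by end_near. Qed.

Lemma flat_poly_derive1 p : (flat_poly p)^`()%classic = flat_poly ('X^2 * (p - p^`())).
Proof. by apply/funext => x; rewrite derive1E; have /@derive_val := flat_poly_derive p x. Qed.

Lemma is_diff_lform (al be ga : R) (x : pt) :
  differentiable (fun y => lform al be y + ga) x /\ 'd (fun y => lform al be y + ga) x = lform al be :> (pt -> R).
Proof.
apply: (@quadratic_is_diff _ _ _ _ (lform al be) x 0 (@continuous_lform _ al be)) => h.
by rewrite linearD mul0r (_ : _ - _ - _ = 0) ?normr0 //; ring.
Qed.

Lemma smooth_flat_poly_lform p (al be ga : R) : smooth (fun x : pt => flat_poly p (lform al be x + ga)).
Proof.
have dfl c q (x : pt) : differentiable (fun x : pt => c * flat_poly q (lform al be x + ga)) x /\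
    forall v, 'D_v (fun x : pt => c * flat_poly q (lform al be x + ga)) x =
      c * lform al be v * flat_poly ('X^2 * (q - q^`())) (lform al be x + ga).
  have [dl lE] := is_diff_lform al be ga x.
  have df : differentiable (flat_poly q) (lform al be x + ga).
    by apply/derivable1_diffP; have [] := flat_poly_derive q (lform al be x + ga).
  have dc := differentiable_comp dl df.
  have dz : differentiable (fun x : pt => c * flat_poly q (lform al be x + ga)) x.
    exact: (differentiableZ c dc).
  split => // v; rewrite deriveE // (diffZ c dc) /= diff_comp //= lE.
  by rewrite deriv1E ?flat_poly_derive1 /GRing.scale /=; [ring|apply/derivable1_diffP].
apply: (@smooth_class _ [set h | exists c p, h = fun x : pt => c * flat_poly p (lform al be x + ga)]).
- by move=> _ x [c [q ->]]; have [] := dfl c q x.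
- move=> _ v [c [q ->]]; exists (c * lform al be v), ('X^2 * (q - q^`())).
  by apply/funext => x; have [_ ->] := dfl c q x.
- by exists 1, p; apply/funext => x; rewrite mul1r.
Qed.

(** By the Leibniz rule the derivative of a product is a sum of two products, so this class is
    stable under directional derivatives. *)
Inductive smooth_products : (pt -> R) -> Prop :=
| sp_mul f g : smooth f -> smooth g -> smooth_products (f \* g)
| sp_add f g : smooth_products f -> smooth_products g -> smooth_products (f \+ g).

Lemma smoothM (f g : pt -> R) : smooth f -> smooth g -> smooth (fun x => f x * g x).
Proof.
move=> sf sg.
have DD h : smooth_products h -> forall x, differentiable h x.
  elim => [f1 g1 sf1 sg1|f1 g1 _ IH1 _ IH2] x.
    by apply: differentiableM; exact: smooth_differentiable.
  exact: differentiableD.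
apply: (@smooth_class _ [set h | smooth_products h]); last exact: sp_mul.
  by move=> h x sh; exact: DD.
move=> h v; elim => [f1 g1 sf1 sg1|f1 g1 h1 IH1 h2 IH2].
  have -> : 'D_v (f1 \* g1) = ('D_v f1 \* g1) \+ (f1 \* 'D_v g1).
    apply/funext => x; rewrite deriveM; try by apply/diff_derivable/smooth_differentiable.
    by rewrite /GRing.scale /= addrC [g1 x * _]mulrC.
  by apply: sp_add; apply: sp_mul => //; exact: smooth_derive.
have -> : 'D_v (f1 \+ g1) = 'D_v f1 \+ 'D_v g1.
  by apply/funext => x; rewrite deriveD //; apply/diff_derivable/DD.
exact: sp_add.
Qed.

Lemma smooth_lform (al be ga : R) : smooth (fun x : pt => lform al be x + ga).
Proof.
apply: (@smooth_class _ [set h | exists al be ga, h = fun x : pt => lform al be x + ga]); last by exists al, be, ga.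
  by move=> _ x [a [b [c ->]]]; have [] := is_diff_lform a b c x.
move=> _ v [a [b [c ->]]]; exists 0, 0, (lform a b v); apply/funext => x.
have [dl lE] := is_diff_lform a b c x.
by rewrite deriveE // lE /lform !mul0r add0r add0r.
Qed.

End Bump.

(** * Test functions and a uniform Taylor bound *)

Section TestFunctions.
Context {R : realType}.
Notation pt := (R * R)%type.

Definition compactly_supported (phi : pt -> R) := compact (closure [set x | phi x != 0]).

Lemma derive_eq0_off_support (phi : pt -> R) v x :
  ~ closure [set x | phi x != 0] x -> 'D_v phi x = 0.
Proof.
move=> nx.
have [U Ux Un] : exists2 U, nbhs x U & forall y, U y -> phi y = 0.
  have : nbhs x (~` closure [set x | phi x != 0]).
    by apply: open_nbhs_nbhs; split => //; apply: closed_openC; exact: closed_closure.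
  move=> H; exists (~` closure [set x | phi x != 0]) => // y ny.
  by apply/eqP; apply/negP => /negP yn; apply: ny; exact: subset_closure.
have xO : \near x, (cst 0 : pt -> R) x = phi x.
  by apply: filterS Ux => y /Un ->.
by rewrite -(near_eq_derive v xO) derive_cst.
Qed.

Lemma compactly_supported_derive (phi : pt -> R) v :
  compactly_supported phi -> compactly_supported ('D_v phi).
Proof.
move=> cphi; apply: (subclosed_compact _ cphi); first exact: closed_closure.
have : [set x | 'D_v phi x != 0] `<=` closure [set x | phi x != 0].
  move=> x /= /eqP D0; apply: contrapT => nx; apply: D0.
  exact: derive_eq0_off_support.
have E := (closure_id (closure [set x | phi x != 0])).1 (@closed_closure _ _).
by move/closure_subset; rewrite -E.
Qed.

Lemma compactly_supported_bounded (phi : pt -> R) : continuous phi ->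
  compactly_supported phi -> exists M, 0 <= M /\ forall x, `|phi x| <= M.
Proof.
move=> cf cphi.
have /compact_bounded [M [Mr HM]] : compact (phi @` closure [set x | phi x != 0]).
  by apply: continuous_compact => //; apply: continuous_subspaceT.
exists (`|M| + 1); split; first by rewrite addr_ge0.
move=> x; have [->|nx] := eqVneq (phi x) 0; first by rewrite normr0 addr_ge0.
apply: (HM (`|M| + 1)); first by rewrite (le_lt_trans (ler_norm M)) // ltrDl.
by exists x => //; exact: subset_closure.
Qed.

Lemma line_derive (phi : pt -> R) (x h : pt) (t : R) : (forall y, differentiable phi y) ->
  is_derive t (1 : R) (fun s : R => phi (x + s *: h)) ('D_h phi (x + t *: h)).
Proof.
move=> dphi.
pose g s := phi (x + s *: h).
have E : (fun k : R => k^-1 *: ((g \o shift t) (k *: (1 : R)) - g t)) =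
         (fun k : R => k^-1 *: ((phi \o shift (x + t *: h)) (k *: h) - phi (x + t *: h))).
  apply/funext => k; rewrite /g /=; congr (_ *: (phi _ - _)).
  by rewrite [k *: 1]mulr1 scalerDl addrCA.
have := diff_derivable (v:=h) (dphi (x + t *: h)); rewrite /derivable -E => dg.
by apply: DeriveDef => //; rewrite /derive E.
Qed.

Lemma mean_value_plane (phi : pt -> R) (x h : pt) : (forall y, differentiable phi y) ->
  exists2 t : R, 0 <= t <= 1 & phi (x + h) - phi x = 'D_h phi (x + t *: h).
Proof.
move=> dphi.
have [t t01 E] := @MVT_segment R (fun s => phi (x + s *: h)) (fun s => 'D_h phi (x + s *: h)) 0 1
  ler01 (fun t _ => line_derive x h t dphi) (continuous_subspaceT
   (fun t => differentiable_continuous ((derivable1_diffP _ _).1 (@ex_derive _ _ _ _ _ _ _ (line_derive x h t dphi))))).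
exists t; first by move: t01; rewrite in_itv.
by move: E; rewrite scale1r scale0r addr0 subr0 mulr1.
Qed.

Lemma lipschitz_bounded_derive (phi : pt -> R) M : (forall y, differentiable phi y) ->
  0 <= M -> (forall y, `|'D_e1 phi y| <= M) -> (forall y, `|'D_e2 phi y| <= M) ->
  forall x h, `|phi (x + h) - phi x| <= 2 * M * `|h|.
Proof.
move=> dphi M0 M1 M2 x h; have [t _ ->] := mean_value_plane x h dphi.
rewrite deriveDE // (le_trans (ler_normD _ _)) // !normrM.
have h1 : `|h.1| <= `|h| by rewrite prod_normE le_max lexx.
have h2 : `|h.2| <= `|h| by rewrite prod_normE le_max lexx orbT.
have D1 := ler_pM (normr_ge0 _) (normr_ge0 _) h1 (M1 (x + t *: h)).
have D2 := ler_pM (normr_ge0 _) (normr_ge0 _) h2 (M2 (x + t *: h)).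
apply: le_trans (lerD D1 D2) _; rewrite le_eqVlt; apply/orP; left; apply/eqP.
ring.
Qed.

(** Compact support bounds the second derivatives, hence makes the first ones Lipschitz; the mean
    value theorem does the rest. Uniformity in [x] is what permits differentiation under an
    integral. *)
Lemma taylor2_uniform (phi : pt -> R) : smooth phi -> compactly_supported phi ->
  exists M, forall x h,
    `|phi (x + h) - phi x - lform ('D_e1 phi x) ('D_e2 phi x) h| <= M * `|h| ^+ 2.
Proof.
move=> sphi cphi.
have B v w : exists M, 0 <= M /\ forall x, `|'D_w ('D_v phi) x| <= M.
  apply: compactly_supported_bounded.
    exact/continuous_smooth_derive/smooth_derive.
  by do 2 apply: compactly_supported_derive.
have L v : exists M, 0 <= M /\ forall x h, `|'D_v phi (x + h) - 'D_v phi x| <= M * `|h|.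
  have [M1 [M10 H1]] := B v e1; have [M2 [M20 H2]] := B v e2.
  exists (2 * (M1 + M2)); split; first by rewrite mulr_ge0 // addr_ge0.
  apply: lipschitz_bounded_derive; last 3 first.
  - by rewrite addr_ge0.
  - by move=> y; rewrite (le_trans (H1 y)) // lerDl.
  - by move=> y; rewrite (le_trans (H2 y)) // lerDr.
  by move=> y; apply/smooth_differentiable/smooth_derive.
have [M1 [M10 H1]] := L e1; have [M2 [M20 H2]] := L e2.
exists (M1 + M2) => x h.
have dphi y : differentiable phi y by exact: smooth_differentiable.
have [t /andP[t0 t1] ->] := mean_value_plane x h dphi.
rewrite deriveDE // /lform.
have h1 : `|h.1| <= `|h| by rewrite prod_normE le_max lexx.
have h2 : `|h.2| <= `|h| by rewrite prod_normE le_max lexx orbT.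
have th : `|t *: h| <= `|h| by rewrite normrZ ger0_norm // ler_piMl.
have d1 : `|'D_e1 phi (x + t *: h) - 'D_e1 phi x| <= M1 * `|h|.
  by apply: le_trans (H1 _ _) _; rewrite ler_wpM2l.
have d2 : `|'D_e2 phi (x + t *: h) - 'D_e2 phi x| <= M2 * `|h|.
  by apply: le_trans (H2 _ _) _; rewrite ler_wpM2l.
rewrite (_ : _ - _ = h.1 * ('D_e1 phi (x + t *: h) - 'D_e1 phi x)
   + h.2 * ('D_e2 phi (x + t *: h) - 'D_e2 phi x)); last by ring.
rewrite (le_trans (ler_normD _ _)) // !normrM.
have D1 := ler_pM (normr_ge0 _) (normr_ge0 _) h1 d1.
have D2 := ler_pM (normr_ge0 _) (normr_ge0 _) h2 d2.
apply: le_trans (lerD D1 D2) _; rewrite le_eqVlt; apply/orP; left; apply/eqP.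
by rewrite mulrDl expr2; congr (_ + _); rewrite mulrCA.
Qed.

End TestFunctions.

(** * A normalised bump *)

Section Kernel.
Context {R : realType}.
Notation pt := (R * R)%type.
Notation mR := (measurableTypeR R).
Notation mpt := (mR * mR)%type.
Notation mu1 := (@lebesgue_measure R).

(** The bump [exp (- 1/(1+t)) exp (- 1/(1-t))] on []-1, 1[], extended by zero. *)
Definition hat (t : R) : R := flat_poly 1 (1 + t) * flat_poly 1 (1 - t).

Lemma flat_poly1_ge0 (x : R) : 0 <= flat_poly 1 x.
Proof. by rewrite /flat_poly; case: ifP => // _; rewrite hornerC mul1r expR_ge0. Qed.

Lemma hat_ge0 t : 0 <= hat t.
Proof. by rewrite mulr_ge0 ?flat_poly1_ge0. Qed.

Lemma hat_even t : hat (- t) = hat t.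
Proof. by rewrite /hat opprK mulrC. Qed.

Lemma hat_neq0 t : hat t != 0 -> `|t| < 1.
Proof.
rewrite /hat /flat_poly ltr_norml; case: ifPn => [h1|_]; last by rewrite mul0r eqxx.
by case: ifPn => [h2 _|_]; [apply/andP; split; lra|rewrite mulr0 eqxx].
Qed.

Lemma hat_le1 t : hat t <= 1.
Proof.
have H (x : R) : flat_poly 1 x <= 1.
  rewrite /flat_poly; case: ifPn => // x0; rewrite hornerC mul1r -expR0 ler_expR.
  by rewrite oppr_le0 invr_ge0 ltW.
by rewrite /hat -[leRHS]mulr1 ler_pM ?flat_poly1_ge0.
Qed.

Lemma hat_ge t : `|t| <= 2^-1 -> expR (- 4) <= hat t.
Proof.
rewrite ler_norml => /andP[h1 h2].
have H (x : R) : 2^-1 <= x -> expR (- 2) <= flat_poly 1 x.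
  move=> hx; have x0 : 0 < x by apply: lt_le_trans hx; rewrite invr_gt0.
  rewrite /flat_poly x0 hornerC mul1r ler_expR lerN2 -[leRHS]invrK lef_pV2 ?posrE ?invr_gt0 //.
have -> : expR (- 4) = expR (- 2) * expR (- 2) :> R by rewrite -expRD; congr expR; ring.
by apply: ler_pM; rewrite ?expR_ge0 // H //; lra.
Qed.

Lemma continuous_flat_poly p : continuous (@flat_poly R p).
Proof.
move=> x; apply: differentiable_continuous; apply/derivable1_diffP.
by have [] := flat_poly_derive p x.
Qed.

Lemma continuous_hat : continuous hat.
Proof.
move=> t; apply: cvgM.
  apply: (cvg_comp (fun t => 1 + t) (flat_poly 1)); last exact: continuous_flat_poly.
  by apply: cvgD; [exact: cvg_cst|exact: cvg_id].
apply: (cvg_comp (fun t => 1 - t) (flat_poly 1)); last exact: continuous_flat_poly.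
by apply: cvgB; [exact: cvg_cst|exact: cvg_id].
Qed.

Lemma measurable_hat : measurable_fun setT (hat : mR -> R).
Proof. exact: continuous_measurable_fun continuous_hat. Qed.

Lemma integral_hat_fin : (0 < \int[mu1]_t (hat t)%:E < +oo)%E.
Proof.
apply/andP; split.
  apply: (@lt_le_trans _ _ (\int[mu1]_(t in `[(- 2^-1)%R, (2^-1)%R]) (expR (- 4))%:E)%E).
    rewrite integral_cst //= lebesgue_measure_itv /= lte_fin ifT; last by lra.
    by rewrite -EFinD -EFinM lte_fin mulr_gt0 ?expR_gt0 //; lra.
  apply: (@le_trans _ _ (\int[mu1]_(t in `[(- 2^-1)%R, (2^-1)%R]) (hat t)%:E)%E).
    apply: ge0_le_integral => //.
    - by apply/measurable_EFinP; apply: measurable_funTS; exact: measurable_hat.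
    - move=> t /=; rewrite in_itv /= => /andP[h1 h2]; rewrite lee_fin hat_ge // ler_norml.
      by rewrite h1 h2.
  apply: ge0_subset_integral => //.
    by apply/measurable_EFinP; exact: measurable_hat.
  by move=> t _; rewrite lee_fin hat_ge0.
rewrite (_ : (fun t => _) = EFin \o hat) //.
have -> : (\int[mu1]_t (EFin \o hat) t = \int[mu1]_(t in `[(-1)%R, 1%R]) (EFin \o hat) t)%E.
  rewrite [RHS]integral_mkcond; apply: eq_integral => t _.
  rewrite patchE; case: ifPn => // /negP nt; congr EFin; apply/eqP.
  apply: contrapT => /negP /hat_neq0; rewrite ltr_norml => /andP[h1 h2].
  by apply: nt; rewrite inE /= in_itv /= !ltW.
apply: (@le_lt_trans _ _ (\int[mu1]_(t in `[(-1)%R, 1%R]) (cst 1%E t))%E).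
  apply: ge0_le_integral => //; try by move=> t _; rewrite lee_fin hat_ge0.
  - by apply/measurable_EFinP; apply: measurable_funTS; exact: measurable_hat.
  - by move=> t _; rewrite lee_fin hat_le1.
rewrite integral_cst //= lebesgue_measure_itv /= mul1e; case: ifP => _; rewrite ?ltry //.
Qed.

Definition hat_mass : R := fine (\int[mu1]_t (hat t)%:E).

Lemma hat_massE : (\int[mu1]_t (hat t)%:E = hat_mass%:E)%E.
Proof.
have /andP[h0 hy] := integral_hat_fin.
by rewrite fineK // ge0_fin_numE // ltW.
Qed.

Lemma hat_mass_gt0 : 0 < hat_mass.
Proof. by have /andP[] := integral_hat_fin; rewrite hat_massE lte_fin. Qed.

(** A tensor product, so the mass is a product of one-dimensional masses and the support lies in a
    square, which is a ball for the max norm of [R * R]. *)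
Definition cutoff (s : R) (c y : pt) : R :=
  (s * hat_mass)^-1 ^+ 2 * (hat ((y.1 - c.1) / s) * hat ((y.2 - c.2) / s)).

Lemma cutoff_ge0 s c y : 0 <= cutoff s c y.
Proof. by rewrite mulr_ge0 ?sqr_ge0 // mulr_ge0 ?hat_ge0. Qed.

Lemma cutoff_sym s c y : cutoff s c y = cutoff s y c.
Proof.
rewrite /cutoff; congr (_ * (_ * _)).
  by rewrite -hat_even -mulNr opprB.
by rewrite -hat_even -mulNr opprB.
Qed.

Lemma cutoff_shift s c y : cutoff s c y = cutoff s 0 (y - c).
Proof. by rewrite /cutoff /= !subr0. Qed.

Lemma cutoff_neq0 s c y : 0 < s -> cutoff s c y != 0 -> `|y - c| < s.
Proof.
move=> s0 b0.
have /hat_neq0 h1 : hat ((y.1 - c.1) / s) != 0.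
  by apply: contra_neq b0 => E; rewrite /cutoff E mul0r mulr0.
have /hat_neq0 h2 : hat ((y.2 - c.2) / s) != 0.
  by apply: contra_neq b0 => E; rewrite /cutoff E !mulr0.
rewrite prod_normE gt_max /=; move: h1 h2.
by rewrite !normrM normfV (gtr0_norm s0) !ltr_pdivrMr // !mul1r => -> ->.
Qed.

Lemma smooth_cutoff s c : smooth (cutoff s c).
Proof.
have H (al be : R) : smooth (fun y : pt => hat (lform al be y + (- lform al be c))).
  apply: smoothM.
    rewrite (_ : (fun _ => _) = fun y : pt => flat_poly 1 (lform al be y + (1 - lform al be c))).
      exact: smooth_flat_poly_lform.
    by apply/funext => y; rewrite addrCA.
  rewrite (_ : (fun _ => _) = fun y : pt => flat_poly 1 (lform (- al) (- be) y + (1 + lform al be c))).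
    exact: smooth_flat_poly_lform.
  by apply/funext => y; congr (flat_poly _ _); rewrite /lform; ring.
apply: smoothM; first exact: smooth_cst.
apply: smoothM.
  rewrite (_ : (fun _ => _) = fun y : pt => hat (lform s^-1 0 y + (- lform s^-1 0 c))) //.
  by apply/funext => y; congr hat; rewrite /lform; ring.
rewrite (_ : (fun _ => _) = fun y : pt => hat (lform 0 s^-1 y + (- lform 0 s^-1 c))) //.
by apply/funext => y; congr hat; rewrite /lform; ring.
Qed.

Lemma cutoff_support s c : 0 < s ->
  compact (closure [set y | cutoff s c y != 0]) /\
  closure [set y | cutoff s c y != 0] `<=` [set y | `|y - c| <= s].
Proof.
move=> s0.
pose B : set pt := `[c.1 - s, c.1 + s]%classic `*` `[c.2 - s, c.2 + s]%classic.
have BE : B = [set y | `|y - c| <= s].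
  apply/seteqP; split => y /=; rewrite /B /= !in_itv /= prod_normE ge_max /= !ler_norml.
    by move=> [/andP[? ?] /andP[? ?]]; apply/andP; split; apply/andP; split; lra.
  by move=> /andP[/andP[? ?] /andP[? ?]]; split; apply/andP; split; lra.
have cB : compact B by apply: compact_setX; exact: segment_compact.
have sB : closure [set y | cutoff s c y != 0] `<=` B.
  have clB : closed B by apply: compact_closed => //; exact: norm_hausdorff.
  rewrite [X in _ `<=` X](closure_id B).1 //; apply: closure_subset => y /=.
  by move=> /(cutoff_neq0 s0) /ltW; rewrite BE.
split; last by rewrite -BE.
exact: subclosed_compact (@closed_closure _ _) cB sB.
Qed.

Lemma measurable_cutoff s c : measurable_fun setT (cutoff s c : mpt -> R).
Proof.
apply: continuous_measurable_plane; apply: differentiable_continuous_plane => x.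
exact/smooth_differentiable/smooth_cutoff.
Qed.

Lemma integral_cutoff s c : 0 < s -> (\int[area]_y (cutoff s c y)%:E = 1)%E.
Proof.
move=> s0.
have cr : cross (s, 0) (0, s) = s ^+ 2 :> R by rewrite /cross /= mul0r subr0 expr2.
have cr0 : cross (s, 0) (0, s) != 0 :> R by rewrite cr sqrf_eq0 gt_eqF.
rewrite (ge0_integral_lin c cr0); last 2 first.
- by apply/measurable_EFinP; exact: measurable_cutoff.
- by move=> y; rewrite lee_fin cutoff_ge0.
have mh2 : measurable_fun setT (fun y : mpt => hat y.1 * hat y.2).
  by apply: measurable_funM; apply: measurableT_comp => //; exact: measurable_hat.
transitivity ((s ^+ 2)%:E * \int[area]_y (((s * hat_mass)^-1 ^+ 2)%:E * (hat y.1 * hat y.2)%:E))%E.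
  rewrite cr ger0_norm; last exact: sqr_ge0.
  congr (_ * _)%E.
  apply: eq_integral => y _.
  rewrite -EFinM /cutoff lin1 lin2 /=; congr ((_ * (hat _ * hat _))%:E).
    by field; rewrite gt_eqF.
  by field; rewrite gt_eqF.
rewrite ge0_integralZl_EFin ?sqr_ge0 //; last 2 first.
- by move=> y _; rewrite lee_fin mulr_ge0 ?hat_ge0.
- by apply/measurable_EFinP.
have -> : (\int[area]_y (hat y.1 * hat y.2)%:E = (hat_mass ^+ 2)%:E)%E.
  rewrite (@tonelli_area _ (fun y : mpt => (hat y.1 * hat y.2)%:E)); last 2 first.
  - exact/measurable_EFinP.
  - by move=> y; rewrite lee_fin mulr_ge0 ?hat_ge0.
  transitivity (\int[mu1]_x ((hat_mass)%:E * (hat x)%:E))%E.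
    apply: eq_integral => x _ /=.
    transitivity (\int[mu1]_y ((hat x)%:E * (hat y)%:E))%E; first exact: eq_integral.
    rewrite ge0_integralZl_EFin ?hat_ge0 // ?hat_massE; first by rewrite muleC.
    - by move=> y _; rewrite lee_fin hat_ge0.
    - by apply/measurable_EFinP; exact: measurable_hat.
  rewrite ge0_integralZl_EFin ?hat_massE // ?ltW ?hat_mass_gt0 //.
  - by move=> y _; rewrite lee_fin hat_ge0.
  - by apply/measurable_EFinP; exact: measurable_hat.
rewrite -!EFinM; congr EFin; field.
by rewrite !gt_eqF // hat_mass_gt0.
Qed.

End Kernel.

Opaque area.

(** * Convolution at a contracted point *)

Section Mollify.
Context {R : realType}.
Notation pt := (R * R)%type.
Notation mR := (measurableTypeR R).
Notation mpt := (mR * mR)%type.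
Notation mu1 := (@lebesgue_measure R).

Lemma derive_affine (phi : pt -> R) (k : R) (b v x : pt) : (forall y, differentiable phi y) ->
  differentiable (fun y => phi (k *: y + b)) x /\
  'D_v (fun y => phi (k *: y + b)) x = k * 'D_v phi (k *: x + b).
Proof.
move=> dphi.
have [dl dlE] : differentiable (fun y : pt => k *: y + b) x /\
    'd (fun y : pt => k *: y + b) x = ( *:%R k : {linear pt -> pt}) :> (pt -> pt).
  apply: (@quadratic_is_diff _ _ _ _ ( *:%R k : {linear pt -> pt}) x 0); first exact: scaler_continuous.
  move=> h; have -> : k *: (x + h) + b = k *: h + (k *: x + b) by rewrite scalerDr -addrA addrCA.
  by rewrite addrK subrr normr0 mul0r.
have dc := differentiable_comp dl (dphi (k *: x + b)).
split => //; rewrite deriveE // diff_comp //= dlE linearZ /=.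
by rewrite -deriveE.
Qed.

Lemma scale_shiftE (k : R) (b : pt) (x : pt) : k *: x + b = lin b (k, 0) (0, k) x.
Proof.
rewrite [LHS]surjective_pairing [RHS]surjective_pairing lin1 lin2 /=.
rewrite -[k *: x.1]/(k * x.1) -[k *: x.2]/(k * x.2).
by congr (_, _); ring.
Qed.

Lemma measurable_scale_shift (k : R) (b : pt) : measurable_fun setT (fun x : mpt => k *: (x : pt) + b : mpt).
Proof.
rewrite (_ : (fun _ => _) = lin b (k, 0) (0, k)); first exact: measurable_lin.
by apply/funext => x; exact: scale_shiftE.
Qed.

Section Convolution.
Variables (D : set mpt) (g : mpt -> R) (k : R) (b : pt).
Hypotheses (mD : measurable D) (gi : area.-integrable D (EFin \o g)).

(** Convolution read at the affine image [k *: x + b], which will be a contraction; the integral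
    stays on [D], the domain of [g]. *)
Definition convol (phi : pt -> R) (x : pt) : R := \int[area]_(y in D) (g y * phi (k *: x + b - y)).

Lemma convol_integrable (phi : pt -> R) (x : pt) : continuous phi -> compactly_supported phi ->
  area.-integrable D (EFin \o (fun y => g y * phi (k *: x + b - y))).
Proof.
move=> cphi sphi; have [M [M0 HM]] := compactly_supported_bounded cphi sphi.
apply: (integrable_bddM mD (M := M) gi); last by move=> y _; exact: HM.
apply: measurable_funTS; apply: continuous_measurable_plane => y.
apply: (cvg_comp (fun y : pt => k *: x + b - y) phi); last exact: cphi.
by apply: cvgB; [exact: cvg_cst|exact: cvg_id].
Qed.

(** Differentiation under the integral: the uniform Taylor remainder of [phi], integrated against
    the modulus of [g], is again quadratic in [h]. The factor [k] is the chain rule through the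
    affine map. *)
Lemma convol_derive (phi : pt -> R) (x : pt) : smooth phi -> compactly_supported phi ->
  differentiable (convol phi) x /\ forall v, 'D_v (convol phi) x = k * convol ('D_v phi) x.
Proof.
move=> sphi cphi.
have [M HM] := taylor2_uniform sphi cphi.
have ci v : area.-integrable D (EFin \o (fun y => g y * 'D_v phi (k *: x + b - y))).
  exact: (convol_integrable x (continuous_smooth_derive (v := v) sphi) (compactly_supported_derive (v := v) cphi)).
have cphi' : continuous phi by apply: differentiable_continuous_plane => z; exact: smooth_differentiable.
have c0 z := convol_integrable z cphi' cphi.
have convE v : convol ('D_v phi) x = lform (convol ('D_e1 phi) x) (convol ('D_e2 phi) x) v.
  transitivity (v.1 * convol ('D_e1 phi) x + v.2 * convol ('D_e2 phi) x); last first.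
    by rewrite /lform; move: (convol ('D_e1 phi) x) (convol ('D_e2 phi) x) => p q; ring.
  rewrite /convol -(Rintegral_comb mD v.1 v.2 (ci e1) (ci e2)).
  by apply: eq_Rintegral => y _; rewrite (deriveDE _ (smooth_differentiable _ sphi)); ring.
pose N := \int[area]_(y in D) `|g y|.
have HC : forall h, `|convol phi (x + h) - convol phi x - lform (k * convol ('D_e1 phi) x) (k * convol ('D_e2 phi) x) h|
   <= `|M| * k ^+ 2 * N * `|h| ^+ 2.
  move=> h.
  have -> : lform (k * convol ('D_e1 phi) x) (k * convol ('D_e2 phi) x) h = k * convol ('D_h phi) x.
    rewrite (convE h) /lform; move: (convol ('D_e1 phi) x) (convol ('D_e2 phi) x) => p q; ring.
  have i1 := integrable_sub_R mD (c0 (x + h)) (c0 x).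
  have i2 := integrable_scale_R mD k (ci h).
  rewrite /convol -(Rintegral_scale mD k (ci h)) -(Rintegral_sub mD (c0 (x + h)) (c0 x)) -(Rintegral_sub mD i1 i2).
  rewrite (_ : `|M| * k ^+ 2 * N * `|h| ^+ 2 = (`|M| * k ^+ 2 * `|h| ^+ 2) * N); last first.
    by move: N => N; ring.
  have i3 := integrable_abs_R gi.
  rewrite -(Rintegral_scale mD _ i3).
  apply: (abs_Rintegral_le mD (integrable_sub_R mD i1 i2) (integrable_scale_R mD _ i3)) => y _.
  have -> : k *: (x + h) + b - y = k *: x + b - y + k *: h.
    by rewrite scalerDr -!addrA; congr (_ + _); rewrite addrC !addrA.
  set z := k *: x + b - y.
  have -> : g y * phi (z + k *: h) - g y * phi z - k * (g y * 'D_h phi z) =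
      g y * (phi (z + k *: h) - phi z - lform ('D_e1 phi z) ('D_e2 phi z) (k *: h)).
    rewrite (deriveDE _ (smooth_differentiable _ sphi)) /lform.
    by rewrite -[(k *: h).1]/(k * h.1) -[(k *: h).2]/(k * h.2); ring.
  rewrite normrM mulrC; apply: ler_wpM2r => //; apply: le_trans (HM _ _) _.
  rewrite normrZ exprMn real_normK ?num_real // -mulrA ler_wpM2r ?ler_norm //.
  by rewrite mulr_ge0 // sqr_ge0.
have [df dE] := quadratic_differentiable HC.
split => // v; rewrite dE (convE v) /lform; move: (convol ('D_e1 phi) x) (convol ('D_e2 phi) x) => p q; ring.
Qed.

Lemma convol_smooth (phi : pt -> R) : smooth phi -> compactly_supported phi -> smooth (convol phi).
Proof.
move=> sphi cphi.
apply: (@smooth_class _ [set F | exists a psi, [/\ smooth psi, compactly_supported psi & F = (fun x => a * convol psi x)]]).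
- move=> _ x [a [psi [s1 s2 ->]]]; apply: differentiableZ.
  by have [] := convol_derive x s1 s2.
- move=> _ v [a [psi [s1 s2 ->]]]; exists (a * k), ('D_v psi); split.
  + exact: smooth_derive.
  + exact: compactly_supported_derive.
  apply/funext => x; have [df dE] := convol_derive x s1 s2.
  rewrite -[LHS]/('D_v (a \*: convol psi) x) deriveZ; last exact: diff_derivable.
  by rewrite dE /GRing.scale /= mulrA.
- by exists 1, phi; split => //; apply/funext => x; rewrite mul1r.
Qed.

End Convolution.

(** Symmetry of the kernel turns its centre into the variable, and the contraction of the plane has
    Jacobian [k ^+ 2]. *)
Lemma integral_cutoff_center (k s : R) (b w : pt) : 0 < k -> 0 < s ->
  (\int[area]_x (cutoff s (k *: (x : pt) + b) w)%:E = (k ^- 2)%:E)%E.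
Proof.
move=> k0 s0.
have cr : cross (k, 0) (0, k) = k ^+ 2 :> R by rewrite /cross /= mul0r subr0 expr2.
have cr0 : cross (k, 0) (0, k) != 0 :> R by rewrite cr sqrf_eq0 gt_eqF.
have := @ge0_integral_lin R b (k, 0) (0, k) (fun y => (cutoff s w y)%:E) cr0.
rewrite integral_cutoff // cr ger0_norm; last exact: sqr_ge0.
move=> /(_ _ _)/wrap[].
  by apply/measurable_EFinP; exact: measurable_cutoff.
  by move=> y; rewrite lee_fin cutoff_ge0.
move=> H; set I := (\int[area]_x _)%E.
have EI : (\int[area]_x (cutoff s w (lin b (k, 0%R) (0%R, k) x))%:E)%E = I.
  by apply: eq_integral => x _; rewrite cutoff_sym scale_shiftE.
have -> : I = ((k ^- 2)%:E * ((k ^+ 2)%:E * I))%E.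
  by rewrite muleA -EFinM mulVf ?mul1e // sqrf_eq0 gt_eqF.
by rewrite -EI -H mule1.
Qed.

Lemma measurable_cutoff2 d (T : measurableType d) (s k : R) (b : pt) (gam : T -> mpt) :
  measurable_fun setT gam ->
  measurable_fun setT (fun z : mpt * T => cutoff s (k *: (z.1 : pt) + b) (gam z.2)).
Proof.
move=> mg.
rewrite (_ : (fun _ => _) = (cutoff s 0 : mpt -> R) \o (fun z : mpt * T => (gam z.2 : pt) - (k *: (z.1 : pt) + b) : mpt)).
  apply: measurableT_comp; first exact: measurable_cutoff.
  have m1 := measurableT_comp (measurable_scale_shift k b) (@measurable_fst _ _ mpt T).
  have m2 := measurableT_comp mg (@measurable_snd _ _ mpt T).
  apply/measurable_fun_pairP; split.
    apply: (measurable_funB (f := fst \o (gam \o snd)) (g := fst \o ((fun x : mpt => k *: (x : pt) + b : mpt) \o fst))).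
      by apply: measurableT_comp m2; exact: measurable_fst.
    by apply: measurableT_comp m1; exact: measurable_fst.
  apply: (measurable_funB (f := snd \o (gam \o snd)) (g := snd \o ((fun x : mpt => k *: (x : pt) + b : mpt) \o fst))).
    by apply: measurableT_comp m2; exact: measurable_snd.
  by apply: measurableT_comp m1; exact: measurable_snd.
by apply/funext => z /=; rewrite cutoff_shift.
Qed.

(** Stated for any measure carried by a map [gam] into the plane, so that one computation covers the
    area, for the gradient part, and the parameter of a side, for the jump part. The exchange of
    integrals is a hypothesis because its proof differs in the two cases. *)
Lemma tonelli_cutoff d (T : measurableType d) (nu : {measure set T -> \bar R})
    (gam : T -> mpt) (G : T -> \bar R) (k s : R) (b : pt) :
  (forall F : mpt * T -> \bar R, measurable_fun setT F -> (forall z, 0 <= F z)%E ->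
     (\int[area]_x \int[nu]_w F (x, w) = \int[nu]_w \int[area]_x F (x, w))%E) ->
  0 < k -> 0 < s -> measurable_fun setT gam -> measurable_fun setT G -> (forall w, 0 <= G w)%E ->
  (\int[area]_x \int[nu]_w (G w * (cutoff s (k *: (x : pt) + b) (gam w))%:E) = (k ^- 2)%:E * \int[nu]_w G w)%E.
Proof.
move=> swap k0 s0 mg mG G0.
pose F (z : mpt * T) := (G z.2 * (cutoff s (k *: (z.1 : pt) + b) (gam z.2))%:E)%E.
have mF : measurable_fun setT F.
  apply: emeasurable_funM; first exact: measurableT_comp mG measurable_snd.
  by apply/measurable_EFinP; exact: measurable_cutoff2.
have F0 z : (0 <= F z)%E by rewrite mule_ge0 // lee_fin cutoff_ge0.
transitivity (\int[nu]_w \int[area]_x F (x, w))%E; first exact: swap.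
rewrite -ge0_integralZl_EFin //; last by rewrite invr_ge0 sqr_ge0.
apply: eq_integral => w _; rewrite /F /=.
rewrite ge0_integralZl //.
- by rewrite integral_cutoff_center // muleC.
- apply/measurable_EFinP.
  rewrite (_ : (fun _ => _) = (fun x : mpt => cutoff s (k *: (x : pt) + b) (gam w))) //.
  exact: (measurableT_comp (measurable_cutoff2 s k b mg) (measurable_pair2 w)).
- by move=> x _; rewrite lee_fin cutoff_ge0.
Qed.

End Mollify.

(** * Mollification on a bounded convex set *)

Lemma contraction_shift (R : realType) (e : R) (x y z : R * R) :
  x - y = - (y - ((1 - e) *: x + e *: z)) - e *: (z - x).
Proof.
case: x y z => x1 x2 [y1 y2] [z1 z2].
by congr (_, _) => /=; rewrite -?[_ *: _]/(_ * _); ring.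
Qed.

Section Mollifier.
Context {R : realType}.
Notation pt := (R * R)%type.
Notation mR := (measurableTypeR R).
Notation mpt := (mR * mR)%type.

Variables (D : set mpt) (z0 : pt) (r : R).
Hypotheses (mD : measurable D) (fD : (area D < +oo)%E) (r0 : 0 < r).
Hypothesis convD : forall (x z : pt) (e : R), 0 < e < 1 -> D x -> D z -> D ((1 - e) *: x + e *: z).
Hypothesis ballD : forall z : pt, `|z - z0| <= r -> D z.

(* [mcen] pulls [x] towards [z0], so that by convexity the ball over which
   [moll n g] averages around it stays in [D]. *)
Definition meps (n : nat) : R := n.+2%:R^-1.
Definition mcen (n : nat) (x : pt) : pt := (1 - meps n) *: x + meps n *: z0.
Definition moll (n : nat) (g : pt -> R) (x : pt) : R :=
  \int[area]_(y in D) (g y * cutoff (meps n * r) (mcen n x) y).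

Lemma meps_itv n : 0 < meps n < 1.
Proof. by rewrite /meps invr_gt0 ltr0n /= invf_lt1 ?ltr0n // ltr1n. Qed.

(** The index shift by two keeps [1 - meps n] at least 1/2, so that the Jacobian factor
    [(1 - meps n) ^- 2] never exceeds 4. *)
Lemma meps_le n : meps n <= 2^-1.
Proof. by rewrite /meps lef_pV2 ?posrE ?ltr0n // ler_nat. Qed.

Lemma meps_cvg0 : meps n @[n --> \oo] --> (0 : R).
Proof.
have := @cvg_harmonic R; rewrite -(cvg_shiftS (@harmonic R : nat -> R)).
by apply.
Qed.

Lemma mrad_gt0 n : 0 < meps n * r.
Proof. by rewrite mulr_gt0 //; case/andP: (meps_itv n). Qed.

Lemma mscale_gt0 n : 0 < 1 - meps n.
Proof. by rewrite subr_gt0; case/andP: (meps_itv n). Qed.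

(** [y] is a convex combination of [x] and of [z0 + (meps n)^-1 *: (y - mcen n x)], a point of the
    inner ball around [z0]. *)
Lemma near_center_in n (x y : pt) : D x -> `|y - mcen n x| <= meps n * r -> D y.
Proof.
move=> Dx yc; have [e0 e1] := andP (meps_itv n).
have -> : y = (1 - meps n) *: x + meps n *: (z0 + (meps n)^-1 *: (y - mcen n x)).
  rewrite scalerDr scalerA divff ?gt_eqF // scale1r /mcen.
  by rewrite [in RHS]addrA addrC subrK.
apply: convD; [exact: meps_itv|exact: Dx|apply: ballD].
by rewrite addrAC subrr add0r normrZ gtr0_norm ?invr_gt0 // ler_pdivrMl.
Qed.

Lemma cutoff_in n (x y : pt) : D x -> cutoff (meps n * r) (mcen n x) y != 0 -> D y.
Proof.
move=> Dx /(cutoff_neq0 (mrad_gt0 n)) /ltW; exact: near_center_in.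
Qed.

Lemma moll_test n (x : pt) : D x -> test_function D (cutoff (meps n * r) (mcen n x)).
Proof.
move=> Dx; have [c1 c2] := cutoff_support (mcen n x) (mrad_gt0 n).
split => //; first exact: smooth_cutoff.
by move=> y /c2 /=; exact: near_center_in.
Qed.

Lemma cutoff_bounded s c : 0 < s -> exists M, forall y, `|@cutoff R s c y| <= M.
Proof.
move=> s0; have [c1 _] := cutoff_support c s0.
have [M [_ HM]] := @compactly_supported_bounded _ (cutoff s c)
  (differentiable_continuous_plane (fun x => smooth_differentiable x (smooth_cutoff s c))) c1.
by exists M.
Qed.

Lemma integrable_moll n (g : pt -> R) x : area.-integrable D (EFin \o g) ->
  area.-integrable D (EFin \o (fun y => g y * cutoff (meps n * r) (mcen n x) y)).
Proof.
move=> gi; have [M HM] := cutoff_bounded (mcen n x) (mrad_gt0 n).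
apply: (integrable_bddM mD (M := M) gi) => //.
by apply: measurable_funTS; exact: measurable_cutoff.
Qed.

Lemma integrable_cutoff n x : area.-integrable D (EFin \o cutoff (meps n * r) (mcen n x)).
Proof.
have [M HM] := cutoff_bounded (mcen n x) (mrad_gt0 n).
apply: (sqint_integrable mD fD); apply: (@sqint_bounded _ _ _ area D mD M) => //.
by apply: measurable_funTS; exact: measurable_cutoff.
Qed.

Lemma cutoff_mass n x : D x -> \int[area]_(y in D) cutoff (meps n * r) (mcen n x) y = 1.
Proof.
move=> Dx; rewrite /Rintegral.
have -> : (\int[area]_(y in D) (cutoff (meps n * r) (mcen n x) y)%:E = 1)%E.
  rewrite integral_mkcond -(integral_cutoff (mcen n x) (mrad_gt0 n)).
  apply: eq_integral => y _; rewrite patchE; case: ifPn => // /negP yD.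
  congr EFin; apply/esym/eqP; apply: contrapT => /negP /(cutoff_in Dx) Dy.
  by apply: yD; rewrite inE.
by [].
Qed.

Lemma moll_convolE n g x : moll n g x = convol D g (1 - meps n) (meps n *: z0) (cutoff (meps n * r) 0) x.
Proof.
by apply: eq_Rintegral => y _; rewrite cutoff_sym cutoff_shift.
Qed.

Lemma moll_smooth n (g : pt -> R) : area.-integrable D (EFin \o g) -> smooth (moll n g).
Proof.
move=> gi; rewrite (_ : moll n g = convol D g (1 - meps n) (meps n *: z0) (cutoff (meps n * r) 0)).
  apply: convol_smooth => //; first exact: smooth_cutoff.
  by have [] := cutoff_support 0 (mrad_gt0 n).
by apply/funext => x; exact: moll_convolE.
Qed.

Lemma cutoff_derive s c (v y : pt) :
  'D_v (cutoff s c) y = - 'D_v (@cutoff R s 0) (c - y).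
Proof.
have -> : cutoff s c = (fun y : pt => cutoff s 0 ((-1) *: y + c)).
  by apply/funext => w; rewrite cutoff_sym cutoff_shift scaleN1r addrC.
have [_ ->] := @derive_affine _ (cutoff s 0) (-1) c v y (fun z => smooth_differentiable z (smooth_cutoff s 0)).
by rewrite mulN1r scaleN1r addrC.
Qed.

(** Differentiating the kernel in its centre is minus differentiating it in [y]; the contraction
    contributes the factor [1 - meps n]. *)
Lemma moll_derive n (u : pt -> R) v (x : pt) : area.-integrable D (EFin \o u) ->
  'D_v (moll n u) x = - (1 - meps n) * \int[area]_(y in D) (u y * 'D_v (cutoff (meps n * r) (mcen n x)) y).
Proof.
move=> ui; rewrite (_ : moll n u = convol D u (1 - meps n) (meps n *: z0) (cutoff (meps n * r) 0)); last first.
  by apply/funext => y; exact: moll_convolE.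
have [s1 _] := cutoff_support (0 : pt) (mrad_gt0 n).
have [_ ->] := convol_derive (1 - meps n) (meps n *: z0) mD ui x (smooth_cutoff _ _) s1.
rewrite mulNr -mulrN; congr (_ * _).
have ci : area.-integrable D (EFin \o (fun y => u y * 'D_v (cutoff (meps n * r) (mcen n x)) y)).
  have [c1 _] := cutoff_support (mcen n x) (mrad_gt0 n).
  have [M [_ HM]] := compactly_supported_bounded (continuous_smooth_derive (v := v) (smooth_cutoff _ _))
    (compactly_supported_derive (v := v) c1).
  apply: (integrable_bddM mD (M := M) ui) => //.
  by apply: measurable_funTS; apply: continuous_measurable_plane; exact/continuous_smooth_derive/smooth_cutoff.
rewrite -[RHS]mulN1r -(Rintegral_scale mD _ ci); apply: eq_Rintegral => y _.
by rewrite [in RHS]cutoff_derive -/(mcen n x) mulN1r mulrN opprK.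
Qed.

(** For every [x] in [D] the kernel is a test function on [D], so mollification commutes with the
    weak derivative, up to a scalar factor, all the way to the boundary. *)
Lemma moll_weak_derive n (u G : pt -> R) v (x : pt) : area.-integrable D (EFin \o u) ->
  weak_deriv D v u G -> D x -> 'D_v (moll n u) x = (1 - meps n) * moll n G x.
Proof.
move=> ui wd Dx; rewrite moll_derive // wd; last exact: moll_test.
by rewrite mulNr mulrN opprK.
Qed.

(** Jensen's inequality, obtained from Cauchy-Schwarz by splitting the kernel, of mass one, into two
    square roots. *)
Lemma sq_moll_le n (g : pt -> R) x : sqint area D g -> D x ->
  (moll n g x) ^+ 2 <= \int[area]_(y in D) (g y ^+ 2 * cutoff (meps n * r) (mcen n x) y).
Proof.
move=> g2 Dx.
have [M HM] := cutoff_bounded (mcen n x) (mrad_gt0 n).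
pose q y := Num.sqrt (cutoff (meps n * r) (mcen n x) y).
have qq y : q y * q y = cutoff (meps n * r) (mcen n x) y by rewrite -expr2 sqr_sqrtr // cutoff_ge0.
have qM y : D y -> `|q y| <= Num.sqrt M.
  by move=> _; rewrite ger0_norm ?sqrtr_ge0 //; apply: ler_wsqrtr; exact: le_trans (ler_norm _) (HM y).
have mq : measurable_fun D q.
  apply: measurable_funTS; apply: continuous_measurable_plane => y.
  apply: (cvg_comp (cutoff (meps n * r) (mcen n x)) Num.sqrt); last exact: sqrt_continuous.
  exact/differentiable_continuous/smooth_differentiable/smooth_cutoff.
have gq := sqint_bddM mD mq qM g2.
have q2 := sqint_bounded mD fD mq qM.
have := cauchy_schwarz mD gq q2.
rewrite (@eq_Rintegral _ _ _ area D (fun y => g y * cutoff (meps n * r) (mcen n x) y)); last first.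
  by move=> y _; rewrite -mulrA qq.
rewrite (@eq_Rintegral _ _ _ area D (fun y => g y ^+ 2 * cutoff (meps n * r) (mcen n x) y)
  (fun y => (g y * q y) ^+ 2)); last first.
  by move=> y _; rewrite exprMn [q y ^+ 2]expr2 qq.
rewrite (@eq_Rintegral _ _ _ area D (cutoff (meps n * r) (mcen n x)) (fun y => q y ^+ 2)); last first.
  by move=> y _; rewrite expr2 qq.
by rewrite cutoff_mass // mulr1.
Qed.

Lemma measurable_moll n (g : pt -> R) : area.-integrable D (EFin \o g) -> measurable_fun setT (moll n g : mpt -> R).
Proof.
move=> gi; apply: continuous_measurable_plane; apply: differentiable_continuous_plane => x.
exact/smooth_differentiable/moll_smooth.
Qed.

(** Jensen's bound is integrated in [x] and the order of integration exchanged; what is left is the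
    mass of the kernel in its centre. *)
Lemma integral_sq_moll_le n (g : pt -> R) : sqint area D g ->
  (\int[area]_(x in D) (moll n g x ^+ 2)%:E <= ((1 - meps n) ^- 2)%:E * \int[area]_(x in D) (g x ^+ 2)%:E)%E.
Proof.
move=> g2; have [mg gi2] := g2; have gi := sqint_integrable mD fD g2.
pose G (y : mpt) : \bar R := (fun y => (g y ^+ 2)%:E) \_ D y.
have mG : measurable_fun setT G.
  by apply/(measurable_restrictT _ mD); exact: measurable_int gi2.
have G0 y : (0 <= G y)%E by rewrite /G patchE; case: ifPn => // _; rewrite lee_fin sqr_ge0.
have T := tonelli_cutoff (meps n *: z0) (@tonelli_area_area R) (mscale_gt0 n) (mrad_gt0 n) (@measurable_id _ _ setT) mG G0.
rewrite [in leRHS]integral_mkcond -/G -T.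
have H0 (x : mpt) : (0 <= \int[area]_w (G w * (cutoff (meps n * r) ((1 - meps n) *: (x : pt) + meps n *: z0) w)%:E))%E.
  by apply: integral_ge0 => y _; rewrite mule_ge0 // lee_fin cutoff_ge0.
have mH : measurable_fun setT (fun x : mpt => \int[area]_w (G w * (cutoff (meps n * r) ((1 - meps n) *: (x : pt) + meps n *: z0) w)%:E))%E.
  apply: (@measurable_area_partial _ _ _ (fun z : mpt * mpt => G z.1 * (cutoff (meps n * r) ((1 - meps n) *: (z.2 : pt) + meps n *: z0) z.1)%:E))%E.
    apply: emeasurable_funM; first exact: measurableT_comp mG measurable_fst.
    apply/measurable_EFinP.
    have := measurable_cutoff2 (meps n * r) (1 - meps n) (meps n *: z0) (@measurable_id _ mpt setT).
    move=> /measurableT_comp/(_ (@measurable_swap _ _ mpt mpt)). exact.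
  by move=> z; rewrite mule_ge0 // lee_fin cutoff_ge0.
apply: (@le_trans _ _ (\int[area]_(x in D) \int[area]_w (G w * (cutoff (meps n * r) ((1 - meps n) *: (x : pt) + meps n *: z0) w)%:E))%E).
  apply: ge0_le_integral => //.
  - by move=> x _; rewrite lee_fin sqr_ge0.
  - apply/measurable_EFinP; apply: measurable_funX; apply: measurable_funTS; exact: measurable_moll.
  - exact: measurable_funTS.
  move=> x Dx.
  apply: (@le_trans _ _ (\int[area]_(y in D) (g y ^+ 2 * cutoff (meps n * r) (mcen n x) y))%:E).
    by rewrite lee_fin sq_moll_le.
  rewrite /Rintegral fineK; last first.
    by apply: integrable_fin_num => //; exact: integrable_moll.
  rewrite integral_mkcond le_eqVlt; apply/orP; left; apply/eqP; apply: eq_integral => y _.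
  by rewrite /G !patchE; case: ifPn => _; rewrite ?mul0e // EFinM.
exact: ge0_subset_integral.
Qed.

Lemma sqint_moll n (g : pt -> R) : sqint area D g -> sqint area D (moll n g).
Proof.
move=> g2; have gi := sqint_integrable mD fD g2.
have mm : measurable_fun D (moll n g : mpt -> R) by apply: measurable_funTS; exact: measurable_moll.
split => //; apply/integrableP; split; first by apply/measurable_EFinP; exact: measurable_funX.
rewrite (eq_integral (fun x : mpt => (moll n g x ^+ 2)%:E)); last first.
  by move=> x _; rewrite /= ger0_norm ?sqr_ge0.
apply: le_lt_trans (integral_sq_moll_le n g2) _.
rewrite lte_mul_pinfty ?lee_fin ?invr_ge0 ?sqr_ge0 //.
have [_ gi2] := g2; move/integrableP : gi2 => [_]; apply: le_lt_trans.
rewrite le_eqVlt; apply/orP; left; apply/eqP; apply: eq_integral => x _.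
by rewrite /= ger0_norm ?sqr_ge0.
Qed.

Lemma sqnorm_moll_le n (g : pt -> R) : sqint area D g ->
  \int[area]_(x in D) (moll n g x ^+ 2) <= (1 - meps n) ^- 2 * \int[area]_(x in D) (g x ^+ 2).
Proof.
move=> g2; have [_ m2] := sqint_moll n g2; have [_ gi2] := g2.
have fm := integrable_fin_num mD m2; have fg := integrable_fin_num mD gi2.
rewrite -lee_fin EFinM /Rintegral !fineK //; exact: integral_sq_moll_le.
Qed.

Definition moll_cvg (g : pt -> R) :=
  \int[area]_(x in D) ((moll n g x - g x) ^+ 2) @[n --> \oo] --> (0 : R).

Lemma mollD n (f g : pt -> R) : area.-integrable D (EFin \o f) -> area.-integrable D (EFin \o g) ->
  moll n (fun x => f x + g x) = (fun x => moll n f x + moll n g x).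
Proof.
move=> fi gi; apply/funext => x.
rewrite /moll -(Rintegral_add mD (integrable_moll n x fi) (integrable_moll n x gi)).
by apply: eq_Rintegral => y _; rewrite mulrDl.
Qed.

Lemma mollZ n (a : R) (f : pt -> R) : area.-integrable D (EFin \o f) ->
  moll n (fun x => a * f x) = (fun x => a * moll n f x).
Proof.
move=> fi; apply/funext => x.
rewrite /moll -(Rintegral_scale mD a (integrable_moll n x fi)).
by apply: eq_Rintegral => y _; rewrite mulrA.
Qed.

Lemma eq_moll n (f g : pt -> R) x : {in D, f =1 g} -> moll n f x = moll n g x.
Proof. by move=> fg; apply: eq_Rintegral => y yD; rewrite fg. Qed.

Lemma eq_moll_cvg (f g : pt -> R) : {in D, f =1 g} -> moll_cvg f -> moll_cvg g.
Proof.
move=> fg; rewrite /moll_cvg.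
rewrite (_ : (fun n => _) = (fun n => \int[area]_(x in D) ((moll n g x - g x) ^+ 2))) //.
by apply/funext => n; apply: eq_Rintegral => x xD; rewrite (eq_moll n x fg) fg.
Qed.

Lemma sqnorm_ge0 (h : pt -> R) : 0 <= \int[area]_(x in D) (h x ^+ 2).
Proof. by apply: Rintegral_ge0 => x _; exact: sqr_ge0. Qed.

Lemma squeeze0 (a b : nat -> R) : (forall n, 0 <= a n <= b n) ->
  b n @[n --> \oo] --> (0 : R) -> a n @[n --> \oo] --> (0 : R).
Proof.
move=> ab b0; apply: (squeeze_cvgr _ (cvg_cst (0 : R)) b0).
by apply: nearW.
Qed.

(** Mollification is bounded on L^2 uniformly in [n], so the functions on which it converges form a
    closed set. *)
Lemma moll_cvg_approx (g : pt -> R) : sqint area D g ->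
  (forall e, 0 < e -> exists h, [/\ sqint area D h, moll_cvg h &
     \int[area]_(x in D) ((g x - h x) ^+ 2) <= e]) -> moll_cvg g.
Proof.
move=> g2 H; apply/cvgrPdist_le => e e0.
(* The three errors add up to 16 times this quantity. *)
have e40 : 0 < e / 20 by rewrite divr_gt0.
have [h [h2 hc gh]] := H _ e40.
have d2 := sqintB mD g2 h2.
have gi := sqint_integrable mD fD g2; have hi := sqint_integrable mD fD h2.
have di := sqint_integrable mD fD d2.
near=> n.
rewrite sub0r normrN ger0_norm ?sqnorm_ge0 //.
have E : moll n g = (fun x => moll n (fun y => g y - h y) x + moll n h x).
  by rewrite -(mollD n di hi); congr (moll n _); apply/funext => y; rewrite subrK.
have m1 := sqint_moll n d2; have m2 := sqint_moll n h2.
have s1 := sqintB mD m2 h2.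
have s2 := sqintB mD h2 g2.
have -> : \int[area]_(x in D) ((moll n g x - g x) ^+ 2) =
    \int[area]_(x in D) ((moll n (fun y => g y - h y) x + ((moll n h x - h x) + (h x - g x))) ^+ 2).
  by apply: eq_Rintegral => x _; rewrite E; congr (_ ^+ 2); ring.
apply: le_trans (sq_integralD_le mD m1 (sqintD mD s1 s2)) _.
have I1 := sqnorm_moll_le n d2.
have I2 := sq_integralD_le mD s1 s2.
have I3 : \int[area]_(x in D) ((moll n h x - h x) ^+ 2) <= e / 20.
  have : `|0 - \int[area]_(x in D) ((moll n h x - h x) ^+ 2)| <= e / 20.
    by near: n; move/cvgrPdist_le : hc; apply.
  by rewrite sub0r normrN; apply: le_trans; exact: ler_norm.
have I4 : \int[area]_(x in D) ((h x - g x) ^+ 2) <= e / 20.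
  apply: le_trans gh; rewrite le_eqVlt; apply/orP; left; apply/eqP.
  by apply: eq_Rintegral => x _; ring.
have k4 : (1 - meps n) ^- 2 <= 4.
  rewrite -[leRHS]invrK lef_pV2 ?posrE ?exprn_gt0 ?mscale_gt0 //.
  have := meps_le n; nra.
have I5 : \int[area]_(x in D) (moll n (fun y => g y - h y) x ^+ 2) <= 4 * (e / 20).
  apply: le_trans I1 _; apply: ler_pM => //; last exact: sqnorm_ge0.
  by rewrite invr_ge0 sqr_ge0.
move: I2 I3 I4 I5.
move: (\int[area]_(x in D) _) (\int[area]_(x in D) _) (\int[area]_(x in D) _) (\int[area]_(x in D) _) => p q s t.
lra.
Unshelve. all: by end_near. Qed.

Lemma moll_cvgD (f g : pt -> R) : sqint area D f -> sqint area D g ->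
  moll_cvg f -> moll_cvg g -> moll_cvg (fun x => f x + g x).
Proof.
move=> f2 g2 cf cg.
have fi := sqint_integrable mD fD f2; have gi := sqint_integrable mD fD g2.
apply: (@squeeze0 _ (fun n => 2 * \int[area]_(x in D) ((moll n f x - f x) ^+ 2)
   + 2 * \int[area]_(x in D) ((moll n g x - g x) ^+ 2))).
  move=> n; rewrite sqnorm_ge0 /=.
  have := sq_integralD_le mD (sqintB mD (sqint_moll n f2) f2) (sqintB mD (sqint_moll n g2) g2).
  apply: le_trans; rewrite le_eqVlt; apply/orP; left; apply/eqP.
  by apply: eq_Rintegral => x _; rewrite mollD //; congr (_ ^+ 2); ring.
rewrite -[X in _ --> X](_ : 2 * 0 + 2 * 0 = 0 :> R); last by rewrite !mulr0 addr0.
by apply: cvgD; apply: cvgMr.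
Qed.

Lemma moll_cvgZ (a : R) (f : pt -> R) : sqint area D f ->
  moll_cvg f -> moll_cvg (fun x => a * f x).
Proof.
move=> f2 cf; have fi := sqint_integrable mD fD f2.
rewrite /moll_cvg (_ : (fun n => _) = (fun n => a ^+ 2 * \int[area]_(x in D) ((moll n f x - f x) ^+ 2))).
  by rewrite -[X in _ --> X](mulr0 (a ^+ 2)); exact: cvgMr.
apply/funext => n; have [_ di] := sqintB mD (sqint_moll n f2) f2.
rewrite -(Rintegral_scale mD _ di); apply: eq_Rintegral => x _.
by rewrite mollZ //; ring.
Qed.

Lemma moll_cvg_cst (a : R) : moll_cvg (cst a).
Proof.
rewrite /moll_cvg (_ : (fun n => _) = cst 0); first exact: cvg_cst.
apply/funext => n /=; rewrite (@eq_Rintegral _ _ _ area D (cst 0)).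
  by rewrite /Rintegral integral0.
move=> x /set_mem Dx; rewrite /moll /= Rintegral_scale ?cutoff_mass ?mulr1 ?subrr ?expr0n //.
exact: integrable_cutoff.
Qed.

Lemma sqint_indic (A : set mpt) : measurable A -> sqint area D (\1_A : pt -> R).
Proof.
move=> mA; apply: (@sqint_bounded _ _ _ area D mD 1) => //.
by move=> x _; rewrite indicE; case: (_ \in _); rewrite ?normr1 ?normr0.
Qed.

Lemma moll_indic_open_pointwise (U : set pt) (x : pt) : open U -> D x -> U x ->
  \forall n \near \oo, moll n \1_U x = 1.
Proof.
move=> oU Dx Ux.
have /nbhs_ballP [d /= d0 dU] := open_nbhs_nbhs (conj oU Ux).
(* The averaging square stays within [meps n * (r + |z0 - x|)] of [x], hence eventually inside
   [U]. *)
have B0 : 0 < r + `|z0 - x| by rewrite ltr_pwDl.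
near=> n.
rewrite -(cutoff_mass n Dx); apply: eq_Rintegral => y _.
have [->|cy] := eqVneq (cutoff (meps n * r) (mcen n x) y) 0; first by rewrite mulr0.
rewrite indicE mem_set ?mul1r //; apply: dU; rewrite -ball_normE /ball_ /=.
have yc := cutoff_neq0 (mrad_gt0 n) cy.
have -> : x - y = - (y - mcen n x) - meps n *: (z0 - x).
  exact: contraction_shift.
rewrite (le_lt_trans (ler_normB _ _)) // normrN normrZ ger0_norm; last by rewrite ltW //; case/andP: (meps_itv n).
apply: (@lt_trans _ _ (meps n * (r + `|z0 - x|))); first by rewrite mulrDr ltrD2r.
rewrite -ltr_pdivlMr //.
have : `|0 - meps n| < d / (r + `|z0 - x|).
  by near: n; move/cvgrPdist_lt : meps_cvg0; apply; rewrite divr_gt0.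
by rewrite sub0r normrN; apply: le_lt_trans; exact: ler_norm.
Unshelve. all: by end_near. Qed.

Lemma moll_indic_bounds (U : set mpt) n (x : pt) : measurable U -> D x -> 0 <= moll n \1_U x <= 1.
Proof.
move=> mU Dx; have i1 := sqint_integrable mD fD (sqint_indic mU).
apply/andP; split.
  by apply: Rintegral_ge0 => y _; rewrite mulr_ge0 ?cutoff_ge0 // indicE.
rewrite -(cutoff_mass n Dx); apply: le_Rintegral => //.
- exact: integrable_moll.
- exact: integrable_cutoff.
by move=> y _; rewrite ler_piMl ?cutoff_ge0 // indicE lern1; case: (_ \in _).
Qed.

(** Expanding the square, the norm of the mollification is asymptotically at most that of the
    indicator and the pairing of the two converges to its squared norm. Only points of [U] matter in
    the pairing, so the boundary of [U], which may have positive area, causes no trouble. *)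
Lemma moll_cvg_open (U : set pt) : open U -> moll_cvg (\1_U : pt -> R).
Proof.
move=> oU; have mU := open_measurable_plane oU.
have u2 := sqint_indic mU; have ui := sqint_integrable mD fD u2.
pose a := \int[area]_(x in D) (\1_U x ^+ 2 : R).
pose I n := \int[area]_(x in D) (moll n \1_U x * \1_U x).
have Ia : I n @[n --> \oo] --> a.
  apply: (@Rintegral_dominated_cvg _ _ _ area D mD (fun n x => moll n \1_U x * \1_U x) _ (cst 1)).
  - move=> n; apply: measurable_funM; apply: measurable_funTS; first exact: measurable_moll.
    exact: measurable_indic.
  - move=> x Dx; have [Ux|nUx] := pselect (U x).
      have -> : \1_U x ^+ 2 = 1 * \1_U x :> R by rewrite indicE mem_set // expr1n mulr1.
      apply: cvgMl; apply: cvg_near_cst; exact: moll_indic_open_pointwise.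
    rewrite indicE memNset // expr0n /=.
    by under eq_fun do rewrite mulr0; exact: cvg_cst.
  - apply: (sqint_integrable mD fD); apply: (@sqint_bounded _ _ _ area D mD 1) => // x _.
    by rewrite normr1.
  - move=> n x Dx; have /andP[h0 h1] := moll_indic_bounds n mU Dx.
    rewrite ger0_norm ?mulr_ge0 ?indicE // -[leRHS]mulr1; apply: ler_pM => //.
    by case: (_ \in _).
apply: (@squeeze0 _ (fun n => (1 - meps n) ^- 2 * a - 2 * I n + a)).
  move=> n; rewrite sqnorm_ge0 /=.
  have m2 := sqint_moll n u2.
  have mi := sqint_mul mD m2 u2.
  have -> : \int[area]_(x in D) ((moll n \1_U x - \1_U x) ^+ 2) =
      (1 * \int[area]_(x in D) (moll n \1_U x ^+ 2) + (- 2) * I n) + a.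
    rewrite /I /a -(Rintegral_comb mD 1 (-2) m2.2 mi) -(Rintegral_add mD _ u2.2); last first.
      by apply: (integrable_sum_R mD); apply: (integrable_scale_R mD); [exact: m2.2|].
    by apply: eq_Rintegral => x _; ring.
  have := sqnorm_moll_le n u2; rewrite -/a.
  move: (\int[area]_(x in D) _) ((1 - meps n) ^- 2 * a) (I n) => p q s; lra.
rewrite (_ : 0 = (1 - 0) ^- 2 * a - 2 * a + a) //; last by rewrite subr0 expr1n invr1; ring.
apply: cvgD; last exact: cvg_cst.
apply: cvgB; last by apply: cvgMr.
apply: cvgMl; apply: cvgV; first by rewrite subr0 expr1n oner_neq0.
rewrite expr2; under eq_fun do rewrite expr2.
by apply: cvgM; apply: cvgB; [exact: cvg_cst|exact: meps_cvg0|exact: cvg_cst|exact: meps_cvg0].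
Qed.

End Mollifier.

(** * L^2 convergence of mollifications *)

Section MollifierConvergence.
Context {R : realType}.
Notation pt := (R * R)%type.
Notation mR := (measurableTypeR R).
Notation mpt := (mR * mR)%type.

(** Lets an induction over measurable sets start from the open ones, for which convergence is
    known. *)
Lemma measurable_plane_open : @measurable _ mpt = <<s (open : set (set pt)) >>.
Proof.
apply/seteqP; split => [|A]; last first.
  apply: smallest_sub; first exact: sigma_algebra_measurable.
  by move=> U; exact: open_measurable_plane.
rewrite measurable_prod_measurableType; apply: smallest_sub; first exact: smallest_sigma_algebra.
pose S := g_sigma_algebraType (open : set (set pt)).
have m1 : measurable_fun setT (fst : S -> mR).
  apply: (measurability _ (RGenOpens.measurableE R)).
  move=> _ [_ [a [b ->]] <-]; rewrite setTI; apply: sub_sigma_algebra.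
  apply: (@open_comp pt R) => // x _; exact: cvg_fst.
have m2 : measurable_fun setT (snd : S -> mR).
  apply: (measurability _ (RGenOpens.measurableE R)).
  move=> _ [_ [a [b ->]] <-]; rewrite setTI; apply: sub_sigma_algebra.
  apply: (@open_comp pt R) => // x _; exact: cvg_snd.
move=> _ [A mA [B mB <-]].
have -> : A `*` B = (fst @^-1` A) `&` (snd @^-1` B) :> set mpt by [].
have := @measurableI _ S _ _ (m1 measurableT _ mA) (m2 measurableT _ mB).
by rewrite !setTI.
Qed.

Variables (D : set mpt) (z0 : pt) (r : R).
Hypotheses (mD : measurable D) (fD : (area D < +oo)%E) (r0 : 0 < r).
Hypothesis convD : forall (x z : pt) (e : R), 0 < e < 1 -> D x -> D z -> D ((1 - e) *: x + e *: z).
Hypothesis ballD : forall z : pt, `|z - z0| <= r -> D z.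

Let Mcvg (g : pt -> R) := moll_cvg D z0 r g.

Lemma sqint_approx_cvg (g : pt -> R) (h : nat -> pt -> R) : sqint area D g ->
  (forall n, sqint area D (h n)) -> (forall x, D x -> h n x @[n --> \oo] --> g x) ->
  (forall n x, D x -> `|g x - h n x| <= `|g x|) ->
  \int[area]_(x in D) ((g x - h n x) ^+ 2) @[n --> \oo] --> (0 : R).
Proof.
move=> g2 h2 hg hb.
have -> : (0 : R) = \int[area]_(x in D) (0 : R) by rewrite /Rintegral integral0.
apply: (@Rintegral_dominated_cvg _ _ _ area D mD (fun n x => (g x - h n x) ^+ 2) _ (fun x => g x ^+ 2)).
- by move=> n; apply: measurable_funX; apply: measurable_funB; [exact: g2.1|exact: (h2 n).1].
- move=> x Dx; rewrite (_ : 0 = (g x - g x) ^+ 2); last by rewrite subrr expr0n.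
  rewrite expr2; under eq_fun do rewrite expr2.
  by apply: cvgM; apply: cvgB => //; try exact: cvg_cst; exact: hg.
- exact: g2.2.
- by move=> n x Dx; rewrite normrX -[g x ^+ 2]real_normK ?num_real // lerXn2r ?nnegrE // hb.
Qed.

Lemma moll_cvg_limit (g : pt -> R) (h : nat -> pt -> R) : sqint area D g ->
  (forall n, sqint area D (h n)) -> (forall x, D x -> h n x @[n --> \oo] --> g x) ->
  (forall n x, D x -> `|g x - h n x| <= `|g x|) -> (forall n, Mcvg (h n)) -> Mcvg g.
Proof.
move=> g2 h2 hg hb hc; apply: moll_cvg_approx => // e e0.
have [n _ /(_ n (leqnn _)) /= Hn] := proj1 (cvgr0Pnorm_le _) (sqint_approx_cvg g2 h2 hg hb) _ e0.
by exists (h n); split; [exact: h2|exact: hc|exact: le_trans (ler_norm _) Hn].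
Qed.

(** Dynkin's pi-lambda theorem: open sets are stable under intersection, complements are handled by
    linearity from the constant 1, and countable disjoint unions as L^2 limits of finite ones. *)
Lemma moll_cvg_indic (B : set mpt) : measurable B -> Mcvg \1_B.
Proof.
move=> mB; have : <<s (open : set (set pt)) >> B by rewrite -measurable_plane_open.
apply: (@dynkin_induction _ mpt _ (fun B => Mcvg \1_B) measurable_plane_open).
- by move=> U V; exact: openI.
- by apply: moll_cvg_open => //; exact: openT.
- by move=> U; exact: moll_cvg_open.
- move=> S mS cS.
  have E : {in D, (fun x => 1 + -1 * \1_S x) =1 (\1_(~` S) : pt -> R)}.
    by move=> x _; rewrite !indicE in_setC; case: (_ \in _) => /=; ring.
  apply: (eq_moll_cvg E).
  apply: moll_cvgD => //.
  - apply: (@sqint_bounded _ _ _ area D mD 1) => // x _; by rewrite normr1.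
  - by apply: (sqintZ mD); exact: sqint_indic.
  - exact: moll_cvg_cst.
  - by apply: moll_cvgZ => //; exact: sqint_indic.
move=> F mF tF cF.
have cU n : measurable (\big[setU/set0]_(i < n) F i) /\ Mcvg \1_(\big[setU/set0]_(i < n) F i).
  elim: n => [|n [mU cU]].
    rewrite big_ord0; split => //; rewrite indic0; exact: moll_cvg_cst.
  have E : {in D, (fun x => \1_(\big[setU/set0]_(i < n) F i) x + \1_(F n) x) =1
      (\1_(\big[setU/set0]_(i < n.+1) F i) : pt -> R)}.
    move=> x _; rewrite big_ord_recr /= !indicE in_setU.
    case: (boolP (x \in F n)) => xF; rewrite ?orbF ?addr0 //.
    rewrite memNset ?add0r //; rewrite -bigcup_mkord => -[k /= kn Fk].
    have kE : k = n by apply: (tF k n I I); exists x; split => //; exact: set_mem.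
    by rewrite kE ltnn in kn.
  split; first by rewrite big_ord_recr; exact: measurableU.
  have s1 := sqint_indic mD fD mU; have s2 := sqint_indic mD fD (mF n).
  by apply: (eq_moll_cvg E); exact: (moll_cvgD mD fD r0 convD ballD s1 s2 cU (cF n)).
have mU : measurable (\bigcup_k F k) by exact: bigcup_measurable.
apply: (@moll_cvg_limit _ (fun n => \1_(\big[setU/set0]_(i < n) F i))).
- exact: sqint_indic.
- by move=> n; apply: sqint_indic => //; exact: (cU n).1.
- move=> x _; have [[k _ Fk]|nx] := pselect ((\bigcup_k F k) x).
    apply: cvg_near_cst; near=> n.
    rewrite !indicE !mem_set //; first by exists k.
    rewrite -bigcup_mkord; exists k => //=; near: n; exact: nbhs_infty_gt.
  rewrite indicE memNset //; apply: cvg_near_cst; apply: nearW => n.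
  rewrite indicE memNset // -bigcup_mkord => -[k _ Fk]; by apply: nx; exists k.
- move=> n x _; rewrite !indicE.
  case: (boolP (x \in \bigcup_k F k)) => xF.
    by rewrite normr1; case: (_ \in _); rewrite ?subrr ?subr0 ?normr0 ?normr1.
  rewrite memNset ?subr0 // -bigcup_mkord => -[k _ Fk].
  by move/negP: xF; apply; rewrite inE; exists k.
- by move=> n; exact: (cU n).2.
Unshelve. all: by end_near. Qed.

Import HBNNSimple.

Lemma moll_cvg_simple (h : {nnsfun mpt >-> R}) : Mcvg h.
Proof.
have E : {in D, (fun x => \sum_(y <- finmap.enum_fset (fset_set (range h))) y * \1_(h @^-1` [set y]) x) =1 h}.
  by move=> x _; rewrite [RHS]fimfunE fsbig_finite //=.
apply: (eq_moll_cvg E).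
suff H : forall s : seq R, sqint area D (fun x => \sum_(y <- s) y * \1_(h @^-1` [set y]) x)
    /\ Mcvg (fun x => \sum_(y <- s) y * \1_(h @^-1` [set y]) x) by have [] := H (finmap.enum_fset (fset_set (range h))).
elim => [|y s [IH1 IH2]].
  under eq_fun do rewrite big_nil.
  split; last exact: moll_cvg_cst.
  apply: (@sqint_bounded _ _ _ area D mD 0) => // x _; by rewrite normr0.
under eq_fun do rewrite big_cons.
have m1 : measurable (h @^-1` [set y]) by exact: measurable_sfunP.
have i1 := sqint_indic mD fD m1.
split; first by apply: (sqintD mD) => //; exact: (sqintZ mD).
apply: moll_cvgD => //; first exact: (sqintZ mD).
by apply: moll_cvgZ => //; exact: moll_cvg_indic.
Qed.

Lemma moll_cvg_ge0 (g : pt -> R) : sqint area D g -> (forall x, D x -> 0 <= g x) -> Mcvg g.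
Proof.
move=> g2 g0; have mg : measurable_fun D (EFin \o g) by apply/measurable_EFinP; exact: g2.1.
have g0' x : D x -> (0 <= (EFin \o g) x)%E by move=> Dx; rewrite lee_fin g0.
have hle n x : D x -> nnsfun_approx mD mg n x <= g x.
  by move=> Dx; rewrite -lee_fin; rewrite nnsfun_approxE; exact: le_approx.
apply: (@moll_cvg_limit _ (nnsfun_approx mD mg)) => //.
- move=> n; split; first exact: measurable_funTS.
  apply: (@integrable_dom_R _ _ _ _ D mD _ (fun x => g x ^+ 2)) g2.2.
    by apply: measurable_funX; exact: measurable_funTS.
  move=> x Dx; rewrite normrX lerXn2r ?nnegrE // ?g0 // ger0_norm //; exact: hle.
- move=> x Dx; have := cvg_nnsfun_approx mD mg g0' Dx.
  by move/fine_cvg.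
- move=> n x Dx; rewrite !ger0_norm ?g0 // ?subr_ge0 ?hle //.
  by rewrite lerBlDr lerDl.
- by move=> n; exact: moll_cvg_simple.
Qed.

Theorem moll_cvg_sqint (g : pt -> R) : sqint area D g -> Mcvg g.
Proof.
move=> g2.
have mp : sqint area D (fun x => Num.max (g x) 0).
  split; first exact: measurable_maxr g2.1 _.
  apply: (@integrable_dom_R _ _ _ _ D mD _ (fun x => g x ^+ 2)) g2.2.
    by apply: measurable_funX; exact: measurable_maxr g2.1 _.
  by move=> x _; rewrite normrX -[g x ^+ 2]real_normK ?num_real // lerXn2r ?nnegrE //; case: (leP (g x)) => _; rewrite ?normr0.
have mn := sqintB mD mp g2.
have E : {in D, (fun x => Num.max (g x) 0 + -1 * (Num.max (g x) 0 - g x)) =1 g}.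
  by move=> x _; ring.
apply: (eq_moll_cvg E).
apply: moll_cvgD => //; first exact: (sqintZ mD).
  by apply: moll_cvg_ge0 => // x _; rewrite le_max lexx orbT.
apply: moll_cvgZ => //; apply: moll_cvg_ge0 => // x _.
by rewrite subr_ge0 le_max lexx.
Qed.

End MollifierConvergence.

(** * Integration by parts on a triangle *)

Section Divergence.
Context {R : realType}.
Notation pt := (R * R)%type.
Notation mR := (measurableTypeR R).
Notation mpt := (mR * mR)%type.
Notation mu1 := (@lebesgue_measure R).
Notation I01 := (`[0, 1]%classic : set mR).

Lemma mI01 : @measurable _ mR I01.
Proof. exact: measurable_itv. Qed.

Lemma ge0_integral_reverse (f : mR -> \bar R) : measurable_fun I01 f ->
  (forall r, I01 r -> 0 <= f r)%E ->
  (\int[mu1]_(r in I01) f (1 - r)%R = \int[mu1]_(r in I01) f r)%E.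
Proof.
move=> mf f0; rewrite [RHS]integral_mkcond (@ge0_integral_affine _ (-1) 1) ?oppr_eq0 ?oner_neq0 //.
- rewrite normrN normr1 mul1e integral_mkcond; apply: eq_integral => r _.
  have E : aff (-1) 1 r = 1 - r by rewrite /aff mulN1r addrC.
  rewrite !patchE E.
  have -> : (1 - r \in I01) = (r \in I01); last by [].
  by apply/idP/idP; rewrite !inE /= !in_itv /= => /andP[h1 h2]; apply/andP; split; lra.
- by apply/(measurable_restrictT _ (measurable_itv _)).
- by move=> r; rewrite patchE; case: ifPn => // /set_mem; exact: f0.
Qed.

Lemma integral_reverse (f : mR -> R) : measurable_fun I01 f ->
  \int[mu1]_(r in I01) f (1 - r) = \int[mu1]_(r in I01) f r.
Proof.
move=> mf; rewrite /Rintegral; congr fine.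
have mf' : measurable_fun I01 (EFin \o f) by exact/measurable_EFinP.
rewrite integralE [in RHS]integralE; congr (_ - _)%E.
  have H := ge0_integral_reverse (measurable_funepos mf') (fun r _ => funepos_ge0 _ r).
  rewrite -[RHS]H; apply: eq_integral => r _.
  by rewrite !funeposE.
have H := ge0_integral_reverse (measurable_funeneg mf') (fun r _ => funeneg_ge0 _ r).
rewrite -[RHS]H; apply: eq_integral => r _.
by rewrite !funenegE.
Qed.

Lemma mu1_I01 : mu1 I01 = 1%E.
Proof. by rewrite lebesgue_measure_itv /= lte01 oppr0 addr0. Qed.

Lemma I01_fin : (mu1 I01 < +oo)%E.
Proof. by rewrite mu1_I01 ltry. Qed.

Lemma continuous_measurable_line (f : R -> R) : continuous f -> measurable_fun setT (f : mR -> R).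
Proof. exact: continuous_measurable_fun. Qed.

Lemma continuous_bounded_segment (f : R -> R) : continuous f ->
  exists M, forall r, I01 r -> `|f r| <= M.
Proof.
move=> cf.
have [M [_ HM]] := @compact_bounded _ _ _ (continuous_compact (continuous_subspaceT cf) (@segment_compact R 0 1)).
exists (M + 1) => r Ir; apply: (HM (M + 1)); first by rewrite ltrDl.
by exists r.
Qed.

Lemma sqint_continuous_segment (f : R -> R) : continuous f -> sqint mu1 I01 f.
Proof.
move=> cf; have [M HM] := continuous_bounded_segment cf.
apply: (@sqint_bounded _ _ _ mu1 I01 (measurable_itv _) M) => //; first exact: I01_fin.
by apply: measurable_funTS; exact: continuous_measurable_line.
Qed.

Lemma integrable_continuous_segment (f : R -> R) : continuous f -> mu1.-integrable I01 (EFin \o f).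
Proof. by move=> /sqint_continuous_segment; apply: sqint_integrable; [exact: measurable_itv|exact: I01_fin]. Qed.

Lemma integral_derive_segment (F f : R -> R) (a b : R) : a < b -> continuous f ->
  (forall x, is_derive x (1 : R) F (f x)) ->
  (\int[mu1]_(x in `[a, b]) (f x)%:E = (F b - F a)%:E)%E.
Proof.
move=> ab cf dF.
have cF : continuous F.
  by move=> x; apply: differentiable_continuous; apply/derivable1_diffP; case: (dF x).
rewrite (@continuous_FTC2 _ f F) //.
- exact: continuous_subspaceT.
- split.
  + by move=> x _; case: (dF x).
  + by apply: cvg_at_right_filter; exact: cF.
  + by apply: cvg_at_left_filter; exact: cF.
- by move=> x _; rewrite derive1E; case: (dF x).
Qed.

Definition ref_tri : set mpt := [set x | [/\ 0 < x.1, 0 < x.2 & x.1 + x.2 < 1]].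

Lemma ref_tri_open : open (ref_tri : set pt).
Proof.
have -> : ref_tri = fst @^-1` [set t : R | 0 < t] `&` snd @^-1` [set t : R | 0 < t] `&`
   (fun x : pt => x.1 + x.2) @^-1` [set t : R | t < 1].
  by apply/seteqP; split => x /=; [case=> a b c; split|case=> -[a b] c; split].
have cf : continuous (fst : pt -> R) by move=> x; exact: cvg_fst.
have cs : continuous (snd : pt -> R) by move=> x; exact: cvg_snd.
apply: openI; first apply: openI.
- by apply: open_comp => [x _|]; [exact: cf|exact: open_gt].
- by apply: open_comp => [x _|]; [exact: cs|exact: open_gt].
by apply: open_comp => [x _|]; [apply: cvgD; [exact: cf|exact: cs]|exact: open_lt].
Qed.

Definition unit_square : set mpt := I01 `*` I01.

Transparent area.
Lemma unit_square_area : area unit_square = 1%E.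
Proof.
rewrite -[LHS]/((mu1 \x mu1)%E (I01 `*` I01)) product_measure1E; try exact: measurable_itv.
by rewrite [X in (X * _)%E]mu1_I01 [X in (_ * X)%E]mu1_I01 mule1.
Qed.
Opaque area.

Lemma continuous_on_line (F : pt -> R) (p v : pt) (c : R -> pt) : continuous F ->
  (forall r, c r = p + r *: v) -> continuous (fun r : R => F (c r)).
Proof.
move=> cF cE; rewrite (_ : (fun r : R => F (c r)) = (fun r : R => F (p + r *: v))); last first.
  by apply/funext => r; rewrite cE.
move=> r; apply: (@continuous_comp _ _ _ (fun r : R => p + r *: v) F); last exact: cF.
by apply: cvgD; [exact: cvg_cst|apply: cvgZr_tmp; exact: cvg_id].
Qed.

Lemma ref_tri_sub : ref_tri `<=` unit_square.
Proof. by move=> x [h1 h2 h3]; split; rewrite /= in_itv /=; apply/andP; split; lra. Qed.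

Lemma continuous_bounded_square (f : pt -> R) : continuous f ->
  exists M, forall x, unit_square x -> `|f x| <= M.
Proof.
move=> cf.
have cS : compact (unit_square : set pt) by apply: compact_setX; exact: segment_compact.
have [M [_ HM]] := @compact_bounded _ _ _ (continuous_compact (continuous_subspaceT cf) cS).
exists (M + 1) => r Ir; apply: (HM (M + 1)); first by rewrite ltrDl.
by exists r.
Qed.

Lemma sqint_continuous_square (A : set mpt) (f : pt -> R) : measurable A -> A `<=` unit_square ->
  continuous f -> sqint area A f.
Proof.
move=> mA As cf; have [M HM] := continuous_bounded_square cf.
apply: (@sqint_bounded _ _ _ area A mA M) => //.
- apply: (@le_lt_trans _ _ (area unit_square)); last by rewrite unit_square_area ltry.
  apply: le_measure; rewrite ?inE //; apply: measurableX; exact: measurable_itv.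
- by apply: measurable_funTS; exact: continuous_measurable_plane.
- by move=> x Ax; apply: HM; exact: As.
Qed.

Lemma ref_tri_fin : (area ref_tri < +oo)%E.
Proof.
apply: (@le_lt_trans _ _ (area unit_square)); last by rewrite unit_square_area ltry.
apply: le_measure; rewrite ?inE; [exact: (open_measurable_plane ref_tri_open)| |exact: ref_tri_sub].
by apply: measurableX; exact: measurable_itv.
Qed.

(** At height [y] the slice is []0, 1 - y[], on which the fundamental theorem of calculus applies;
    its ends lie on the hypotenuse and on the vertical side. *)
Lemma ref_tri_divergence (F F1 : mpt -> R) : continuous (F : pt -> R) -> continuous (F1 : pt -> R) ->
  (forall y s : R, is_derive s (1 : R) (fun s => F (s, y)) (F1 (s, y))) ->
  \int[area]_(x in ref_tri) F1 x = \int[mu1]_(r in I01) (F (1 - r, r) - F (0, r)).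
Proof.
move=> cF cF1 dF.
have mT := open_measurable_plane ref_tri_open.
have iF : area.-integrable ref_tri (EFin \o F1).
  by apply: (sqint_integrable mT ref_tri_fin); apply: sqint_continuous_square => //; exact: ref_tri_sub.
have cG : continuous (fun r : R => F (1 - r, r) - F (0, r)).
  move=> r; apply: cvgB.
    apply: (@continuous_on_line F (1, 0) (-1, 1)) => // t; congr (_, _) => /=; rewrite -[_ *: _]/(_ * _); ring.
  apply: (@continuous_on_line F (0, 0) (0, 1)) => // t; congr (_, _) => /=; rewrite -[_ *: _]/(_ * _); ring.
rewrite /Rintegral; congr fine.
rewrite integral_mkcond -integral21_prod_meas1; last exact/(integrable_mkcond _ mT).
rewrite -integral_itv_bndo_bndc; last first.
  by apply: measurable_funTS; apply/measurable_EFinP; exact: continuous_measurable_line.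
rewrite -integral_itv_obnd_cbnd; last first.
  by apply: measurable_funTS; apply/measurable_EFinP; exact: continuous_measurable_line.
rewrite [RHS]integral_mkcond; apply: eq_integral => y _.
rewrite /fubini_G patchE; case: ifPn => [|/negP] yI.
  move: yI; rewrite inE /= in_itv /= => /andP[y0 y1].
  have -> : (\int[mu1]_x (((EFin \o F1) \_ ref_tri) (x, y)) = \int[mu1]_(x in `]0%R, (1 - y)%R[) (F1 (x, y))%:E)%E.
    rewrite [RHS]integral_mkcond; apply: eq_integral => x _; rewrite !patchE.
    have -> : ((x, y) \in ref_tri) = (x \in (`]0%R, (1 - y)%R[%classic : set mR)); last by [].
    apply/idP/idP; rewrite !inE /= in_itv /=.
      by case=> /= h1 h2 h3; apply/andP; split; lra.
    by move=> /andP[h1 h2]; split => /=; lra.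
  have cf : continuous (fun s : R => F1 (s, y)).
    by apply: (@continuous_on_line F1 (0, y) (1, 0)) => // t; congr (_, _) => /=; rewrite -[_ *: _]/(_ * _); ring.
  rewrite integral_itv_obnd_cbnd; last by apply: measurable_funTS; apply/measurable_EFinP; exact: continuous_measurable_line.
  rewrite integral_itv_bndo_bndc; last by apply: measurable_funTS; apply/measurable_EFinP; exact: continuous_measurable_line.
  by rewrite (@integral_derive_segment (fun s => F (s, y))) // subr_gt0.
rewrite (eq_integral (cst 0%E)) ?integral0 // => x _.
rewrite patchE memNset // => -[/= h1 h2 h3]; apply: yI.
by rewrite inE /= in_itv /=; apply/andP; split; lra.
Qed.

Definition tri (o a b : pt) : set mpt :=
  [set x | exists s r : R, [/\ 0 < s, 0 < r, s + r < 1 & x = o + s *: a + r *: b]].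

Lemma triC o a b : tri o a b = tri o b a.
Proof.
by apply/seteqP; split => x [s [r [h1 h2 h3 ->]]]; exists r, s; split; rewrite // ?[r + s]addrC // addrAC.
Qed.

(** Cramer's rule: dividing by [cross a b] recovers the coordinates of a point in the frame
    [(o, a, b)]. *)
Lemma cross_coord1 (o a b : pt) (x : mpt) : cross (lin o a b x - o) b = x.1 * cross a b.
Proof. by rewrite /cross /lin /=; rewrite -?[_ *: _]/(_ * _); ring. Qed.

Lemma cross_coord2 (o a b : pt) (x : mpt) : cross a (lin o a b x - o) = x.2 * cross a b.
Proof. by rewrite /cross /lin /=; rewrite -?[_ *: _]/(_ * _); ring. Qed.

Lemma lin_coords (o a b x : pt) : cross a b != 0 ->
  lin o a b (cross (x - o) b / cross a b, cross a (x - o) / cross a b) = x.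
Proof.
case: x o a b => x1 x2 [p1 p2] [a1 a2] [b1 b2]; rewrite /lin /cross /= => ab.
by congr (_, _) => /=; rewrite -?[_ *: _]/(_ * _); field.
Qed.

Lemma lin_inj o a b : cross a b != 0 -> injective (lin o a b : mpt -> mpt).
Proof.
move=> ab x y E; have := cross_coord1 o a b x; have := cross_coord2 o a b x.
rewrite E cross_coord1 cross_coord2 => /(mulIf ab) e2 /(mulIf ab) e1.
by rewrite [x]surjective_pairing [y]surjective_pairing e1 e2.
Qed.

Lemma lin_tri o a b : cross a b != 0 -> lin o a b @^-1` tri o a b = ref_tri.
Proof.
move=> ab; apply/seteqP; split => x /=.
  move=> [s [r [h1 h2 h3 E]]].
  by have -> : x = (s, r) by apply: (lin_inj (o := o) ab).
by case=> h1 h2 h3; exists x.1, x.2.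
Qed.

Lemma continuous_lin o a b : continuous (lin o a b : pt -> pt).
Proof.
move=> x; apply: cvgD; first (apply: cvgD; first exact: cvg_cst); apply: cvgZl.
  exact: cvg_fst.
exact: cvg_snd.
Qed.

Lemma smooth_coord1 (o a b : pt) : smooth (fun x : pt => cross (x - o) b / cross a b).
Proof.
have -> : (fun x : pt => cross (x - o) b / cross a b) =
  (fun x : pt => lform (b.2 / cross a b) (- b.1 / cross a b) x + (- (o.1 * b.2 - o.2 * b.1) / cross a b)).
  by apply/funext => x; rewrite /lform [in LHS]/cross /=; ring.
exact: smooth_lform.
Qed.

Lemma open_tri_oab o a b : cross a b != 0 -> open (tri o a b : set pt).
Proof.
move=> ab.
pose i1 (x : pt) : R := cross (x - o) b / cross a b.
pose i2 (x : pt) : R := cross a (x - o) / cross a b.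
have c1 : continuous i1.
  by apply: differentiable_continuous_plane => x; apply: smooth_differentiable; exact: smooth_coord1.
have c2 : continuous i2.
  have -> : i2 = (fun x : pt => cross (x - o) a / cross b a).
    by apply/funext => x; rewrite /i2 (_ : cross b a = - cross a b) ?invrN /cross; ring.
  by apply: differentiable_continuous_plane => x; apply: smooth_differentiable; exact: smooth_coord1.
have -> : (tri o a b : set pt) = i1 @^-1` [set t : R | 0 < t] `&` i2 @^-1` [set t : R | 0 < t] `&`
   (fun x : pt => i1 x + i2 x) @^-1` [set t : R | t < 1].
  apply/seteqP; split => x.
    move=> [s [r [h1 h2 h3 ->]]].
    have := cross_coord1 o a b (s, r); have := cross_coord2 o a b (s, r).
    by rewrite /= /i1 /i2 /lin /= => -> ->; rewrite !mulfK.
  move=> [[/= h1 h2] h3]; exists (i1 x), (i2 x); split => //.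
  by rewrite -[RHS]/(lin o a b (i1 x, i2 x)) lin_coords.
apply: openI; first apply: openI.
- by apply: open_comp => [x _|]; [exact: c1|exact: open_gt].
- by apply: open_comp => [x _|]; [exact: c2|exact: open_gt].
by apply: open_comp => [x _|]; [apply: cvgD; [exact: c1|exact: c2]|exact: open_lt].
Qed.

Lemma tri_fin o a b : cross a b != 0 -> area (tri o a b) = (`|cross a b|%:E * area ref_tri)%E.
Proof.
move=> ab; have mT := open_measurable_plane (open_tri_oab (o := o) ab).
have := @ge0_integral_lin_on _ o a b _ (cst 1%E) ab mT (measurable_cst _) (fun _ _ => lee01).
rewrite lin_tri // -[X in (_ = _ * X)%E]/(\int[area]_(x in ref_tri) cst 1 x)%E integral_cst //.
by rewrite integral_cst ?mul1e //; exact: (open_measurable_plane ref_tri_open).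
Qed.

Lemma tri_fin_lt o a b : cross a b != 0 -> (area (tri o a b) < +oo)%E.
Proof. by move=> ab; rewrite tri_fin // lte_mul_pinfty // ?ref_tri_fin ?ge0_fin_numE // lee_fin. Qed.

Lemma sqint_continuous_tri o a b (f : pt -> R) : cross a b != 0 -> continuous f ->
  sqint area (tri o a b) f.
Proof.
move=> ab cf; have mT := open_measurable_plane (open_tri_oab (o := o) ab).
have [M HM] := continuous_bounded_square (f := f \o lin o a b)
  (fun x => continuous_comp (@continuous_lin o a b x) (cf _)).
apply: (@sqint_bounded _ _ _ area _ mT M) => //; first exact: tri_fin_lt.
  by apply: measurable_funTS; exact: continuous_measurable_plane.
move=> _ [s [r [h1 h2 h3 ->]]]; have := HM (s, r); apply.
by apply: ref_tri_sub; split.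
Qed.

(** In the frame [(a, b)] the derivative along [a] is the first partial derivative, so the side
    parallel to [a] contributes nothing. *)
Lemma tri_divergence o a b (w : pt -> R) : cross a b != 0 -> smooth w ->
  \int[area]_(x in tri o a b) 'D_a w x =
  `|cross a b| * \int[mu1]_(r in I01) (w (o + (1 - r) *: a + r *: b) - w (o + r *: b)).
Proof.
move=> ab sw; have mT := open_measurable_plane (open_tri_oab (o := o) ab).
have cDw := continuous_smooth_derive (v := a) sw.
have cw := differentiable_continuous_plane (fun x => smooth_differentiable x sw).
have i := sqint_integrable mT (tri_fin_lt o ab) (sqint_continuous_tri o ab cDw).
have [_ ->] := integral_lin_on o ab mT i.
rewrite lin_tri //; congr (_ * _).
have c1 : continuous ((w \o lin o a b) : pt -> R).
  by move=> x; apply: continuous_comp; [exact: continuous_lin|exact: cw].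
have c2 : continuous (('D_a w \o lin o a b) : pt -> R).
  by move=> x; apply: continuous_comp; [exact: continuous_lin|exact: cDw].
have c3 (y s : R) : is_derive s (1 : R) (fun s => (w \o lin o a b) (s, y)) (('D_a w \o lin o a b) (s, y)).
  have := line_derive (o + y *: b) a s (fun z => smooth_differentiable z sw).
  rewrite /lin /= (addrAC o) => H.
  by rewrite (_ : (fun s => _) = (fun s : R => w (o + y *: b + s *: a))) //; apply/funext => z; rewrite addrAC.
apply: etrans (ref_tri_divergence c1 c2 c3) _.
by apply: eq_Rintegral => r _; rewrite /lin /= scale0r addr0.
Qed.

Lemma derive_coord1 (o a b x : pt) : cross a b != 0 -> 'D_a (fun x : pt => cross (x - o) b / cross a b) x = 1.
Proof.
move=> ab.
have -> : (fun x : pt => cross (x - o) b / cross a b) =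
  (fun x : pt => lform (b.2 / cross a b) (- b.1 / cross a b) x + (- (o.1 * b.2 - o.2 * b.1) / cross a b)).
  by apply/funext => y; rewrite /lform [in LHS]/cross /=; ring.
have [d1 d2] := is_diff_lform (b.2 / cross a b) (- b.1 / cross a b) (- (o.1 * b.2 - o.2 * b.1) / cross a b) x.
rewrite deriveE // d2 /lform -(divff ab) [in RHS]/cross; by ring.
Qed.

Lemma deriveM_plane (f g : pt -> R) v x : differentiable f x -> differentiable g x ->
  'D_v (fun y => f y * g y) x = f x * 'D_v g x + g x * 'D_v f x.
Proof.
move=> df dg; have := @deriveM _ _ f g x v (diff_derivable (v := v) df) (diff_derivable (v := v) dg).
by move=> E; rewrite -[in LHS]/('D_v (f * g) x) E.
Qed.

(** The divergence formula for [w ^+ 2] times the first coordinate. The weight vanishes on the side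
    through [o] along [b] and equals [1 - r] on the side opposite [o], so only that side
    survives. *)
Lemma weighted_divergence o a b (w : pt -> R) : cross a b != 0 -> smooth w ->
  \int[area]_(x in tri o a b) (2 * (w x * 'D_a w x * (cross (x - o) b / cross a b)) + w x ^+ 2) =
  `|cross a b| * \int[mu1]_(r in I01) ((1 - r) * w (o + (1 - r) *: a + r *: b) ^+ 2).
Proof.
move=> ab sw.
pose l1 (x : pt) := cross (x - o) b / cross a b.
have sl : smooth l1 by exact: smooth_coord1.
have sww := smoothM sw sw.
have := tri_divergence o ab (smoothM sww sl).
rewrite (_ : (fun r => _) = (fun r : R => (1 - r) * w (o + (1 - r) *: a + r *: b) ^+ 2)); last first.
  apply/funext => r.
  have -> : l1 (o + (1 - r) *: a + r *: b) = 1 - r.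
    by rewrite /l1 -[X in X - o]/(lin o a b (1 - r, r)) cross_coord1 mulfK.
  have -> : l1 (o + r *: b) = 0.
    rewrite -[X in l1 X](_ : lin o a b (0, r) = _); last by rewrite /lin /= scale0r addr0.
    by rewrite /l1 cross_coord1 mulfK.
  by ring.
move=> <-; apply: eq_Rintegral => x _.
rewrite deriveM_plane; [|exact: smooth_differentiable..].
rewrite deriveM_plane; [|exact: smooth_differentiable..].
rewrite derive_coord1 // -/(l1 x); ring.
Qed.

(** Sum of the weighted identities for [a] and for [b]: after reversal of the parameter in the
    second, the weights [1 - r] and [r] add up to one. Young's inequality splits the mixed terms,
    and the 4 collects two copies of [w ^+ 2] from each identity. *)
Lemma side_trace_inequality o a b (w : pt -> R) : cross a b != 0 -> smooth w ->
  `|cross a b| * \int[mu1]_(r in I01) (w (o + a + r *: (b - a)) ^+ 2) <=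
  4 * \int[area]_(x in tri o a b) (w x ^+ 2) + \int[area]_(x in tri o a b) ('D_a w x ^+ 2)
    + \int[area]_(x in tri o a b) ('D_b w x ^+ 2).
Proof.
move=> ab sw.
have ba : cross b a != 0 by rewrite (_ : cross b a = - cross a b) ?oppr_eq0 // /cross; ring.
have mT := open_measurable_plane (open_tri_oab (o := o) ab).
have cw := differentiable_continuous_plane (fun x => smooth_differentiable x sw).
have cD v : continuous ('D_v w) by exact: continuous_smooth_derive.
have E1 := weighted_divergence o ab sw.
have E2 := weighted_divergence o ba sw.
pose p r : R := w (o + a + r *: (b - a)) ^+ 2.
have pE r : p r = w (o + (1 - r) *: a + r *: b) ^+ 2.
  congr (w _ ^+ 2); rewrite scalerBl scale1r scalerBr.
  by rewrite -!addrA; congr (_ + (_ + _)); rewrite addrC.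
have cp : continuous p.
  move=> r; rewrite (_ : p = (fun r => w (o + a + r *: (b - a)) * w (o + a + r *: (b - a)))); last first.
    by apply/funext => t; rewrite /p expr2.
  by apply: cvgM; apply: (@continuous_on_line w (o + a) (b - a)).
have c1 : continuous (fun r : R => (1 - r) * p r).
  by move=> r; apply: cvgM; [apply: cvgB; [exact: cvg_cst|exact: cvg_id]|exact: cp].
have c2 : continuous (fun r : R => r * p r).
  by move=> r; apply: cvgM; [exact: cvg_id|exact: cp].
have I1 := integrable_continuous_segment c1.
have I2 := integrable_continuous_segment c2.
have E1' : \int[mu1]_(r in I01) ((1 - r) * w (o + (1 - r) *: a + r *: b) ^+ 2) =
    \int[mu1]_(r in I01) ((1 - r) * p r).
  by apply: eq_Rintegral => r _; rewrite pE.
have E2' : \int[mu1]_(r in I01) ((1 - r) * w (o + (1 - r) *: b + r *: a) ^+ 2) =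
    \int[mu1]_(r in I01) (r * p r).
  rewrite -(integral_reverse (f := fun r => r * p r)); last by apply: measurable_funTS; exact: continuous_measurable_line.
  by apply: eq_Rintegral => r _; rewrite pE opprB addrCA subrr addr0 addrAC.
have E3 : \int[mu1]_(r in I01) p r = \int[mu1]_(r in I01) ((1 - r) * p r) + \int[mu1]_(r in I01) (r * p r).
  rewrite -(Rintegral_add mI01 I1 I2).
  by apply: eq_Rintegral => r _; ring.
rewrite -/(p _) (_ : (fun r => w _ ^+ 2) = p) // E3 mulrDr -E1' -E2' -E1.
have -> : `|cross a b| = `|cross b a| by rewrite -normrN; congr `|_|; rewrite /cross; ring.
rewrite -E2 (triC o b a).
pose l1 (x : pt) := cross (x - o) b / cross a b.
pose l2 (x : pt) := cross (x - o) a / cross b a.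
have cl1 : continuous l1 by apply: differentiable_continuous_plane => x; apply: smooth_differentiable; exact: smooth_coord1.
have cl2 : continuous l2 by apply: differentiable_continuous_plane => x; apply: smooth_differentiable; exact: smooth_coord1.
have cq (v : pt) (l : pt -> R) : continuous l -> continuous (fun x => 2 * (w x * 'D_v w x * l x) + w x ^+ 2).
  move=> cl x; apply: cvgD.
    by apply: cvgMr; apply: cvgM; [apply: cvgM; [exact: cw|exact: cD]|exact: cl].
  by rewrite expr2; under eq_fun do rewrite expr2; apply: cvgM; exact: cw.
have J (f : pt -> R) : continuous f -> area.-integrable (tri o a b) (EFin \o f).
  by move=> cf; apply: (sqint_integrable mT (tri_fin_lt o ab)); exact: sqint_continuous_tri.
have S (f : pt -> R) : continuous f -> area.-integrable (tri o a b) (EFin \o (fun x => f x ^+ 2)).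
  by move=> cf; have [] := sqint_continuous_tri o ab cf.
rewrite -(Rintegral_add mT (J _ (cq a l1 cl1)) (J _ (cq b l2 cl2))).
have S1 := S _ cw; have S2 := S _ (cD a); have S3 := S _ (cD b).
rewrite -(Rintegral_scale mT 4 S1).
have S1' := integrable_scale_R mT 4 S1.
rewrite -(Rintegral_add mT S1' S2) -(Rintegral_add mT (integrable_sum_R mT S1' S2) S3).
apply: le_Rintegral => //.
- exact: (integrable_sum_R mT (J _ (cq a l1 cl1)) (J _ (cq b l2 cl2))).
- exact: (integrable_sum_R mT (integrable_sum_R mT S1' S2) S3).
move=> x [s [r [h1 h2 h3 xE]]].
have -> : l1 x = s by rewrite xE /l1 -[X in X - o]/(lin o a b (s, r)) cross_coord1 mulfK.
have -> : l2 x = r.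
  rewrite xE /l2 (_ : o + s *: a + r *: b = lin o b a (r, s)) ?cross_coord1 ?mulfK //.
  by rewrite /lin /= addrAC.
have k (p0 q z : R) : 0 < z -> z < 1 -> 2 * (p0 * q * z) <= p0 ^+ 2 + q ^+ 2.
  move=> z0 z1; have : 0 <= (p0 - z * q) ^+ 2 by exact: sqr_ge0.
  have : 0 <= (1 - z ^+ 2) * q ^+ 2 by rewrite mulr_ge0 ?sqr_ge0 // subr_ge0 expr_le1 // ltW.
  by nra.
have k1 := k (w x) ('D_a w x) s h1 ltac:(lra).
have k2 := k (w x) ('D_b w x) r h2 ltac:(lra).
move: ('D_a w x) ('D_b w x) (w x) k1 k2 => p0 q0 z0; lra.
Qed.

End Divergence.

(** * Completeness of L^2 *)

Section RieszFischer.
Context d (T : measurableType d) (R : realType) (mu : {measure set T -> \bar R}).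
Variable D : set T.
Hypotheses (mD : measurable D) (fD : (mu D < +oo)%E).

Definition sqdist (f g : T -> R) : R := \int[mu]_(x in D) ((f x - g x) ^+ 2).

Lemma sqdist_ge0 f g : 0 <= sqdist f g.
Proof. by apply: Rintegral_ge0 => x _; exact: sqr_ge0. Qed.

Lemma sqdistC f g : sqdist f g = sqdist g f.
Proof. by apply: eq_Rintegral => x _; rewrite -sqrrN opprB. Qed.

Lemma sqdist_triangle (g f h : T -> R) : sqint mu D f -> sqint mu D g -> sqint mu D h ->
  sqdist f h <= 2 * sqdist f g + 2 * sqdist g h.
Proof.
move=> f2 g2 h2; have := sq_integralD_le mD (sqintB mD f2 g2) (sqintB mD g2 h2).
apply: le_trans; rewrite le_eqVlt; apply/orP; left; apply/eqP.
by apply: eq_Rintegral => x _; rewrite addrA subrK.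
Qed.

Lemma integral_sqintE (f : T -> R) : sqint mu D f ->
  (\int[mu]_(x in D) (f x ^+ 2)%:E = (\int[mu]_(x in D) f x ^+ 2)%R%:E)%E.
Proof. by move=> [_ f2]; rewrite /Rintegral fineK //; exact: integrable_fin_num. Qed.

Lemma abs_le_weighted_sq (c z : R) : 0 < c -> `|z| <= c * z ^+ 2 + c^-1.
Proof.
move=> c0; rewrite -(ler_pM2l c0) mulrDr divff ?gt_eqF //.
have -> : c * (c * z ^+ 2) = (c * `|z|) ^+ 2 by rewrite exprMn real_normK ?num_real //; ring.
have := sqr_ge0 (c * `|z| - 1); have := sqr_ge0 (c * `|z| + 1); nra.
Qed.

Lemma sum_half_le n : \sum_(k < n) (2 ^- k : R) <= 2.
Proof.
have -> : \sum_(k < n) (2 ^- k : R) = 2 - 2 * 2 ^- n.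
  elim: n => [|n IH]; first by rewrite big_ord0 expr0 invr1; ring.
  by rewrite big_ord_recr /= IH exprS invfM; field; rewrite expf_neq0.
by rewrite gerBl mulr_ge0 // invr_ge0 exprn_ge0.
Qed.

(** Young's inequality with weight [2 ^+ n] turns a squared distance [4 ^- n] into an L^1 distance
    of at most [2 ^- n] times [1 + mu D]. The sum of the moduli of the increments is therefore
    integrable, and the sequence converges wherever that sum is finite. *)
Lemma sqint_summable_cvg (f : nat -> T -> R) : (forall n, sqint mu D (f n)) ->
  (forall n, sqdist (f n.+1) (f n) <= 4 ^- n) ->
  exists A, [/\ measurable A, A `<=` D, mu (D `\` A) = 0%E & forall x, A x -> cvgn (f ^~ x)].
Proof.
move=> f2 fd.
pose z n x := f n.+1 x - f n x.
have z2 n : sqint mu D (z n) by exact: sqintB.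
pose h x := (\sum_(k <oo) (`|z k x|)%:E)%E.
have mz n : measurable_fun D (fun x => (`|z n x|)%:E).
  by apply/measurable_EFinP; apply: measurableT_comp => //; exact: (z2 n).1.
have h0 x : (0 <= h x)%E by apply: nneseries_ge0 => n _ _; rewrite lee_fin.
pose m := fine (mu D).
have mE : mu D = m%:E by rewrite /m fineK // ge0_fin_numE.
have m0 : 0 <= m by rewrite -lee_fin -mE.
have zk n : (\int[mu]_(x in D) (`|z n x|)%:E <= (2 ^- n * (1 + m))%:E)%E.
  have zi := sqint_integrable mD fD (z2 n).
  have ci : mu.-integrable D (EFin \o cst (2 ^- n : R)).
    apply: (sqint_integrable mD fD); apply: (@sqint_bounded _ _ _ mu D mD (2 ^- n)) => // x _.
    by rewrite ger0_norm // invr_ge0 exprn_ge0.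
  have qi := integrable_scale_R mD (2 ^+ n) (z2 n).2.
  rewrite -[leLHS]fineK; last by apply: integrable_fin_num => //; exact: integrable_abs_R.
  rewrite lee_fin -/(Rintegral _ _ _).
  apply: (@le_trans _ _ (\int[mu]_(x in D) (2 ^+ n * z n x ^+ 2 + 2 ^- n))).
    apply: le_Rintegral => //; first exact: integrable_abs_R.
      exact: (integrable_sum_R mD qi ci).
    by move=> x _; apply: abs_le_weighted_sq; rewrite exprn_gt0.
  rewrite (Rintegral_add mD qi ci) (Rintegral_scale mD _ (z2 n).2) Rintegral_cst // -/m mulrDr mulr1.
  apply: lerD => //; apply: (@le_trans _ _ (2 ^+ n * 4 ^- n)).
    by apply: ler_wpM2l; [exact: exprn_ge0|exact: fd].
  rewrite (_ : 4 = 2 * 2 :> R); last by ring.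
  by rewrite exprMn invfM mulrA divff ?mul1r // expf_neq0.
have hfin : (\int[mu]_(x in D) h x < +oo)%E.
  rewrite integral_nneseries //.
  apply: (@le_lt_trans _ _ (2 * (1 + m))%:E); last exact: ltry.
  apply: lime_le.
    by apply: is_cvg_nneseries => n _ _; apply: integral_ge0 => x _; rewrite lee_fin.
  apply: nearW => n; rewrite big_mkord.
  apply: (@le_trans _ _ (\sum_(k < n) (2 ^- k * (1 + m))%:E)%E); first by apply: lee_sum => k _.
  rewrite sumEFin lee_fin -mulr_suml; apply: ler_wpM2r; last exact: sum_half_le.
  by rewrite addr_ge0.
have mh : measurable_fun D h.
  by apply: ge0_emeasurable_sum => // n x _ _; rewrite lee_fin.
have hi : mu.-integrable D h.
  apply/integrableP; split => //; apply: le_lt_trans hfin.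
  by rewrite le_eqVlt; apply/orP; left; apply/eqP; apply: eq_integral => x _; rewrite gee0_abs.
pose A := D `&` [set x | (h x < +oo)%E].
have mA : measurable A by exact: emeasurable_fun_infty_o.
exists A; split => //; first by move=> x [].
  have mDA : measurable (D `\` A) by exact: measurableD.
  have [N [mN N0 HN]] := integrable_ae mD hi.
  apply/eqP; rewrite eq_le measure_ge0 andbT -N0; apply: le_measure; rewrite ?inE //.
  move=> x [Dx nA]; apply: HN => /= /(_ Dx) hx; apply: nA; split => //=.
  by rewrite -ge0_fin_numE.
move=> x [Dx hx].
have cz : cvgn (series (fun n => z n x)).
  by apply: normed_cvg; apply: (@nnseries_is_cvg _ (fun k => `|z k x|)).
have E : f ^~ x = (fun n => f 0%N x + series (fun n => z n x) n).
  by apply/funext => n; rewrite (eq_sum_telescope (f ^~ x)).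
by rewrite E; apply: is_cvgD => //; exact: is_cvg_cst.
Qed.

(** Fatou's lemma: the bound survives the almost everywhere limit, with no integrability of [g]
    known beforehand. *)
Lemma sqdist_limit_le (f : nat -> T -> R) (g h : T -> R) (A : set T) (c : R) (N : nat) :
  (forall n, sqint mu D (f n)) -> sqint mu D h -> measurable_fun D g ->
  measurable A -> A `<=` D -> mu (D `\` A) = 0%E ->
  (forall x, A x -> f n x @[n --> \oo] --> g x) ->
  (forall n, (N <= n)%N -> sqdist h (f n) <= c) ->
  (\int[mu]_(x in D) ((h x - g x) ^+ 2)%:E <= c%:E)%E.
Proof.
move=> f2 h2 mg mA AD nA cA Hc.
have mhg : measurable_fun D (fun x => ((h x - g x) ^+ 2)%:E).
  by apply/measurable_EFinP; apply: measurable_funX; apply: measurable_funB => //; exact: h2.1.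
rewrite (@ge0_negligible_integral _ _ _ mu D (D `\` A)) //; last 2 first.
  exact: measurableD.
  by move=> x _; rewrite lee_fin sqr_ge0.
have -> : D `\` (D `\` A) = A by rewrite setDD; apply/setIidr.
pose F n x := ((h x - f n x) ^+ 2)%:E.
have mF n : measurable_fun D (F n).
  apply/measurable_EFinP; apply: measurable_funX; apply: measurable_funB; first exact: h2.1.
  exact: (f2 n).1.
rewrite (eq_integral (fun x => limn_einf (F ^~ x))); last first.
  move=> x /set_mem Ax; apply/esym; apply: (cvg_limn_einf_sup _).1.
  apply: cvg_EFin; first exact: nearW.
  rewrite /F /comp /=; under eq_fun do rewrite expr2; rewrite expr2.
  by apply: cvgM; apply: cvgB; try exact: cvg_cst; exact: cA.
apply: le_trans (fatou _ _ _ _) _ => //.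
- by move=> n; apply: measurable_funS (mF n).
- by move=> n x _; rewrite lee_fin sqr_ge0.
rewrite limn_einf_lim; apply: lime_le; first exact: is_cvg_einfs.
apply: nearW => n.
apply: (@le_trans _ _ (\int[mu]_(x in A) F (maxn n N) x)%E).
  by apply: ereal_inf_lbound; exists (maxn n N) => //=; rewrite leq_maxl.
apply: (@le_trans _ _ (\int[mu]_(x in D) F (maxn n N) x)%E).
  by apply: ge0_subset_integral => // x _; rewrite lee_fin sqr_ge0.
have := integral_sqintE (sqintB mD h2 (f2 (maxn n N))).
rewrite /F => ->; rewrite lee_fin; apply: Hc; exact: leq_maxr.
Qed.

Theorem riesz_fischer (f : nat -> T -> R) : (forall n, sqint mu D (f n)) ->
  (forall e, 0 < e -> exists N, forall n m, (N <= n)%N -> (N <= m)%N -> sqdist (f n) (f m) <= e) ->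
  exists g, sqint mu D g /\ sqdist (f n) g @[n --> \oo] --> (0 : R).
Proof.
move=> f2 fC.
have /choice[N HN] : forall k : nat, exists N, forall n m, (N <= n)%N -> (N <= m)%N -> sqdist (f n) (f m) <= 4 ^- k.
  by move=> k; apply: fC; rewrite invr_gt0 exprn_gt0.
(* Partial sums give a nondecreasing choice of indices that dominates [N]. *)
pose p k := (\sum_(i < k.+1) N i)%N.
have pN k : (N k <= p k)%N by rewrite /p big_ord_recr leq_addl.
have pS k : (p k <= p k.+1)%N by rewrite [p k.+1]/p big_ord_recr leq_addr.
have pm k n : (k <= n)%N -> (p k <= p n)%N.
  by move=> /subnK <-; elim: (n - k)%N => // i IH; rewrite addSn; exact: leq_trans (pS _).
have [A [mA AD nA cA]] := sqint_summable_cvg (fun k => f2 (p k))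
  (fun k => HN k _ _ (leq_trans (pN k) (pS k)) (pN k)).
(* The indicator makes the sequence converge everywhere, to zero off [A], so that the limit is
   measurable on [D]. *)
pose g x := limn (fun k => f (p k) x * \1_A x).
have cg x : A x -> f (p k) x @[k --> \oo] --> g x.
  move=> Ax; rewrite /g indicE mem_set //; under [X in limn X]eq_fun do rewrite mulr1.
  exact: cA.
have mg : measurable_fun D g.
  apply: (@measurable_fun_cvg _ _ _ D (fun k x => f (p k) x * \1_A x)).
    move=> k; apply: measurable_funM; first exact: (f2 (p k)).1.
    by apply: measurable_funTS; exact: measurable_indic.
  move=> x Dx; have [Ax|nAx] := pselect (A x).
    by rewrite indicE mem_set //; under eq_fun do rewrite mulr1; exact: cg.
  have E : (fun k => f (p k) x * \1_A x) = cst 0.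
    by apply/funext => k; rewrite indicE memNset // mulr0.
  by rewrite /g E lim_cst //; exact: cvg_cst.
have B k n : (N k <= n)%N -> (\int[mu]_(x in D) ((f n x - g x) ^+ 2)%:E <= (4 ^- k)%:E)%E.
  move=> kn; apply: (@sqdist_limit_le (fun k => f (p k)) g (f n) A _ k) => //.
  by move=> i ki; apply: HN => //; apply: leq_trans (pN k) (pm _ _ ki).
have d2 k n : (N k <= n)%N -> sqint mu D (fun x => f n x - g x).
  move=> kn; have mfg : measurable_fun D (fun x => f n x - g x).
    by apply: measurable_funB => //; exact: (f2 n).1.
  split => //; apply/integrableP; split; first by apply/measurable_EFinP; exact: measurable_funX.
  rewrite (eq_integral (fun x => ((f n x - g x) ^+ 2)%:E)); first exact: le_lt_trans (B k n kn) (ltry _).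
  by move=> x _; rewrite /= ger0_norm ?sqr_ge0.
have g2 : sqint mu D g.
  have := sqintB mD (f2 (N 0%N)) (d2 _ _ (leqnn (N 0%N))).
  by apply: (eq_sqint mD) => x _; rewrite opprB addrC subrK.
exists g; split => //; apply/cvgrPdist_le => e e0.
have [k ke] : exists k : nat, 4 ^- k <= e.
  have z1 : `|4^-1 : R| < 1 by rewrite ger0_norm ?invr_ge0 // invf_lt1 // ltr1n.
  have [k _ /(_ k (leqnn k)) /= Hk] := proj1 (cvgr0Pnorm_le _) (cvg_expr z1) e e0.
  by exists k; rewrite -exprVn; exact: le_trans (ler_norm _) Hk.
exists (N k) => // n /= kn; rewrite sub0r normrN ger0_norm ?sqdist_ge0 //; apply: le_trans ke.
by rewrite -lee_fin -(integral_sqintE (d2 k n kn)); exact: B.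
Qed.

Lemma sqdist_cvg_trans (f h : nat -> T -> R) (g : T -> R) :
  (forall n, sqint mu D (f n)) -> (forall n, sqint mu D (h n)) -> sqint mu D g ->
  sqdist (f n) g @[n --> \oo] --> (0 : R) -> sqdist (h n) (f n) @[n --> \oo] --> (0 : R) ->
  sqdist (h n) g @[n --> \oo] --> (0 : R).
Proof.
move=> f2 h2 g2 fg hf.
apply: (squeeze_cvgr (f := cst 0) (h := fun n => 2 * sqdist (h n) (f n) + 2 * sqdist (f n) g)).
- by apply: nearW => n; rewrite sqdist_ge0 /=; exact: sqdist_triangle.
- exact: cvg_cst.
rewrite -[X in _ --> X](_ : 2 * 0 + 2 * 0 = 0 :> R); last by rewrite !mulr0 addr0.
by apply: cvgD; apply: cvgMr.
Qed.

Lemma sqdist_limit_unique (f : nat -> T -> R) (g h : T -> R) :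
  (forall n, sqint mu D (f n)) -> sqint mu D g -> sqint mu D h ->
  sqdist (f n) g @[n --> \oo] --> (0 : R) -> sqdist (f n) h @[n --> \oo] --> (0 : R) ->
  sqdist g h = 0.
Proof.
move=> f2 g2 h2 fg fh; apply/eqP; rewrite eq_le sqdist_ge0 andbT.
have H : sqdist g h <= limn (fun n => 2 * sqdist (f n) g + 2 * sqdist (f n) h).
  apply: limr_ge.
    by apply: is_cvgD; apply: is_cvgMr; apply/cvg_ex; exists 0.
  apply: nearW => n; rewrite (sqdistC (f n) g); exact: sqdist_triangle.
have L : 2 * sqdist (f n) g + 2 * sqdist (f n) h @[n --> \oo] --> (2 * 0 + 2 * 0 : R).
  by apply: cvgD; apply: cvgMr.
by move: H; rewrite (cvg_lim _ L) // mulr0 addr0.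
Qed.

Lemma sqdist0_integral_sq (f g : T -> R) : sqint mu D f -> sqint mu D g -> sqdist f g = 0 ->
  \int[mu]_(x in D) (f x ^+ 2) = \int[mu]_(x in D) (g x ^+ 2).
Proof.
move=> f2 g2 fg0; have d2 := sqintB mD f2 g2.
have fg2 := sqintD mD f2 g2.
have H : \int[mu]_(x in D) ((f x - g x) * (f x + g x)) = 0.
  have := cauchy_schwarz mD d2 fg2; rewrite -/(sqdist f g) fg0 mul0r.
  by move=> h; apply/eqP; rewrite -sqrf_eq0 eq_le h sqr_ge0.
apply/eqP; rewrite -subr_eq0 -(Rintegral_sub mD f2.2 g2.2) -H; apply/eqP.
by apply: eq_Rintegral => x _; ring.
Qed.

End RieszFischer.

(** * Triangles and traces *)

Section TriangleGeometry.
Context {R : realType}.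
Notation pt := (R * R)%type.
Notation mR := (measurableTypeR R).
Notation mpt := (mR * mR)%type.
Notation mu1 := (@lebesgue_measure R).
Notation I01 := (`[0, 1]%classic : set mR).
Implicit Type t : triangle R.
Notation nondeg := Defs.nondegenerate.

Lemma ord3_cases (P : 'I_3 -> Prop) : P 0 -> P 1 -> P 2%:R -> forall i, P i.
Proof.
move=> P0 P1 P2 [[|[|[|i]]] // hi].
- by rewrite (_ : Ordinal hi = 0) //; exact: val_inj.
- by rewrite (_ : Ordinal hi = 1) //; exact: val_inj.
- by rewrite (_ : Ordinal hi = 2%:R) //; exact: val_inj.
Qed.

Lemma ord3_addE : (((1 + 1)%R = 2%:R :> 'I_3) * ((1 + 2%:R)%R = 0 :> 'I_3) *
  ((2%:R + 1)%R = 0 :> 'I_3) * ((2%:R + 2%:R)%R = 1 :> 'I_3) * ((0 + 1)%R = 1 :> 'I_3) *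
  ((0 + 2%:R)%R = 2%:R :> 'I_3))%type.
Proof. by do !split; apply: val_inj. Qed.

Lemma sum_ord3 (V : nmodType) (f : 'I_3 -> V) i : \sum_j f j = f i + f (i + 1) + f (i + 2%:R).
Proof.
have E : \sum_j f j = f 0 + f 1 + f 2%:R.
  rewrite 3!big_ord_recl big_ord0 addr0 addrA.
  by congr (f _ + f _ + f _); exact: val_inj.
elim/ord3_cases: i; rewrite E !ord3_addE //.
  by rewrite -addrA addrC.
by rewrite addrC addrA.
Qed.

Lemma ord3_neq (i : 'I_3) : [/\ i + 1 != i, i + 2%:R != i & i + 1 != i + 2%:R].
Proof. by elim/ord3_cases: i. Qed.

Lemma ord3_split (i j : 'I_3) : [\/ j = i, j = i + 1 | j = i + 2%:R].
Proof.
by elim/ord3_cases: i; elim/ord3_cases: j; rewrite ?ord3_addE;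
  [constructor 1|constructor 2|constructor 3|constructor 3|constructor 1|constructor 2|
   constructor 2|constructor 3|constructor 1].
Qed.

Definition edge1 t i : pt := t (i + 1) - t i.
Definition edge2 t i : pt := t (i + 2%:R) - t i.
Definition tri_det t : R := cross (edge1 t 0) (edge2 t 0).

Lemma tri_det_neq0 t : nondeg t -> tri_det t != 0.
Proof. by rewrite /tri_det /edge1 /edge2 !ord3_addE. Qed.

Lemma tri_detE t i : cross (edge1 t i) (edge2 t i) = tri_det t.
Proof.
rewrite /tri_det /edge1 /edge2 /cross /=.
by elim/ord3_cases: i; rewrite !ord3_addE //=; ring.
Qed.

(** Any vertex may serve as origin, which brings each side in turn to the position opposite the
    origin. *)
Lemma open_triE t i : open_tri t = tri (t i) (edge1 t i) (edge2 t i).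
Proof.
have [n1 n2 n3] := ord3_neq i.
apply/seteqP; split => x.
  move=> [l [l0 l1 ->]]; exists (l (i + 1)), (l (i + 2%:R)); split => //.
    by have := l0 i; rewrite (sum_ord3 _ i) in l1; move: l1; lra.
  rewrite (sum_ord3 _ i) /edge1 /edge2; rewrite (sum_ord3 _ i) in l1.
  have -> : l i = 1 - l (i + 1) - l (i + 2%:R) by lra.
  by rewrite !scalerBl scale1r !scalerBr; case: (t i) (t (i + 1)) (t (i + 2%:R)) => a1 a2 [b1 b2] [c1 c2];
     congr (_, _) => /=; ring.
move=> [s [r [s0 r0 sr ->]]].
exists (fun j => if j == i then 1 - s - r else if j == i + 1 then s else r); split.
- by move=> j; case: ifP => _; [lra|case: ifP].
- by rewrite (sum_ord3 _ i) eqxx (negbTE n1) eqxx (negbTE n2) eq_sym (negbTE n3); ring.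
rewrite (sum_ord3 _ i) eqxx (negbTE n1) eqxx (negbTE n2) [i + 2%:R == _]eq_sym (negbTE n3) /edge1 /edge2.
by rewrite !scalerBl scale1r !scalerBr; case: (t i) (t (i + 1)) (t (i + 2%:R)) => a1 a2 [b1 b2] [c1 c2];
     congr (_, _) => /=; ring.
Qed.

Lemma open_open_tri t : nondeg t -> open (open_tri t).
Proof. by move=> /tri_det_neq0 nt; rewrite (open_triE t 0); exact: open_tri_oab. Qed.

Lemma measurable_open_tri t : nondeg t -> measurable (open_tri t : set mpt).
Proof. by move=> nt; exact: (open_measurable_plane (open_open_tri nt)). Qed.

Lemma open_tri_fin t : nondeg t -> (area (open_tri t) < +oo)%E.
Proof. by move=> /tri_det_neq0 nt; rewrite (open_triE t 0); exact: tri_fin_lt. Qed.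

Lemma sqint_continuous_open_tri t (f : pt -> R) : nondeg t -> continuous f ->
  sqint area (open_tri t) f.
Proof. by move=> /tri_det_neq0 nt cf; rewrite (open_triE t 0); exact: sqint_continuous_tri. Qed.

Lemma side_ptE t i r : side_pt (t, i) r = t i + edge1 t i + r *: (edge2 t i - edge1 t i).
Proof.
rewrite /side_pt /side_src /side_tgt /edge1 /edge2 /=.
by case: (t i) (t (i + 1)) (t (i + 2%:R)) => a1 a2 [b1 b2] [c1 c2]; congr (_, _) => /=; ring. Qed.

Lemma continuous_side_pt (s : side R) (f : pt -> R) : continuous f -> continuous (fun r : R => f (side_pt s r)).
Proof. by move=> cf; exact: (@continuous_on_line _ f (side_src s) (side_tgt s - side_src s)). Qed.

Definition side_avg (s : side R) (f : pt -> R) : R := \int[mu1]_(r in I01) f (side_pt s r).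

Lemma smooth_continuous (w : pt -> R) : smooth w -> continuous w.
Proof. by move=> sw; apply: differentiable_continuous_plane => x; exact: smooth_differentiable. Qed.

Lemma derive_lin_combination (w : pt -> R) (al be : R) (a b x : pt) : differentiable w x ->
  'D_(al *: a + be *: b) w x = al * 'D_a w x + be * 'D_b w x.
Proof.
move=> dw; rewrite (deriveDE a dw) (deriveDE b dw) deriveDE //.
move: ('D_e1 w x) ('D_e2 w x) => p q; rewrite /= -?[_ *: _]/(_ * _); ring. Qed.

Lemma decompose (a b d : pt) : cross a b != 0 ->
  d = (cross d b / cross a b) *: a + (cross a d / cross a b) *: b.
Proof.
by move=> ab; rewrite -[LHS](lin_coords 0 d ab) /lin /= !subr0 add0r.
Qed.

(* Side length times the component along [d] of the outward normal. *)
Definition normal_coef (s : side R) (d : pt) : R :=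
  - Num.sg (tri_det s.1) * cross (side_tgt s - side_src s) d.

(** The direction [d] is decomposed along the two edges at vertex 0; for an edge direction,
    [tri_divergence] involves only the two sides not parallel to it. *)
Theorem green_smooth t (w : pt -> R) (d : pt) : nondeg t -> smooth w ->
  \int[area]_(x in open_tri t) 'D_d w x = \sum_i normal_coef (t, i) d * side_avg (t, i) w.
Proof.
move=> nt sw; set a := edge1 t 0; set b := edge2 t 0.
have ab : cross a b != 0 by exact: tri_det_neq0 nt.
have ba : cross b a != 0 by rewrite (_ : cross b a = - cross a b) ?oppr_eq0 // /cross; ring.
have cw := smooth_continuous sw.
have mT := measurable_open_tri nt.
have I v : area.-integrable (open_tri t) (EFin \o 'D_v w).
  apply: (sqint_integrable mT (open_tri_fin nt)); apply: sqint_continuous_open_tri => //.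
  exact: continuous_smooth_derive.
rewrite (@eq_Rintegral _ _ _ area _ (fun x => cross d b / cross a b * 'D_a w x + cross a d / cross a b * 'D_b w x)); last first.
  by move=> x _; rewrite -derive_lin_combination -?decompose //; exact: smooth_differentiable.
rewrite (Rintegral_comb mT _ _ (I a) (I b)).
have Ea : \int[area]_(x in open_tri t) 'D_a w x = `|cross a b| * (side_avg (t, 0) w - side_avg (t, 1) w).
  rewrite (open_triE t 0) tri_divergence //; congr (_ * _).
  have c0 := continuous_side_pt (s := (t, 0)) cw; have c1 := continuous_side_pt (s := (t, 1)) cw.
  rewrite [side_avg (t, 1) w]/side_avg.
  rewrite -(integral_reverse (f := fun r => w (side_pt (t, 1) r))); last by apply: measurable_funTS; exact: continuous_measurable_line.
  have c1' : continuous (fun r : R => w (side_pt (t, 1) (1 - r))).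
    by move=> r; apply: (@continuous_comp _ _ _ (fun r : R => 1 - r) (fun r : R => w (side_pt (t, 1) r))); [apply: cvgB; [exact: cvg_cst|exact: cvg_id]|exact: c1].
  rewrite -(Rintegral_sub mI01 (integrable_continuous_segment c0) (integrable_continuous_segment c1')).
  apply: eq_Rintegral => r _; rewrite /side_pt /side_src /side_tgt /= !ord3_addE /edge1 /edge2 !ord3_addE.
  congr (w _ - w _); case: (t 0) (t 1) (t 2%:R) => a1 a2 [b1 b2] [g1 g2]; congr (_, _) => /=; rewrite -?[_ *: _]/(_ * _); ring.
have Eb : \int[area]_(x in open_tri t) 'D_b w x = `|cross a b| * (side_avg (t, 0) w - side_avg (t, 2%:R) w).
  have -> : cross a b = - cross b a by rewrite /cross; ring.
  rewrite normrN (open_triE t 0) triC tri_divergence //; congr (_ * _).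
  have c0 := continuous_side_pt (s := (t, 0)) cw; have c1 := continuous_side_pt (s := (t, 2%:R)) cw.
  rewrite [side_avg (t, 0) w]/side_avg.
  rewrite -(integral_reverse (f := fun r => w (side_pt (t, 0) r))); last by apply: measurable_funTS; exact: continuous_measurable_line.
  have c0' : continuous (fun r : R => w (side_pt (t, 0) (1 - r))).
    by move=> r; apply: (@continuous_comp _ _ _ (fun r : R => 1 - r) (fun r : R => w (side_pt (t, 0) r))); [apply: cvgB; [exact: cvg_cst|exact: cvg_id]|exact: c0].
  rewrite -(Rintegral_sub mI01 (integrable_continuous_segment c0') (integrable_continuous_segment c1)).
  apply: eq_Rintegral => r _; rewrite /side_pt /side_src /side_tgt /= !ord3_addE /edge1 /edge2 !ord3_addE.
  congr (w _ - w _); case: (t 0) (t 1) (t 2%:R) => a1 a2 [b1 b2] [g1 g2]; congr (_, _) => /=; rewrite -?[_ *: _]/(_ * _); ring.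
rewrite Ea Eb (sum_ord3 _ 0) !ord3_addE /normal_coef /= -/(tri_det t).
have -> : tri_det t = cross a b by [].
rewrite {1 2}[`|_|]normrEsg.
have h (z : R) : z / cross a b * (Num.sg (cross a b) * cross a b) = Num.sg (cross a b) * z by field.
rewrite !mulrA -[cross d b / _ * _ * _]mulrA -[cross a d / _ * _ * _]mulrA !h.
rewrite /side_src /side_tgt /= !ord3_addE /a /b /edge1 /edge2 !ord3_addE.
move: (side_avg _ _) (side_avg _ _) (side_avg _ _) (Num.sg _) => p q r sg.
by rewrite /cross /=; ring.
Qed.

End TriangleGeometry.

(** * Traces and Green's formula for H^1 functions on a triangle *)

Section Traces.
Context {R : realType}.
Notation pt := (R * R)%type.
Notation mR := (measurableTypeR R).
Notation mpt := (mR * mR)%type.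
Notation mu1 := (@lebesgue_measure R).
Notation I01 := (`[0, 1]%classic : set mR).
Implicit Type t : triangle R.
Notation nondeg := Defs.nondegenerate.

Lemma L2sq_derive_le (A : set mpt) (w : pt -> R) (v : pt) : measurable A -> smooth w ->
  sqint area A ('D_e1 w) -> sqint area A ('D_e2 w) ->
  L2sq A ('D_v w) <= 2 * (v.1 ^+ 2 + v.2 ^+ 2) * (L2sq A ('D_e1 w) + L2sq A ('D_e2 w)).
Proof.
move=> mA sw s1 s2.
have H := sq_integralD_le mA (sqintZ mA v.1 s1) (sqintZ mA v.2 s2).
have E : L2sq A ('D_v w) = \int[area]_(x in A) ((v.1 * 'D_e1 w x + v.2 * 'D_e2 w x) ^+ 2).
  by apply: eq_Rintegral => x _; rewrite deriveDE //; exact: smooth_differentiable.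
have Ez (c : R) (f : pt -> R) : sqint area A f -> \int[area]_(x in A) ((c * f x) ^+ 2) = c ^+ 2 * L2sq A f.
  by move=> [_ f2]; rewrite -(Rintegral_scale mA _ f2); apply: eq_Rintegral => x _; rewrite exprMn.
rewrite E; apply: le_trans H _; rewrite !Ez //.
have := sqnorm_ge0 A ('D_e1 w); have := sqnorm_ge0 A ('D_e2 w); rewrite -!/(L2sq A _).
have := sqr_ge0 v.1; have := sqr_ge0 v.2.
move: (L2sq A ('D_e1 w)) (L2sq A ('D_e2 w)) (v.1 ^+ 2) (v.2 ^+ 2) => p q c1 c2 c20 c10 q0 p0.
have h1 := mulr_ge0 c10 q0; have h2 := mulr_ge0 c20 p0; have h3 := mulr_ge0 c10 p0; have h4 := mulr_ge0 c20 q0.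
lra.
Qed.

(** The constant may depend on the triangle: it serves to construct traces and does not enter the
    final estimate. *)
Lemma trace_inequality t i : nondeg t -> exists C, 0 <= C /\ forall w : pt -> R, smooth w ->
  \int[mu1]_(r in I01) (w (side_pt (t, i) r) ^+ 2) <=
  C * (L2sq (open_tri t) w + L2sq (open_tri t) ('D_e1 w) + L2sq (open_tri t) ('D_e2 w)).
Proof.
move=> nt; have d0 := tri_det_neq0 nt; rewrite -(tri_detE t i) in d0.
set a := edge1 t i in d0 *; set b := edge2 t i in d0 *.
pose k (v : pt) : R := 2 * (v.1 ^+ 2 + v.2 ^+ 2).
have k0 v : 0 <= k v by rewrite mulr_ge0 // addr_ge0 ?sqr_ge0.
exists ((4 + k a + k b) / `|cross a b|); split; first by rewrite divr_ge0 // !addr_ge0.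
move=> w sw; have D0 : 0 < `|cross a b| by rewrite normr_gt0.
rewrite -(ler_pM2l D0) [leRHS]mulrA [`|_| * (_ / _)]mulrC divfK ?gt_eqF //.
have := side_trace_inequality (t i) d0 sw.
have -> : \int[mu1]_(r in I01) (w (side_pt (t, i) r) ^+ 2) = \int[mu1]_(r in I01) (w (t i + a + r *: (b - a)) ^+ 2).
  by apply: eq_Rintegral => r _; rewrite side_ptE.
move/le_trans; apply; rewrite -(open_triE t i).
have mT := measurable_open_tri nt.
have S v : sqint area (open_tri t) ('D_v w).
  by apply: sqint_continuous_open_tri => //; exact: continuous_smooth_derive.
have aux (p q r s z ka kb : R) : 0 <= p -> 0 <= q -> 0 <= r -> 0 <= ka -> 0 <= kb ->
    s <= ka * (q + r) -> z <= kb * (q + r) -> 4 * p + s + z <= (4 + ka + kb) * (p + q + r).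
  move=> p0 q0 r0 ka0 kb0 hs hz; have h1 := mulr_ge0 ka0 p0; have h2 := mulr_ge0 kb0 p0; lra.
apply: aux; [exact: sqnorm_ge0|exact: sqnorm_ge0|exact: sqnorm_ge0|exact: k0|exact: k0| |];
  exact: L2sq_derive_le.
Qed.

Lemma open_tri_convex t (x z : pt) (e : R) : 0 < e < 1 -> open_tri t x -> open_tri t z ->
  open_tri t ((1 - e) *: x + e *: z).
Proof.
move=> /andP[e0 e1'] [l [l0 l1 ->]] [k [k0 k1 ->]].
exists (fun i => (1 - e) * l i + e * k i); split.
- by move=> i; rewrite addr_gt0 // mulr_gt0 // subr_gt0.
- by rewrite big_split /= -!mulr_sumr l1 k1; ring.
rewrite !scaler_sumr -big_split /=; apply: eq_bigr => i _.
by rewrite [RHS]scalerDl !scalerA.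
Qed.

Lemma open_tri_center t : open_tri t (\sum_i 3^-1 *: t i).
Proof.
exists (fun=> 3^-1); split => //.
by rewrite (sum_ord3 _ 0); field.
Qed.

Lemma open_inner_ball (U : set pt) (x : pt) : open U -> U x ->
  exists r : R, 0 < r /\ forall z : pt, `|z - x| <= r -> U z.
Proof.
move=> oU Ux; have /nbhs_ballP[e /= e0 eU] := open_nbhs_nbhs (conj oU Ux).
exists (e / 2); split; first by rewrite divr_gt0.
move=> z zx; apply: eU; rewrite -ball_normE /ball_ /= distrC; apply: le_lt_trans zx _.
by rewrite ltr_pdivrMr // ltr_pMr // ltr1n.
Qed.

Lemma gradP (A : set pt) (u : pt -> R) : H1 A u -> weak_grad A u (grad A u).
Proof. by move=> [_ [G HG]]; apply: (xgetPex _ (P := [set G | weak_grad A u G])); exists G. Qed.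

Lemma smoothB (f g : pt -> R) : smooth f -> smooth g -> smooth (fun x => f x - g x).
Proof.
move=> sf sg; have := smoothD sf (smoothM (smooth_cst (-1)) sg).
by rewrite (_ : (fun x => _) = (fun x => f x - g x)) //; apply/funext => x; rewrite mulN1r.
Qed.

Lemma deriveB_plane (f g : pt -> R) v x : smooth f -> smooth g ->
  'D_v (fun y => f y - g y) x = 'D_v f x - 'D_v g x.
Proof.
move=> sf sg; rewrite -[in LHS]/('D_v (f - g) x) deriveB //; apply: diff_derivable; exact: smooth_differentiable.
Qed.

(** The part of [is_trace] that does not mention the side, so that one sequence serves all three
    sides. *)
Definition H1_approx t (u : pt -> R) (v : nat -> pt -> R) :=
  [/\ forall n, smooth (v n),
   sqdist area (open_tri t) (v n) u @[n --> \oo] --> (0 : R),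
   sqdist area (open_tri t) ('D_e1 (v n)) (grad (open_tri t) u).1 @[n --> \oo] --> (0 : R) &
   sqdist area (open_tri t) ('D_e2 (v n)) (grad (open_tri t) u).2 @[n --> \oo] --> (0 : R)].

(** Contracted mollifications are smooth on the whole plane. Their derivative is [(1 - meps n)]
    times the mollified gradient; the excess, [meps n] times a bounded family in L^2, vanishes in
    the limit. *)
Lemma H1_approx_exists t u : nondeg t -> H1 (open_tri t) u -> exists v, H1_approx t u v.
Proof.
move=> nt hu; have [u2 _] := hu.
have [g1 g2 w1 w2] := gradP hu.
have mT := measurable_open_tri nt; have fT := open_tri_fin nt.
have [r [r0 rT]] := open_inner_ball (open_open_tri nt) (open_tri_center t).
have convT := @open_tri_convex t.
have ui := sqint_integrable mT fT u2.
exists (fun n => moll (open_tri t) (\sum_i 3^-1 *: t i) r n u).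
have H (e : pt) (g : pt -> R) : L2 (open_tri t) g -> weak_deriv (open_tri t) e u g ->
    sqdist area (open_tri t) ('D_e (moll (open_tri t) (\sum_i 3^-1 *: t i) r n u)) g @[n --> \oo] --> (0 : R).
  move=> s2 wd.
  have mg n := sqint_moll mT fT r0 convT rT n s2.
  have c := moll_cvg_sqint mT fT r0 convT rT s2.
  pose m n := moll (open_tri t) (\sum_i 3^-1 *: t i) r n g.
  pose K := L2sq (open_tri t) g.
  have B n : 0 <= sqdist area (open_tri t) ('D_e (moll (open_tri t) (\sum_i 3^-1 *: t i) r n u)) g <=
     2 * sqdist area (open_tri t) (m n) g + 2 * (meps n ^+ 2 * (4 * K)).
    rewrite sqdist_ge0 /=.
    have h := sq_integralD_le mT (sqintB mT (mg n) s2) (sqintZ mT (- meps n) (mg n)).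
    have E : \int[area]_(x in open_tri t) ((- meps n * m n x) ^+ 2) = meps n ^+ 2 * L2sq (open_tri t) (m n).
      by rewrite -(Rintegral_scale mT _ (mg n).2); apply: eq_Rintegral => x _; rewrite exprMn sqrrN.
    have -> : sqdist area (open_tri t) ('D_e (moll (open_tri t) (\sum_i 3^-1 *: t i) r n u)) g =
        \int[area]_(x in open_tri t) (((m n x - g x) + (- meps n * m n x)) ^+ 2).
      apply: eq_Rintegral => x /set_mem xT.
      by rewrite (moll_weak_derive mT r0 convT rT n ui wd xT); congr (_ ^+ 2); rewrite /m; ring.
    apply: le_trans h _; rewrite E lerD2l ler_pM2l // ler_wpM2l ?sqr_ge0 //.
    apply: le_trans (sqnorm_moll_le mT fT r0 convT rT n s2) _.
    apply: ler_wpM2r; first exact: sqnorm_ge0.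
    rewrite -[leRHS]invrK lef_pV2 ?posrE ?exprn_gt0 ?mscale_gt0 //.
    have := @meps_le R n; nra.
  apply: (squeeze0 B).
  rewrite -[X in _ --> X](_ : 2 * 0 + 2 * (0 * 0 * (4 * K)) = 0 :> R); last by ring.
  apply: cvgD; apply: cvgMr; first exact: c.
  by apply: cvgMl; under eq_fun do rewrite expr2; apply: cvgM; exact: meps_cvg0.
split.
- by move=> n; exact: moll_smooth.
- have c0 := moll_cvg_sqint mT fT r0 convT rT u2; exact: c0.
- exact: H.
- exact: H.
Qed.

Lemma smooth_sqint t (w : pt -> R) : nondeg t -> smooth w -> sqint area (open_tri t) w.
Proof. by move=> nt sw; apply: sqint_continuous_open_tri => //; exact: smooth_continuous. Qed.

Lemma smooth_sqint_side s (w : pt -> R) : smooth w -> sqint mu1 I01 (fun r => w (side_pt s r)).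
Proof. by move=> sw; apply: sqint_continuous_segment; apply: continuous_side_pt; exact: smooth_continuous. Qed.

Lemma trace_inequality_sub t i : nondeg t -> exists C, 0 <= C /\ forall v w : pt -> R, smooth v -> smooth w ->
  sqdist mu1 I01 (fun r => v (side_pt (t, i) r)) (fun r => w (side_pt (t, i) r)) <=
  C * (sqdist area (open_tri t) v w + sqdist area (open_tri t) ('D_e1 v) ('D_e1 w) +
       sqdist area (open_tri t) ('D_e2 v) ('D_e2 w)).
Proof.
move=> nt; have [C [C0 HC]] := trace_inequality i nt; exists C; split => // v w sv sw.
have := HC _ (smoothB sv sw); rewrite /L2sq.
have E e : \int[area]_(x in open_tri t) ('D_e (fun x => v x - w x) x ^+ 2) = sqdist area (open_tri t) ('D_e v) ('D_e w).
  by apply: eq_Rintegral => x _; rewrite deriveB_plane.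
by rewrite !E.
Qed.

Lemma side_len_gt0 t i : nondeg t -> 0 < side_len (t, i).
Proof.
move=> nt; rewrite /side_len /edist sqrtr_gt0 lt_neqAle addr_ge0 ?sqr_ge0 // andbT.
have := tri_det_neq0 nt; rewrite -(tri_detE t i); apply: contraNneq => /esym/eqP; rewrite paddr_eq0 ?sqr_ge0 // !sqrf_eq0 !subr_eq0 /=.
rewrite /cross /edge1 /edge2 /side_src /side_tgt /= => /andP[/eqP -> /eqP ->].
by apply/eqP; ring.
Qed.

Lemma sqdist_cauchy_le d (T : measurableType d) (mu : {measure set T -> \bar R}) (A : set T)
    (f : nat -> T -> R) (g : T -> R) : measurable A -> (forall n, sqint mu A (f n)) -> sqint mu A g ->
  sqdist mu A (f n) g @[n --> \oo] --> (0 : R) ->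
  forall e, 0 < e -> exists N, forall n m, (N <= n)%N -> (N <= m)%N -> sqdist mu A (f n) (f m) <= e.
Proof.
move=> mA f2 g2 cf e e0; have e4 : 0 < e / 4 by rewrite divr_gt0.
have [N _ HN] := proj1 (cvgr0Pnorm_le _) cf _ e4.
exists N => n m Nn Nm; apply: le_trans (sqdist_triangle mA (f2 n) g2 (f2 m)) _.
rewrite (sqdistC mu A g).
have := HN n Nn; have := HN m Nm; rewrite /= !ger0_norm ?sqdist_ge0 //.
move: (sqdist _ _ _ _) (sqdist _ _ _ _) => p q; lra.
Qed.

(** By the trace inequality the restrictions to the side of a smooth approximation form a Cauchy
    sequence, and L^2 of the parameter interval is complete. *)
Lemma trace_exists t i u : nondeg t -> H1 (open_tri t) u -> exists g, is_trace (t, i) u g.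
Proof.
move=> nt hu; have [v [sv c0 c1 c2]] := H1_approx_exists nt hu.
have [u2 _] := hu; have [g1 g2 _ _] := gradP hu.
have mT := measurable_open_tri nt.
have [C [C0 HC]] := trace_inequality_sub i nt.
have [G [G2 cG]] : exists g, sqint mu1 I01 g /\ sqdist mu1 I01 (fun r => v n (side_pt (t, i) r)) g @[n --> \oo] --> (0 : R).
  apply: (riesz_fischer mI01 I01_fin (f := fun n r => v n (side_pt (t, i) r))).
    by move=> n; exact: smooth_sqint_side.
  (* Three distances, each at most [d], are multiplied by [C]; adding one avoids a division by
     zero. *)
  move=> e e0; pose d := e / (3 * (C + 1)).
  have d0 : 0 < d by rewrite divr_gt0 // mulr_gt0 // ltr_wpDl.
  have [N0 H0] := sqdist_cauchy_le mT (fun n => smooth_sqint nt (sv n)) u2 c0 d0.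
  have [N1 H1] := sqdist_cauchy_le mT (fun n => smooth_sqint nt (smooth_derive _ (sv n))) g1 c1 d0.
  have [N2 H2] := sqdist_cauchy_le mT (fun n => smooth_sqint nt (smooth_derive _ (sv n))) g2 c2 d0.
  exists (maxn N0 (maxn N1 N2)) => n m; rewrite !geq_max => /and3P[n0 n1 n2] /and3P[m0 m1 m2].
  apply: le_trans (HC _ _ (sv n) (sv m)) _.
  have := H0 n m n0 m0; have := H1 n m n1 m1; have := H2 n m n2 m2.
  have E : e = d * (3 * (C + 1)) by rewrite /d divfK // gt_eqF // mulr_gt0 // ltr_wpDl.
  move: (sqdist _ _ _ _) (sqdist _ _ _ _) (sqdist _ _ _ _) => p q s; rewrite E.
  move: d d0 {E H0 H1 H2} => d d0; nra.
have len0 := side_len_gt0 i nt.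
pose q : pt := side_tgt (t, i) - side_src (t, i).
have q0 : q.1 ^+ 2 + q.2 ^+ 2 != 0.
  move: len0; rewrite /side_len /edist sqrtr_gt0 => /gt_eqF/negbT.
  by rewrite /q /= -[(_ - (side_tgt _).1)]opprB -[(_ - (side_tgt _).2)]opprB !sqrrN.
(* The limit lives on the parameter interval; orthogonal projection onto the line of the side makes
   it a function on the plane with the prescribed values on the side. *)
pose g (x : pt) : R := G (((x.1 - (side_src (t, i)).1) * q.1 + (x.2 - (side_src (t, i)).2) * q.2) / (q.1 ^+ 2 + q.2 ^+ 2)).
have gE r : g (side_pt (t, i) r) = G r.
  congr G; move: q0; rewrite /q /side_pt /= -?[_ *: _]/(_ * _).
  move: (side_src _).1 (side_src _).2 (side_tgt _).1 (side_tgt _).2 => s1 s2 q1 q2 qq; by field.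
exists g; split.
- by rewrite (_ : g \o side_pt (t, i) = G); [exact: G2.1|apply/funext].
- by rewrite (_ : (fun r => _) = (fun r => (G r ^+ 2)%:E)); [exact: G2.2|apply/funext => r; rewrite gE].
exists v; split => //.
rewrite -[X in _ --> X](mulr0 (side_len (t, i))); apply: cvgMr.
apply: cvg_trans cG; apply: near_eq_cvg; apply: nearW => n.
by apply: eq_Rintegral => r _; rewrite gE.
Qed.

Lemma traceP t i u : nondeg t -> H1 (open_tri t) u -> is_trace (t, i) u (trace (t, i) u).
Proof.
move=> nt hu; have [g Hg] := trace_exists i nt hu.
by apply: (xgetPex _ (P := [set g | is_trace (t, i) u g])); exists g.
Qed.

Definition side_trace (s : side R) (u : pt -> R) (r : R) : R := trace s u (side_pt s r).

Lemma sqint_side_trace t i u : nondeg t -> H1 (open_tri t) u -> sqint mu1 I01 (side_trace (t, i) u).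
Proof. by move=> nt hu; have [m1 i1 _] := traceP i nt hu. Qed.

(** The selected trace comes with an approximating sequence of its own. The trace inequality,
    applied to the difference of the two sequences, shows that every approximation of [u] has the
    same limit on the side. *)
Lemma side_trace_cvg t i u v : nondeg t -> H1 (open_tri t) u -> H1_approx t u v ->
  sqdist mu1 I01 (fun r => v n (side_pt (t, i) r)) (side_trace (t, i) u) @[n --> \oo] --> (0 : R).
Proof.
move=> nt hu [sv c0 c1 c2]; have [_ _ [w [sw d0 d1 d2 d3]]] := traceP i nt hu.
have [u2 _] := hu; have [g1 g2 _ _] := gradP hu.
have mT := measurable_open_tri nt.
have len0 := side_len_gt0 i nt.
apply: (sqdist_cvg_trans mI01 (fun n => smooth_sqint_side (t, i) (sw n)) (fun n => smooth_sqint_side (t, i) (sv n))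
  (sqint_side_trace i nt hu)).
  have L : (side_len (t, i))^-1 * side_int (t, i) (fun x => (w n x - trace (t, i) u x) ^+ 2) @[n --> \oo]
    --> ((side_len (t, i))^-1 * 0 : R) by apply: cvgMr.
  move: L; rewrite mulr0; apply: cvg_trans.
  apply: near_eq_cvg; apply: nearW => n; rewrite /side_int mulrA mulVf ?mul1r ?gt_eqF //.
have [C [C0 HC]] := trace_inequality_sub i nt.
have K (f h : nat -> pt -> R) (g : pt -> R) : (forall n, smooth (f n)) -> (forall n, smooth (h n)) ->
   L2 (open_tri t) g -> sqdist area (open_tri t) (f n) g @[n --> \oo] --> (0 : R) ->
   sqdist area (open_tri t) (h n) g @[n --> \oo] --> (0 : R) ->
   sqdist area (open_tri t) (f n) (h n) @[n --> \oo] --> (0 : R).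
  move=> sf sh gg cf ch; apply: (@squeeze0 _ _ (fun n => 2 * sqdist area (open_tri t) (f n) g + 2 * sqdist area (open_tri t) (h n) g)).
    move=> n; rewrite sqdist_ge0 /= (sqdistC area (open_tri t) (h n) g).
    by apply: sqdist_triangle => //; exact: smooth_sqint.
  rewrite -[X in _ --> X](_ : 2 * 0 + 2 * 0 = 0 :> R); last by rewrite !mulr0 addr0.
  by apply: cvgD; apply: cvgMr.
apply: (@squeeze0 _ _ (fun n => C * (sqdist area (open_tri t) (v n) (w n) + sqdist area (open_tri t) ('D_e1 (v n)) ('D_e1 (w n)) +
       sqdist area (open_tri t) ('D_e2 (v n)) ('D_e2 (w n))))).
  by move=> n; rewrite sqdist_ge0 /=; exact: HC.
rewrite -[X in _ --> X](_ : C * (0 + 0 + 0) = 0 :> R); last by rewrite !addr0 mulr0.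
apply: cvgMr; apply: cvgD; first apply: cvgD.
- exact: K u2 c0 d0.
- by apply: K g1 c1 d1 => n; exact: smooth_derive.
- by apply: K g2 c2 d2 => n; exact: smooth_derive.
Qed.

(** The smooth formula for [v n * phi], in the limit: every term is an L^2 pairing, on the triangle
    or on a side, of a convergent sequence with a fixed function. *)
Theorem green_H1 t u (phi : pt -> R) (d : pt) : nondeg t -> H1 (open_tri t) u -> smooth phi ->
  \int[area]_(x in open_tri t) (u x * 'D_d phi x) =
  - (\int[area]_(x in open_tri t) ((d.1 * (grad (open_tri t) u).1 x + d.2 * (grad (open_tri t) u).2 x) * phi x))
  + \sum_i normal_coef (t, i) d * \int[mu1]_(r in I01) (side_trace (t, i) u r * phi (side_pt (t, i) r)).
Proof.
move=> nt hu sp; have [v va] := H1_approx_exists nt hu; have [sv c0 c1 c2] := va.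
have [u2 _] := hu; have [g1 g2 _ _] := gradP hu.
have mT := measurable_open_tri nt.
have p2 := smooth_sqint nt sp; have dp2 := smooth_sqint nt (smooth_derive d sp).
have v2 n := smooth_sqint nt (sv n).
have dv2 e n := smooth_sqint nt (smooth_derive e (sv n)).
have L0 := cvg_integral_mul mT v2 u2 dp2 c0.
have L1 := cvg_integral_mul mT (dv2 e1) g1 p2 c1.
have L2 := cvg_integral_mul mT (dv2 e2) g2 p2 c2.
have Ls i := cvg_integral_mul mI01 (fun n => smooth_sqint_side (t, i) (sv n)) (sqint_side_trace i nt hu)
  (smooth_sqint_side (t, i) sp) (side_trace_cvg i nt hu va).
have E n : \int[area]_(x in open_tri t) (v n x * 'D_d phi x) =
  - (d.1 * \int[area]_(x in open_tri t) ('D_e1 (v n) x * phi x) + d.2 * \int[area]_(x in open_tri t) ('D_e2 (v n) x * phi x))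
  + \sum_i normal_coef (t, i) d * \int[mu1]_(r in I01) (v n (side_pt (t, i) r) * phi (side_pt (t, i) r)).
  have := green_smooth d nt (smoothM (sv n) sp); rewrite /side_avg => <-.
  have i0 := sqint_mul mT (v2 n) dp2.
  have i1 := sqint_mul mT (dv2 e1 n) p2; have i2 := sqint_mul mT (dv2 e2 n) p2.
  rewrite -(Rintegral_comb mT _ _ i1 i2).
  have i3 := integrable_sum_R mT (integrable_scale_R mT d.1 i1) (integrable_scale_R mT d.2 i2).
  have -> : \int[area]_(x in open_tri t) 'D_d (fun x => v n x * phi x) x =
     \int[area]_(x in open_tri t) (v n x * 'D_d phi x + (d.1 * ('D_e1 (v n) x * phi x) + d.2 * ('D_e2 (v n) x * phi x))).
    apply: eq_Rintegral => x _; rewrite deriveM_plane; try exact: smooth_differentiable.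
    rewrite (deriveDE d (smooth_differentiable x (sv n))).
    by move: ('D_e1 (v n) x) ('D_e2 (v n) x) ('D_d phi x) => p q s; ring.
  by rewrite (Rintegral_add mT i0 i3) addrC addrK.
have j1 := sqint_mul mT g1 p2; have j2 := sqint_mul mT g2 p2.
have -> : \int[area]_(x in open_tri t) ((d.1 * (grad (open_tri t) u).1 x + d.2 * (grad (open_tri t) u).2 x) * phi x) =
  d.1 * \int[area]_(x in open_tri t) ((grad (open_tri t) u).1 x * phi x) + d.2 * \int[area]_(x in open_tri t) ((grad (open_tri t) u).2 x * phi x).
  rewrite -(Rintegral_comb mT _ _ j1 j2); apply: eq_Rintegral => x _.
  by rewrite mulrDl !mulrA.
apply: (cvg_unique _ L0) => //=; under eq_fun do rewrite E.
apply: cvgD; first by apply: cvgN; apply: cvgD; apply: cvgMr.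
under eq_fun do rewrite (sum_ord3 _ 0); rewrite (sum_ord3 _ 0).
by apply: cvgD; [apply: cvgD|]; apply: cvgMr.
Qed.

End Traces.

(** * Triangulations *)

Section Barycentric.
Context {R : realType}.
Notation pt := (R * R)%type.
Notation mR := (measurableTypeR R).
Notation mpt := (mR * mR)%type.
Implicit Type t : triangle R.
Notation nondeg := Defs.nondegenerate.

Lemma ord3_shift (i : 'I_3) :
  [/\ i + 1 + 1 = i + 2%:R, i + 1 + 2%:R = i, i + 2%:R + 1 = i & i + 2%:R + 2%:R = i + 1].
Proof. by elim/ord3_cases: i; split; exact: val_inj. Qed.

(** Barycentric coordinate as a ratio of signed areas: the triangle over the side opposite vertex
    [i] with apex [x], relative to [t]. *)
Definition bary t i (x : pt) : R := cross (edge1 t (i + 1)) (x - t (i + 1)) / tri_det t.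

Lemma bary_vertices t : nondeg t -> forall i,
  [/\ bary t i (t i) = 1, bary t i (t (i + 1)) = 0 & bary t i (t (i + 2%:R)) = 0].
Proof.
move=> /tri_det_neq0 d0 i; rewrite /bary.
have [E E' _ _] := ord3_shift i.
split.
- have := tri_detE t (i + 1); rewrite /edge2 E' => ->; exact: divff.
- by rewrite subrr /cross /= !mulr0 subrr mul0r.
- by rewrite /edge1 E /cross [X in X - _]mulrC subrr mul0r.
Qed.

Lemma bary_affine t i (l : 'I_3 -> R) (x : 'I_3 -> pt) : \sum_j l j = 1 ->
  bary t i (\sum_j l j *: x j) = \sum_j l j * bary t i (x j).
Proof.
rewrite !(sum_ord3 _ 0) !ord3_addE => E; have -> : l 0 = 1 - l 1 - l 2%:R by lra.
rewrite /bary !mulrA -!mulrDl; congr (_ / _); rewrite /cross /= -?[_ *: _]/(_ * _); ring.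
Qed.

Lemma bary_combination t (l : 'I_3 -> R) i : nondeg t -> \sum_j l j = 1 ->
  bary t i (\sum_j l j *: t j) = l i.
Proof.
move=> nt l1; rewrite bary_affine // (sum_ord3 _ i).
by have [-> -> ->] := bary_vertices nt i; rewrite mulr1 !mulr0 !addr0.
Qed.

Lemma bary_segment t i (e : R) (x z : pt) :
  bary t i ((1 - e) *: x + e *: z) = (1 - e) * bary t i x + e * bary t i z.
Proof.
rewrite /bary !mulrA -!mulrDl; congr (_ / _); rewrite /cross /= -?[_ *: _]/(_ * _); ring.
Qed.

Lemma sum_bary t (x : pt) : nondeg t -> \sum_i bary t i x = 1.
Proof.
move=> /tri_det_neq0 d0; rewrite (sum_ord3 _ 0) /bary -!mulrDl.
apply: (@mulIf _ (tri_det t)) => //; rewrite divfK // mul1r.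
by rewrite /tri_det /cross /edge1 /edge2 !ord3_addE /=; ring.
Qed.

Lemma bary_decomp t (x : pt) : nondeg t -> \sum_i bary t i x *: t i = x.
Proof.
move=> nt; have d0 := tri_det_neq0 nt.
have E : tri_det t *: (\sum_i bary t i x *: t i) = tri_det t *: x.
  rewrite (sum_ord3 _ 0) !scalerDr !scalerA /bary ![tri_det t * _]mulrC !divfK //.
  rewrite /tri_det /cross /edge1 /edge2 !ord3_addE.
  case: x (t 0) (t 1) (t 2%:R) => x1 x2 [a1 a2] [b1 b2] [c1 c2].
  by congr (_, _) => /=; rewrite -?[_ *: _]/(_ * _); ring.
exact: (scalerI d0).
Qed.

Lemma open_triP t x : nondeg t -> open_tri t x <-> forall i, 0 < bary t i x.
Proof.
move=> nt; split => [[l [l0 l1 ->]] i|H]; first by rewrite bary_combination.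
by exists (fun i => bary t i x); rewrite sum_bary // bary_decomp.
Qed.

Lemma closed_triP t x : nondeg t -> closed_tri t x <-> forall i, 0 <= bary t i x.
Proof.
move=> nt; split => [[l [l0 l1 ->]] i|H]; first by rewrite bary_combination.
by exists (fun i => bary t i x); rewrite sum_bary // bary_decomp.
Qed.

Lemma open_closed_tri t : open_tri t `<=` closed_tri t.
Proof. by move=> x [l [l0 l1 ->]]; exists l; split => // i; exact: ltW. Qed.

Lemma continuous_bary t i : continuous (bary t i : pt -> R).
Proof.
set a := edge1 t (i + 1).
have -> : bary t i = (fun x : pt => lform (- a.2 / tri_det t) (a.1 / tri_det t) x +
    (- (a.1 * (t (i + 1)).2 - a.2 * (t (i + 1)).1) / tri_det t)).
  by apply/funext => x; rewrite /lform /bary -/a /cross /=; ring.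
by move=> x; apply: cvgD; [exact: continuous_lform|exact: cvg_cst].
Qed.

Lemma side_src_neq t i : nondeg t -> side_src (t, i) != side_tgt (t, i).
Proof.
move=> nt; apply: contraNneq (tri_det_neq0 nt); rewrite -(tri_detE t i) /edge1 /edge2 /side_src /side_tgt /= => ->.
by apply/eqP; rewrite /cross; ring.
Qed.

Lemma area_bary0 t i : nondeg t -> area [set x : mpt | bary t i x = 0] = 0%E.
Proof.
move=> nt; have d0 := tri_det_neq0 nt; set a := edge1 t (i + 1).
have -> : [set x : mpt | bary t i x = 0] = [set x : mpt | - a.2 * x.1 + a.1 * x.2 = a.1 * (t (i + 1)).2 - a.2 * (t (i + 1)).1].
  apply/seteqP; split => x /=; rewrite /bary -/a.
    by move/(congr1 (fun z => z * tri_det t)); rewrite mul0r divfK // /cross /=; lra.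
  by move=> E; apply: (@mulIf _ (tri_det t)) => //; rewrite mul0r divfK // /cross /=; lra.
apply: area_line0; have := side_src_neq i nt; apply: contra_neq => -[/eqP]; rewrite oppr_eq0 => /eqP a2 a1.
have [E _ _ _] := ord3_shift i.
apply/esym/eqP; rewrite -subr_eq0 /side_src /side_tgt /= -E -/(edge1 t (i + 1)) -/a.
have a1' : a.1 = 0 := a1; have a2' : a.2 = 0 := a2.
by rewrite [a]surjective_pairing a1' a2'.
Qed.

Lemma side_pt_combination (s : side R) r : side_pt s r = (1 - r) *: side_src s + r *: side_tgt s.
Proof.
rewrite /side_pt; case: (side_src s) (side_tgt s) => a1 a2 [b1 b2].
by congr (_, _) => /=; rewrite -?[_ *: _]/(_ * _); ring.
Qed.

Lemma bary_side_pt t i r : nondeg t ->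
  [/\ bary t i (side_pt (t, i) r) = 0, bary t (i + 1) (side_pt (t, i) r) = 1 - r &
      bary t (i + 2%:R) (side_pt (t, i) r) = r].
Proof.
move=> nt; have v := bary_vertices nt.
have [E1 _ _ E2] := ord3_shift i.
rewrite side_pt_combination !bary_segment /side_src /side_tgt /=.
have [_ -> ->] := v i; have [-> + _] := v (i + 1); rewrite E1 => ->.
have [-> _] := v (i + 2%:R); rewrite E2 => ->.
by split; ring.
Qed.

Lemma side_pt_notin t i r : nondeg t -> ~ open_tri t (side_pt (t, i) r).
Proof. by move=> nt /(open_triP _ nt)/(_ i); have [-> _ _] := bary_side_pt i r nt; rewrite ltxx. Qed.

Lemma conforming_disjoint t t' : nondeg t -> nondeg t' -> conforming t t' ->
  open_tri t `&` open_tri t' = set0.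
Proof.
move=> nt nt' C; rewrite -subset0 => x [xt xt'].
have xI : (closed_tri t `&` closed_tri t') x by split; exact: open_closed_tri.
case: C => [C|[i [j [_ C]]]|[i [j [_ C]]]]; rewrite C in xI.
- by [].
- move/(open_triP _ nt): xt => /(_ (i + 2%:R)); rewrite xI.
  have [_ + _] := bary_vertices nt (i + 2%:R).
  have [_ _ -> _] := ord3_shift i.
  by move=> ->; rewrite ltxx.
- by case: xI => r _ rx; apply: (side_pt_notin (i := i) (r := r) nt); rewrite rx.
Qed.

Lemma tri_det_side t i : tri_det t = cross (side_tgt (t, i) - side_src (t, i)) (t i - side_src (t, i)).
Proof.
rewrite -(tri_detE t i) /edge1 /edge2 /side_src /side_tgt /cross /=; ring.
Qed.

Lemma bary_side t i x : bary t i x = cross (side_tgt (t, i) - side_src (t, i)) (x - side_src (t, i)) / tri_det t.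
Proof.
have [E1 _ _ _] := ord3_shift i.
by rewrite /bary /edge1 E1.
Qed.

Definition same_edge_sign (s s' : side R) : R := if side_src s == side_src s' then 1 else -1.

Lemma same_edge_vec (s s' : side R) : same_edge s s' ->
  side_tgt s' - side_src s' = same_edge_sign s s' *: (side_tgt s - side_src s).
Proof.
rewrite /same_edge /same_edge_sign; case: eqP => /= [->|_]; last first.
  by case/andP => /eqP -> /eqP ->; rewrite scaleN1r opprB.
by case/orP => [/eqP ->|/andP[/eqP E /eqP ->]]; rewrite scale1r // E.
Qed.

(** Both coordinates are affine and vanish on the line of the common side, hence are proportional;
    the factor compares the two determinants and the two directions of the side. *)
Lemma same_edge_bary t i t' j x : same_edge (t, i) (t', j) -> nondeg t ->
  bary t' j x = same_edge_sign (t, i) (t', j) * (tri_det t / tri_det t') * bary t i x.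
Proof.
move=> se /tri_det_neq0 d0; rewrite !bary_side (same_edge_vec se).
have -> (b z w : R) : w * (tri_det t * b) * (z / tri_det t) = w * z * b by field.
congr (_ * _); move: se; rewrite /same_edge /same_edge_sign.
move: (side_src _) (side_tgt _) (side_src _) (side_tgt _) => p q p' q'.
case: eqP => /= [->|_]; first by move=> _; rewrite scale1r mul1r.
by case/andP => /eqP -> /eqP ->; rewrite /cross /= -?[_ *: _]/(_ * _); ring.
Qed.

(** Were the factor positive, a point of [t] close to the midpoint of the common side would have
    positive coordinates in [t'] too. *)
Lemma same_edge_opposite t i t' j : nondeg t -> nondeg t' -> same_edge (t, i) (t', j) ->
  open_tri t `&` open_tri t' = set0 ->
  same_edge_sign (t, i) (t', j) * (tri_det t / tri_det t') < 0.
Proof.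
move=> nt nt' se dis; have d0 := tri_det_neq0 nt; have d0' := tri_det_neq0 nt'.
rewrite ltNge; apply/negP => k0.
have {}k0 : 0 < same_edge_sign (t, i) (t', j) * (tri_det t / tri_det t').
  rewrite lt_neqAle k0 andbT eq_sym !mulf_eq0 invr_eq0 (negbTE d0) (negbTE d0') !orbF /same_edge_sign.
  by case: ifP; rewrite ?oppr_eq0 oner_eq0.
set k := (_ * _) in k0.
pose m := side_pt (t, i) 2^-1.
have mE : m = side_pt (t', j) 2^-1.
  move: se; rewrite /same_edge /m !side_pt_combination.
  case/orP => /andP[/eqP -> /eqP ->] //; rewrite addrC.
  by congr (_ *: _ + _ *: _); lra.
pose B1 := bary t' (j + 1) (t i); pose B2 := bary t' (j + 2%:R) (t i).
(* At the midpoint the other two coordinates in [t'] equal 1/2; a step of length [h] towards [t i]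
   is too short to make either of them vanish. *)
pose h := (2 * (1 + `|B1| + `|B2|))^-1.
have q0 : 0 < 1 + `|B1| + `|B2| by rewrite -addrA ltr_pwDl // addr_ge0.
have h0 : 0 < h by rewrite invr_gt0 mulr_gt0.
have hE : h * (2 * (1 + `|B1| + `|B2|)) = 1 by rewrite mulVf // gt_eqF // mulr_gt0.
have h1 : h < 1 by have := normr_ge0 B1; have := normr_ge0 B2; nra.
pose x := (1 - h) *: m + h *: t i.
have [m0 m1 m2] := bary_side_pt i 2^-1 nt.
have [n0 n1 n2] := bary_side_pt j 2^-1 nt'; rewrite -mE in n0 n1 n2.
have v := bary_vertices nt.
have bx : bary t i x = h by rewrite bary_segment m0; have [-> _ _] := v i; ring.
have xt : open_tri t x.
  apply/(open_triP _ nt) => l; case: (ord3_split i l) => ->.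
  - by rewrite bx.
  - rewrite bary_segment m1; have [_ _] := v (i + 1).
    have [_ -> _ _] := ord3_shift i.
    by move=> ->; lra.
  - rewrite bary_segment m2; have [_ + _] := v (i + 2%:R).
    have [_ _ -> _] := ord3_shift i.
    by move=> ->; lra.
have xt' : open_tri t' x.
  have a1 := ler_norm (- B1); have a2 := ler_norm (- B2); rewrite !normrN in a1 a2.
  have b1 := normr_ge0 B1; have b2 := normr_ge0 B2.
  apply/(open_triP _ nt') => l; case: (ord3_split j l) => ->.
  - by rewrite (same_edge_bary x se nt) bx mulr_gt0.
  - by rewrite bary_segment n1 -/B1; nra.
  - by rewrite bary_segment n2 -/B2; nra.
have : (open_tri t `&` open_tri t') x by [].
by rewrite dis.
Qed.

(** The signs in [normal_coef] remove the orientation of each triangle, and what remains is the sign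
    of the negative factor in [same_edge_opposite]. *)
Lemma normal_coef_opposite t i t' j d : nondeg t -> nondeg t' -> same_edge (t, i) (t', j) ->
  open_tri t `&` open_tri t' = set0 -> normal_coef (t', j) d = - normal_coef (t, i) d.
Proof.
move=> nt nt' se dis; have := same_edge_opposite nt nt' se dis.
have d0 := tri_det_neq0 nt; have d0' := tri_det_neq0 nt'.
rewrite /normal_coef (same_edge_vec se) /=.
set e := same_edge_sign _ _ => k.
have -> : cross (e *: (side_tgt (t, i) - side_src (t, i))) d = e * cross (side_tgt (t, i) - side_src (t, i)) d.
  by rewrite /cross /= -?[_ *: _]/(_ * _); ring.
suff -> : Num.sg (tri_det t) = - (e * Num.sg (tri_det t')) by ring.
have : Num.sg (e * (tri_det t / tri_det t')) = -1 by exact: ltr0_sg.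
rewrite !sgrM sgrV.
have -> : Num.sg e = e by rewrite /e /same_edge_sign; case: ifP => _; rewrite ?sgrN sgr1.
have e2 : e * e = 1 by rewrite /e /same_edge_sign; case: ifP => _; ring.
have s2 : Num.sg (tri_det t') * Num.sg (tri_det t') = 1 by rewrite -expr2 sqr_sg d0'.
move=> E.
have -> : Num.sg (tri_det t) = (e * e) * Num.sg (tri_det t) * (Num.sg (tri_det t') * Num.sg (tri_det t')).
  by rewrite e2 s2 mul1r mulr1.
have -> : e * e * Num.sg (tri_det t) * (Num.sg (tri_det t') * Num.sg (tri_det t')) =
   (e * (Num.sg (tri_det t) * Num.sg (tri_det t'))) * (e * Num.sg (tri_det t')) by ring.
by rewrite E mulN1r.
Qed.

Lemma same_edge_sym (s s' : side R) : same_edge s s' = same_edge s' s.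
Proof.
rewrite /same_edge [side_src s' == side_src s]eq_sym [side_tgt s' == side_tgt s]eq_sym.
by rewrite [side_src s' == side_tgt s]eq_sym [side_tgt s' == side_src s]eq_sym [X in _ || X]andbC.
Qed.

Lemma same_edge_trans (s s1 s2 : side R) : same_edge s1 s -> same_edge s s2 -> same_edge s1 s2.
Proof.
rewrite /same_edge => /orP[] /andP[/eqP -> /eqP ->] // /orP[] /andP[/eqP -> /eqP ->]; rewrite !eqxx ?orbT //.
Qed.

Lemma same_edge_side_pt (s s' : side R) r : same_edge s s' ->
  side_pt s' r = side_pt s (if side_src s == side_src s' then r else 1 - r).
Proof.
rewrite /same_edge !side_pt_combination; case: eqP => /= [->|_].
  by case/orP => [/eqP ->|/andP[/eqP E /eqP ->]] //; rewrite E.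
by case/andP => /eqP -> /eqP ->; rewrite addrC subKr.
Qed.

Lemma vertex_inj t i j : nondeg t -> t i = t j -> i = j.
Proof.
move=> nt E; have v := bary_vertices nt; case: (ord3_split i j) => // ji.
  by have [v1 v2 _] := v i; move: v1; rewrite E ji v2 => /eqP; rewrite eq_sym oner_eq0.
by have [v1 _ v2] := v i; move: v1; rewrite E ji v2 => /eqP; rewrite eq_sym oner_eq0.
Qed.

Lemma same_edge_same_tri t i j : nondeg t -> same_edge (t, i) (t, j) -> i = j.
Proof.
move=> nt; rewrite /same_edge /side_src /side_tgt /=.
case/orP => /andP[/eqP/(vertex_inj nt) E1 /eqP/(vertex_inj nt) E2]; first exact: (addIr _ E1).
have [F1 F2 _ _] := ord3_shift j; have [/eqP n1 _ _] := ord3_neq j.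
have ij : i = j + 1 by apply: (addIr 1); rewrite F1.
by case: n1; rewrite -E2 ij F2.
Qed.

End Barycentric.

(** * Pairing the sides of a triangulation *)

Section Triangulations.
Context {R : realType}.
Notation pt := (R * R)%type.
Notation mR := (measurableTypeR R).
Notation mpt := (mR * mR)%type.
Notation mu1 := (@lebesgue_measure R).
Implicit Type t : triangle R.
Notation nondeg := Defs.nondegenerate.

Lemma closed_closed_tri t : nondeg t -> closed (closed_tri t).
Proof.
move=> nt.
have -> : closed_tri t = \bigcap_(i in [set: 'I_3]) (bary t i @^-1` [set z : R | 0 <= z]).
  apply/seteqP; split => x; first by move/(closed_triP _ nt) => H i _; exact: H.
  by move=> H; apply/(closed_triP _ nt) => i; exact: H.
apply: closed_bigI => i _; apply: closed_comp; last exact: closed_ge.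
by move=> x _; exact: continuous_bary.
Qed.

Lemma closed_bigcup_tri (P : seq (triangle R)) : (forall t, t \in P -> nondeg t) ->
  closed (\bigcup_(t in [set` P]) closed_tri t).
Proof.
elim: P => [|t P IH] H.
  by rewrite (_ : [set` [::]] = set0) ?bigcup_set0; [exact: closed0|apply/seteqP; split].
have -> : \bigcup_(t0 in [set` t :: P]) closed_tri t0 = closed_tri t `|` \bigcup_(t in [set` P]) closed_tri t.
  apply/seteqP; split => x.
    by case=> t' /=; rewrite inE => /orP[/eqP ->|tP] xt; [left|right; exists t'].
  by case=> [xt|[t' tP xt]]; [exists t => //=; rewrite inE eqxx|exists t' => //=; rewrite inE tP orbT].
apply: closedU; first by apply: closed_closed_tri; apply: H; rewrite inE eqxx.
by apply: IH => t' t'P; apply: H; rewrite inE t'P orbT.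
Qed.

Section OneTriangulation.
Variables (Omega : set pt) (T : seq (triangle R)).
Hypotheses (oO : open Omega) (HT : triangulation Omega T).

Let uT : uniq T. Proof. by case: HT. Qed.
Let nT t : t \in T -> nondeg t. Proof. by case: HT => _ H _ _; exact: H. Qed.

Lemma triangulation_disjoint t t' : t \in T -> t' \in T -> t != t' ->
  open_tri t `&` open_tri t' = set0.
Proof.
move=> tT tT' tt; case: HT => _ _ C _; apply: conforming_disjoint; [exact: nT|exact: nT|exact: C].
Qed.

Lemma triangulation_covers x : Omega x -> exists2 t, t \in T & closed_tri t x.
Proof.
move=> Ox; case: HT => _ _ _ C.
have : closure Omega x by exact: subset_closure.
by rewrite -C => -[t tT xt]; exists t.
Qed.

(** Points of [Omega] just across the side have to be covered, so some other closed triangle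
    contains the given point; this point is no vertex of [t], and conformity then leaves only a
    common side. *)
Lemma side_partner_exists t i r : t \in T -> 0 < r < 1 -> Omega (side_pt (t, i) r) ->
  exists t' j, [/\ t' \in T, t' != t & same_edge (t, i) (t', j)].
Proof.
move=> tT /andP[r0 r1] Oz; set z := side_pt (t, i) r in Oz.
have nt := nT tT; have [b0 b1 b2] := bary_side_pt i r nt; rewrite -/z in b0 b1 b2.
have [t' [t'T t't zt']] : exists t', [/\ t' \in T, t' != t & closed_tri t' z].
  apply: contrapT => H.
  pose P := [seq t' <- T | t' != t].
  have cP : closed (\bigcup_(t in [set` P]) closed_tri t).
    by apply: closed_bigcup_tri => t'; rewrite mem_filter => /andP[_]; exact: nT.
  have oU : open (Omega `&` ~` (\bigcup_(t in [set` P]) closed_tri t)).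
    by apply: openI => //; exact: closed_openC.
  have Uz : (Omega `&` ~` (\bigcup_(t in [set` P]) closed_tri t)) z.
    split => // -[t' /=]; rewrite mem_filter => /andP[t't t'T] zt'; apply: H; by exists t'.
  have /nbhs_ballP[e /= e0 eU] := open_nbhs_nbhs (conj oU Uz).
  pose n := `|t i - z|; pose h := e / (2 * (n + 1)).
  have n0 : 0 <= n by exact: normr_ge0.
  have h0 : 0 < h by rewrite divr_gt0 // mulr_gt0 // ltr_wpDl.
  (* Just beyond the side, as seen from vertex [i]: the coordinate of [y] at [i] is [- h], so [y] is
     not in [t]. *)
  pose y := (1 - (- h)) *: z + (- h) *: t i.
  have yz : z - y = h *: (t i - z).
    have G (w p : pt) : w - ((1 - (- h)) *: w + (- h) *: p) = h *: (p - w).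
      by case: w p => w1 w2 [p1 p2]; congr (_, _) => /=; rewrite -?[_ *: _]/(_ * _); ring.
    exact: G.
  have [] : (Omega `&` ~` (\bigcup_(t in [set` P]) closed_tri t)) y.
    apply: eU; rewrite -ball_normE /ball_ /= yz normrZ gtr0_norm //.
    rewrite -/n /h mulrAC ltr_pdivrMr ?mulr_gt0 ?ltr_wpDl // ltr_pM2l //; lra.
  move=> Oy; have [t' t'T yt'] := triangulation_covers Oy.
  case; exists t' => //=; rewrite mem_filter t'T andbT; apply/eqP => E; rewrite {}E in yt' t'T.
  move/(closed_triP _ nt): yt' => /(_ i); rewrite bary_segment b0.
  have [-> _ _] := bary_vertices nt i; lra.
have nt' := nT t'T.
case: HT => _ _ /(_ t t' tT t'T); rewrite eq_sym => /(_ t't) C _.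
have zI : (closed_tri t `&` closed_tri t') z.
  split => //; apply/(closed_triP _ nt) => l; case: (ord3_split i l) => ->; rewrite ?b0 ?b1 ?b2; lra.
case: C => [C|[k [j [_ C]]]|[k [j [se C]]]]; rewrite C in zI.
- by [].
- have [v0 v1 v2] := bary_vertices nt k; case: (ord3_split i k) => E; rewrite -zI in v0 v1 v2.
  + by move: v0; rewrite E b0 => /eqP; rewrite eq_sym oner_eq0.
  + by move: v0; rewrite E b1 => ?; lra.
  + by move: v0; rewrite E b2 => ?; lra.
- exists t', j; split => //; case: zI => q _ qz.
  have [v0 _ _] := bary_side_pt k q nt; rewrite qz in v0.
  case: (ord3_split i k) => E; rewrite E ?b1 ?b2 in v0 se *; [by []|lra|lra].
Qed.

Definition partner (s s' : side R) := same_edge s s' && (s.1 != s'.1).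

Lemma partner_sym s s' : partner s s' = partner s' s.
Proof. by rewrite /partner same_edge_sym eq_sym. Qed.

Lemma partner_normal_coef s s' d : s.1 \in T -> s'.1 \in T -> partner s s' ->
  normal_coef s' d = - normal_coef s d.
Proof.
case: s s' => t i [t' j] /= tT t'T /andP[se tt']; apply: normal_coef_opposite => //; try exact: nT.
exact: triangulation_disjoint.
Qed.

Lemma normal_coef_neq0 s : s.1 \in T -> exists d, normal_coef s d != 0.
Proof.
case: s => t i /= tT; have nt := nT tT; have d0 := tri_det_neq0 nt.
exists (t i - side_src (t, i)); rewrite /normal_coef /= -tri_det_side.
by rewrite mulf_neq0 // oppr_eq0 sgr_eq0.
Qed.

(** Two different partners would also be partners of each other; three pairwise opposite normal
    coefficients vanish, while some direction gives a nonzero one. *)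
Lemma partner_unique s s1 s2 : s.1 \in T -> s1.1 \in T -> s2.1 \in T ->
  partner s s1 -> partner s s2 -> s1 = s2.
Proof.
move=> sT s1T s2T p1 p2; have se : same_edge s1 s2.
  apply: (@same_edge_trans _ s); last by case/andP: p2.
  by rewrite same_edge_sym; case/andP: p1.
have [E|ne] := eqVneq s1.1 s2.1.
  case: s1 s2 s1T s2T E se {p1 p2} => t1 i1 [t2 i2] /= t1T _ E; rewrite -E => se.
  by rewrite (same_edge_same_tri (nT t1T) se).
have [d /eqP[]] := normal_coef_neq0 sT.
have E1 := partner_normal_coef d sT s1T p1; have E2 := partner_normal_coef d sT s2T p2.
have E3 : normal_coef s2 d = - normal_coef s1 d by apply: partner_normal_coef => //; rewrite /partner se.
move: E3; rewrite E1 E2; lra.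
Qed.

Definition sides : seq (side R) := [seq (t, i) | t <- T, i <- enum 'I_3].

Lemma mem_sides s : (s \in sides) = (s.1 \in T).
Proof.
case: s => t i; apply/allpairsP/idP => [[[t' j] /= [tT _ [-> _]]]|/= tT] //.
by exists (t, i); rewrite /= mem_enum.
Qed.

Lemma uniq_sides : uniq sides.
Proof. by apply: allpairs_uniq => //; [exact: enum_uniq|move=> [a b] [c d] _ _ /= [-> ->]]. Qed.

Lemma big_sides (V : nmodType) (f : side R -> V) :
  \sum_(s <- sides) f s = \sum_(t <- T) \sum_i f (t, i).
Proof.
rewrite /sides big_allpairs_dep /=; apply: eq_bigr => t _.
by rewrite big_enum.
Qed.

Lemma big_interior_edges (V : nmodType) (f : side R * side R -> V) :
  \sum_(e <- interior_edges T) f e =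
  \sum_(s <- sides) \sum_(s' <- sides | partner s s' && (index s.1 T < index s'.1 T)%N) f (s, s').
Proof.
rewrite /interior_edges big_filter big_mkcond big_allpairs_dep -/sides /=.
rewrite [LHS]big_seq [RHS]big_seq; apply: eq_bigr => s sS.
rewrite -big_mkcond big_seq_cond [RHS]big_seq_cond; apply: eq_bigl => s'.
case: (boolP (s' \in sides)) => //= s'S; rewrite /partner andbC.
case: (same_edge s s') => //=; case: ltnP => [lt|le]; last by rewrite andbF.
by rewrite andbT; apply/esym; apply: contraTneq lt => ->; rewrite ltnn.
Qed.

(** A side with a partner belongs to exactly one edge, as first or second component according to the
    order in [T]. Exchanging the two sums turns the second components into first ones. *)
Lemma sum_paired_sides (V : zmodType) (a : side R -> V) :
  (forall s, s \in sides -> (forall s', s' \in sides -> ~~ partner s s') -> a s = 0) ->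
  \sum_(t <- T) \sum_i a (t, i) = \sum_(e <- interior_edges T) (a e.1 + a e.2).
Proof.
move=> H; rewrite -big_sides big_interior_edges /=.
pose p s s' := partner s s' && (index s.1 T < index s'.1 T)%N.
have -> : \sum_(s <- sides) \sum_(s' <- sides | p s s') (a s + a s') =
   \sum_(s <- sides) \sum_(s' <- sides | p s s') a s + \sum_(s <- sides) \sum_(s' <- sides | p s' s) a s.
  rewrite [X in _ = _ + X](exchange_big_dep xpredT) //= -big_split /=.
  by apply: eq_bigr => s _; rewrite -big_split.
rewrite -big_split /= big_seq [RHS]big_seq; apply: eq_bigr => s sS.
have E : \sum_(s' <- sides | p s s') a s + \sum_(s' <- sides | p s' s) a s = \sum_(s' <- sides | partner s s') a s.
  rewrite [RHS](bigID (fun s' => index s.1 T < index s'.1 T)%N) /=; congr (_ + _).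
  rewrite big_seq_cond [RHS]big_seq_cond; apply: eq_bigl => s'.
  case: (boolP (s' \in sides)) => //= s'S; rewrite /p partner_sym -leqNgt ltn_neqAle.
  case: (boolP (partner s s')) => //= /andP[_ ne].
  case: eqP => //= E; case/eqP: ne; rewrite !mem_sides in sS s'S.
  by rewrite -(nth_index s.1 sS) -E nth_index.
rewrite E; have [[s' [s'S ps]]|no] := pselect (exists s', s' \in sides /\ partner s s').
  rewrite big_mkcond (bigD1_seq s') //=; last exact: uniq_sides.
  rewrite ps big_seq_cond big1 ?addr0 // => s2 /andP[s2S ne]; case: ifP => // p2.
  by case/eqP: ne; rewrite !mem_sides in sS s'S s2S; exact: (partner_unique sS s2S s'S p2 ps).
rewrite (H s sS); last by move=> s' s'S; apply/negP => ps; apply: no; exists s'.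
by rewrite big1.
Qed.

(** By uniqueness of partners, a side is the first component of at most one edge. *)
Lemma sum_interior_edges_le (a : side R -> R) : (forall s, s \in sides -> 0 <= a s) ->
  \sum_(e <- interior_edges T) a e.1 <= \sum_(t <- T) \sum_i a (t, i).
Proof.
move=> a0; rewrite -big_sides big_interior_edges /= [leLHS]big_seq [leRHS]big_seq.
apply: ler_sum => s sS.
have [[s' [s'S ps]]|no] := pselect (exists s', s' \in sides /\ (partner s s' && (index s.1 T < index s'.1 T)%N)).
  rewrite big_mkcond (bigD1_seq s') //=; last exact: uniq_sides.
  rewrite ps big_seq_cond big1 ?addr0 // => s2 /andP[s2S ne]; case: ifP => // /andP[p2 _].
  case/andP: ps => ps _; rewrite !mem_sides in sS s'S s2S.
  by case/eqP: ne; exact: (partner_unique sS s2S s'S p2 ps).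
rewrite big_seq_cond big_pred0 ?a0 // => s'.
by apply/negP => /andP[s'S ps]; apply: no; exists s'.
Qed.

Lemma interior_edgesP e : e \in interior_edges T ->
  [/\ e.1.1 \in T, e.2.1 \in T & partner e.1 e.2].
Proof.
rewrite mem_filter -/sides => /andP[/andP[lt se] /allpairsP[[s s'] /= [sS s'S E]]].
move: lt se; rewrite E /= -!mem_sides => lt se; split => //; rewrite /partner se /=.
by apply: contraTneq lt => ->; rewrite ltnn.
Qed.

End OneTriangulation.

End Triangulations.

(** * Shape regularity: side lengths against areas *)

Section ShapeRegularity.
Context {R : realType}.
Notation pt := (R * R)%type.
Notation mR := (measurableTypeR R).
Notation mpt := (mR * mR)%type.
Notation mu1 := (@lebesgue_measure R).
Implicit Type t : triangle R.
Notation nondeg := Defs.nondegenerate.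

Definition square (c : pt) (r : R) : set mpt :=
  (`[c.1 - r, c.1 + r]%classic : set mR) `*` (`[c.2 - r, c.2 + r]%classic : set mR).

Lemma squareP (c : pt) (r : R) (z : mpt) : square c r z <-> `|z.1 - c.1| <= r /\ `|z.2 - c.2| <= r.
Proof.
rewrite /square /=; rewrite !in_itv /= !ler_distl; split => -[/andP[h1 h2] /andP[h3 h4]];
  by split; apply/andP; split.
Qed.

Lemma measurable_square c r : measurable (square c r).
Proof. by apply: measurableX; exact: measurable_itv. Qed.

Transparent area.
Lemma area_square c r : 0 <= r -> area (square c r) = (4 * r ^+ 2)%:E.
Proof.
move=> r0; rewrite -[LHS]/((mu1 \x mu1)%E (square c r)) product_measure1E; try exact: measurable_itv.
have E (a : R) : mu1 (`[a - r, a + r]%classic : set mR) = (2 * r)%:E.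
  rewrite lebesgue_measure_itv /= lte_fin; case: ltP => h.
    by rewrite -EFinB; congr EFin; ring.
  by congr EFin; lra.
rewrite [X in (X * _)%E]E [X in (_ * X)%E]E -EFinM; congr EFin; ring.
Qed.
Opaque area.

Lemma edist_ge0 (p q : pt) : 0 <= Defs.edist p q.
Proof. exact: sqrtr_ge0. Qed.

Lemma edist_sq (p q : pt) : Defs.edist p q ^+ 2 = (p.1 - q.1) ^+ 2 + (p.2 - q.2) ^+ 2.
Proof. by rewrite sqr_sqrtr // addr_ge0 ?sqr_ge0. Qed.

Lemma open_area_gt0 (U : set pt) : open U -> U !=set0 -> (0 < area U)%E.
Proof.
move=> oU [x Ux]; have [r [r0 rU]] := open_inner_ball oU Ux.
apply: (@lt_le_trans _ _ (area (square x r))).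
  by rewrite area_square ?ltW // lte_fin mulr_gt0 // exprn_gt0.
apply: le_measure; rewrite ?inE; [exact: measurable_square|exact: open_measurable_plane|].
by move=> z /squareP[h1 h2]; apply: rU; rewrite /Num.norm /= ge_max h1 h2.
Qed.

Definition tri_area t : R := fine (area (open_tri t)).

Lemma tri_areaE t : nondeg t -> area (open_tri t) = (tri_area t)%:E.
Proof. by move=> nt; rewrite fineK // ge0_fin_numE // open_tri_fin. Qed.

Lemma tri_area_ge0 t : 0 <= tri_area t.
Proof. exact/fine_ge0/measure_ge0. Qed.

Definition inscribed t : set R := [set r | 0 < r /\ exists c, [set x | Defs.edist c x < r] `<=` open_tri t].

(** A disc of radius [r] contains the concentric axis-parallel square of side [r]. *)
Lemma inscribed_sq_le t r : nondeg t -> inscribed t r -> r ^+ 2 <= tri_area t.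
Proof.
move=> nt [r0 [c H]]; rewrite -lee_fin -tri_areaE //.
have r20 : 0 <= r / 2 by rewrite divr_ge0 // ltW.
have -> : r ^+ 2 = 4 * (r / 2) ^+ 2 by field.
rewrite -(area_square c) //; apply: le_measure; rewrite ?inE; [exact: measurable_square|exact: measurable_open_tri|].
move=> z /squareP[h1 h2]; apply: H => /=.
rewrite -(ltr_pXn2r (n := 2)) ?nnegrE ?edist_ge0 ?ltW // edist_sq.
have k (a b : R) : `|a - b| <= r / 2 -> (b - a) ^+ 2 <= (r / 2) ^+ 2.
  by move=> h; rewrite -sqrrN opprB -[_ ^+ 2]real_normK ?num_real // lerXn2r ?nnegrE.
have := k _ _ h1; have := k _ _ h2; have : 0 < r ^+ 2 by rewrite exprn_gt0.
have -> : (r / 2) ^+ 2 = r ^+ 2 / 4 by field.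
move: (_ ^+ 2) (_ ^+ 2) (_ ^+ 2) => a b d; lra.
Qed.

Lemma inscribed_nonempty t : nondeg t -> inscribed t !=set0.
Proof.
move=> nt; have [r [r0 rT]] := open_inner_ball (open_open_tri nt) (open_tri_center t).
exists r; split => //; exists (\sum_i 3^-1 *: t i) => x /= h; apply: rT.
have k (a b : R) : a ^+ 2 <= Defs.edist (\sum_i 3^-1 *: t i) x ^+ 2 -> `|a| <= r.
  move=> h2; apply: le_trans (ltW h); rewrite -(ler_pXn2r (n := 2)) ?nnegrE ?edist_ge0 //.
  by rewrite real_normK ?num_real.
rewrite /Num.norm /= ge_max; apply/andP; split; apply: (k _ 0); rewrite edist_sq -[leLHS]sqrrN opprB.
  by rewrite lerDl sqr_ge0.
by rewrite lerDr sqr_ge0.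
Qed.

Lemma inradius_gt0 t : nondeg t -> 0 < inradius t.
Proof.
move=> nt; have [r ir] := inscribed_nonempty nt; apply: (@lt_le_trans _ _ r); first by case: ir.
apply: ub_le_sup => //; exists (Num.sqrt (tri_area t)) => z iz.
have z0 : 0 <= z by case: iz => /ltW.
by rewrite -[leLHS]ger0_norm // -sqrtr_sqr ler_wsqrtr // inscribed_sq_le.
Qed.

Lemma inradius_sq_le t : nondeg t -> inradius t ^+ 2 <= tri_area t.
Proof.
move=> nt; have : inradius t <= Num.sqrt (tri_area t).
  apply: ge_sup; first exact: inscribed_nonempty.
  move=> z iz; have z0 : 0 <= z by case: iz => /ltW.
  by rewrite -[leLHS]ger0_norm // -sqrtr_sqr ler_wsqrtr // inscribed_sq_le.
move=> h; rewrite -(sqr_sqrtr (tri_area_ge0 t)) lerXn2r ?nnegrE ?sqrtr_ge0 //.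
exact/ltW/inradius_gt0.
Qed.

Definition circumscribed t : set R := [set r | exists c, open_tri t `<=` [set x | Defs.edist c x <= r]].

(** [inf] of an empty set is a default value; a crude radius makes [circumradius] a genuine
    infimum. *)
Lemma circumscribed_nonempty t : circumscribed t !=set0.
Proof.
pose A := \sum_j `|(t j).1|; pose B := \sum_j `|(t j).2|.
exists (Num.sqrt (A ^+ 2 + B ^+ 2)); exists 0 => x [l [l0 l1 ->]] /=.
rewrite /Defs.edist; apply: ler_wsqrtr.
have k (p : 'I_3 -> R) : (0 - \sum_j l j * p j) ^+ 2 <= (\sum_j `|p j|) ^+ 2.
  rewrite sub0r sqrrN -[leLHS]real_normK ?num_real // lerXn2r ?nnegrE ?sumr_ge0 //.
  apply: le_trans (ler_norm_sum _ _ _) _; apply: ler_sum => j _.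
  rewrite normrM ler_piMl // gtr0_norm // -l1 (bigD1 j) //= lerDl sumr_ge0 // => i _; exact: ltW.
have E1 : (\sum_j l j *: t j).1 = \sum_j l j * (t j).1 by rewrite !(sum_ord3 _ 0).
have E2 : (\sum_j l j *: t j).2 = \sum_j l j * (t j).2 by rewrite !(sum_ord3 _ 0).
by rewrite E1 E2; apply: lerD; exact: k.
Qed.

(** The ends of a side do not belong to the open triangle, so they are first shrunk towards the
    centroid; two points of a disc are at distance at most the diameter, and the shrinking is then
    undone. *)
Lemma side_len_le_circumscribed t i r : nondeg t -> circumscribed t r -> side_len (t, i) / 2 <= r.
Proof.
move=> nt [c Hc]; set len := side_len (t, i); have l0 : 0 < len by exact: side_len_gt0.
have r0 : 0 <= r by apply: le_trans (edist_ge0 c _) (Hc _ (open_tri_center t)).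
suff : len ^+ 2 <= 4 * r ^+ 2.
  move=> h; rewrite ler_pdivrMr // -(ler_pXn2r (n := 2)) ?nnegrE ?mulr_ge0 // ?(ltW l0) //.
  by have -> : (r * 2) ^+ 2 = 4 * r ^+ 2 by ring.
have H (e : R) : 0 < e < 1 -> (1 - e) ^+ 2 * len ^+ 2 <= 4 * r ^+ 2.
  move=> /andP[e0 e1].
  pose z : pt := \sum_i 3^-1 *: t i.
  pose x := (1 - e) *: side_src (t, i) + e *: z; pose y := (1 - e) *: side_tgt (t, i) + e *: z.
  have inT p : (forall j, 0 <= bary t j p) -> open_tri t ((1 - e) *: p + e *: z).
    move=> p0; apply/(open_triP _ nt) => j; rewrite bary_segment.
    have := (open_triP _ nt).1 (open_tri_center t) j; rewrite -/z; have := p0 j; nra.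
  have bs j : 0 <= bary t j (side_pt (t, i) 0) /\ 0 <= bary t j (side_pt (t, i) 1).
    have [a0 a1 a2] := bary_side_pt i 0 nt; have [c0 c1 c2] := bary_side_pt i 1 nt.
    by case: (ord3_split i j) => ->; rewrite ?a0 ?a1 ?a2 ?c0 ?c1 ?c2; split; lra.
  have xT : open_tri t x.
    apply: inT => j; have [+ _] := bs j; rewrite side_pt_combination.
    by rewrite subr0 scale1r scale0r addr0.
  have yT : open_tri t y.
    apply: inT => j; have [_ +] := bs j; rewrite side_pt_combination.
    by rewrite subrr scale1r scale0r add0r.
  have sq p : open_tri t p -> (c.1 - p.1) ^+ 2 + (c.2 - p.2) ^+ 2 <= r ^+ 2.
    by move=> /Hc /= h; rewrite -edist_sq lerXn2r ?nnegrE ?edist_ge0.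
  have := sq _ xT; have := sq _ yT.
  have -> : (1 - e) ^+ 2 * len ^+ 2 = (x.1 - y.1) ^+ 2 + (x.2 - y.2) ^+ 2.
    rewrite /len /side_len edist_sq /x /y /= -?[_ *: _]/(_ * _); ring.
  move: (x.1) (x.2) (y.1) (y.2) (c.1) (c.2) (r ^+ 2) => x1 x2 y1 y2 c1 c2 rr h1 h2.
  have := sqr_ge0 (2 * c1 - x1 - y1); have := sqr_ge0 (2 * c2 - x2 - y2); nra.
rewrite leNgt; apply/negP => lt.
pose d := len ^+ 2 - 4 * r ^+ 2; have d0 : 0 < d by rewrite subr_gt0.
have L0 : 0 < len ^+ 2 by rewrite exprn_gt0.
(* Shrinking by [e] costs at most [d / 2] of [len ^+ 2], half of the assumed gap. *)
pose e := d / (4 * len ^+ 2).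
have eE : e * len ^+ 2 = d / 4 by rewrite /e; field; rewrite gt_eqF.
have e0 : 0 < e by rewrite divr_gt0 // mulr_gt0.
have e1 : e < 1 by rewrite ltr_pdivrMr ?mulr_gt0 // /d; have := sqr_ge0 r; nra.
have := H e; rewrite e0 e1 => /(_ isT).
have : 0 <= e ^+ 2 * len ^+ 2 by rewrite mulr_ge0 ?sqr_ge0.
have -> : (1 - e) ^+ 2 * len ^+ 2 = len ^+ 2 - 2 * (e * len ^+ 2) + e ^+ 2 * len ^+ 2 by ring.
rewrite eE /d in d0 *; lra.
Qed.

Lemma side_len_le_circumradius t i : nondeg t -> side_len (t, i) <= 2 * circumradius t.
Proof.
move=> nt; have : side_len (t, i) / 2 <= circumradius t; last by lra.
apply: lb_le_inf; first exact: circumscribed_nonempty.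
by move=> r; exact: side_len_le_circumscribed.
Qed.

(** The point where the numerical value of the shape constant acts: a side is at most twice the
    circumradius, hence at most [2 * K] inradii, and the squared inradius is at most the area. *)
Lemma side_len_sq_le (T : seq (triangle R)) (K : R) t i : shape_const T <= K -> t \in T -> nondeg t ->
  side_len (t, i) ^+ 2 <= 4 * K ^+ 2 * tri_area t.
Proof.
move=> TK tT nt; have in0 := inradius_gt0 nt.
have h1 : circumradius t <= K * inradius t.
  rewrite -ler_pdivrMr //; apply: le_trans TK; rewrite /shape_const.
  exact: (le_bigmax_seq 0 t xpredT (fun t => circumradius t / inradius t)).
have h2 := side_len_le_circumradius i nt; have h3 := ltW (side_len_gt0 i nt).
apply: (@le_trans _ _ (4 * K ^+ 2 * inradius t ^+ 2)).
  have -> : 4 * K ^+ 2 * inradius t ^+ 2 = (2 * (K * inradius t)) ^+ 2 by ring.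
  rewrite lerXn2r ?nnegrE //; lra.
by rewrite ler_wpM2l ?inradius_sq_le // mulr_ge0 ?sqr_ge0.
Qed.

Lemma sum_tri_area_le (T : seq (triangle R)) (W : set mpt) : uniq T -> (forall t, t \in T -> nondeg t) ->
  (forall t t', t \in T -> t' \in T -> t != t' -> open_tri t `&` open_tri t' = set0) ->
  measurable W -> (forall t, t \in T -> open_tri t `<=` W) ->
  (\sum_(t <- T) (tri_area t)%:E <= area W)%E.
Proof.
move=> uT nT dT mW TW.
apply: (@le_trans _ _ (area (\bigcup_(t in [set` T]) open_tri t))); last first.
  apply: le_measure; rewrite ?inE //; last by move=> x [t /= tT xt]; exact: (TW t).
  by apply: fin_bigcup_measurable => // t /= tT; apply: measurable_open_tri; exact: nT.
rewrite measure_fin_bigcup //.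
- rewrite -fsbig_seq // le_eqVlt; apply/orP; left; apply/eqP.
  rewrite big_seq [RHS]big_seq; apply: eq_bigr => t tT; exact/esym/tri_areaE/nT.
- exact: finite_seq.
- move=> t t' /= tT t'T [x [xt xt']]; apply: contrapT => /eqP ne.
  have : (open_tri t `&` open_tri t') x by [].
  by rewrite dT.
by move=> t /= tT; apply: measurable_open_tri; exact: nT.
Qed.

End ShapeRegularity.

(** * Gluing the pieces into one function on the plane *)

Section Gluing.
Context {R : realType}.
Notation pt := (R * R)%type.
Notation mR := (measurableTypeR R).
Notation mpt := (mR * mR)%type.
Implicit Type t : triangle R.
Notation nondeg := Defs.nondegenerate.

Lemma indic_mul_patch (A : set mpt) (f : mpt -> R) :
  EFin \o (fun x => \1_A x * f x) = (EFin \o f) \_ A.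
Proof.
by apply/funext => x; rewrite patchE /= indicE; case: ifPn => _; rewrite ?mul1r ?mul0r.
Qed.

Lemma integrable_indic_mul (A : set mpt) (f : mpt -> R) : measurable A ->
  area.-integrable A (EFin \o f) -> area.-integrable setT (EFin \o (fun x => \1_A x * f x)).
Proof. by move=> mA fi; rewrite indic_mul_patch; exact/(integrable_mkcond _ mA). Qed.

Lemma integral_indic_mul (A : set mpt) (f : mpt -> R) :
  \int[area]_x (\1_A x * f x) = \int[area]_(x in A) f x.
Proof.
rewrite /Rintegral [in RHS]integral_mkcond -indic_mul_patch //.
Qed.

Lemma sqint_indic_mul (A : set mpt) (f : mpt -> R) : measurable A -> sqint area A f ->
  sqint area setT (fun x => \1_A x * f x).
Proof.
move=> mA [mf f2]; split.
  have mf' : measurable_fun A (EFin \o f) by exact/measurable_EFinP.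
  by apply/measurable_EFinP; rewrite indic_mul_patch; exact/(measurable_restrictT _ mA).
have := integrable_indic_mul mA f2; congr (_.-integrable _ _); apply/funext => x /=.
by rewrite exprMn indicE; case: (_ \in _); rewrite ?expr1n ?expr0n.
Qed.

(** A sum of measurable pieces, hence measurable on the plane, whereas [u] may be arbitrary on the
    sides. *)
Definition piecewise (T : seq (triangle R)) (u : pt -> R) (x : pt) : R :=
  \sum_(t <- T) \1_(open_tri t) x * u x.

Variables (T : seq (triangle R)) (u : pt -> R).
Hypothesis nT : forall t, t \in T -> nondeg t.

Lemma sqint_piecewise : (forall t, t \in T -> L2 (open_tri t) u) -> sqint area setT (piecewise T u).
Proof.
move: nT; rewrite /piecewise; elim: T => [|t T' IH] H Hu.
  under eq_fun do rewrite big_nil.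
  split; first exact: measurable_cst.
  by rewrite (_ : (fun=> _) = cst 0%E); [exact: integrable0|apply/funext => x; rewrite expr0n].
under eq_fun do rewrite big_cons.
have tT : t \in t :: T' by rewrite inE eqxx.
apply: (sqintD measurableT).
  by apply: sqint_indic_mul; [apply: measurable_open_tri; exact: H|exact: Hu].
by apply: IH => t' t'T; [apply: H|apply: Hu]; rewrite inE t'T orbT.
Qed.

Lemma integral_piecewise (psi : pt -> R) :
  (forall t, t \in T -> area.-integrable (open_tri t) (EFin \o (fun x => u x * psi x))) ->
  \int[area]_x (piecewise T u x * psi x) = \sum_(t <- T) \int[area]_(x in open_tri t) (u x * psi x).
Proof.
have mt t : t \in T -> measurable (open_tri t : set mpt) by move=> tT; apply: measurable_open_tri; exact: nT.
move: mt; rewrite /piecewise; elim: T => [|t T' IH] mt Hi.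
  rewrite big_nil; under eq_Rintegral do rewrite big_nil mul0r.
  by rewrite /Rintegral integral0.
suff H : forall s : seq (triangle R), {subset s <= t :: T'} ->
    area.-integrable setT (EFin \o (fun x => (\sum_(t <- s) \1_(open_tri t) x * u x) * psi x)).
  have tT : t \in t :: T' by rewrite inE eqxx.
  have sT : {subset T' <= t :: T'} by move=> x xT; rewrite inE xT orbT.
  rewrite big_cons -IH; [|by move=> t' /sT; exact: mt|by move=> t' /sT; exact: Hi].
  rewrite -(integral_indic_mul (open_tri t) (fun x => u x * psi x)).
  apply: etrans (Rintegral_add measurableT (integrable_indic_mul (mt t tT) (Hi t tT)) (H _ sT)).
  by apply: eq_Rintegral => x _; rewrite big_cons; ring.
elim => [|t' s IHs] sub.
  rewrite (_ : _ \o _ = cst 0%E); first exact: integrable0.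
  by apply/funext => x /=; rewrite big_nil mul0r.
have t'T : t' \in t :: T' by apply: sub; rewrite inE eqxx.
have I1 := integrable_indic_mul (mt t' t'T) (Hi t' t'T).
have I2 := IHs (fun x xs => sub x (mem_behead (s := t' :: s) xs)).
have := integrable_sum_R measurableT I1 I2; congr (_.-integrable _ (_ \o _)).
by apply/funext => x; rewrite big_cons; ring.
Qed.

End Gluing.

(** * Jumps and Green's formula on a triangulation *)

Section Jumps.
Context {R : realType}.
Notation pt := (R * R)%type.
Notation mR := (measurableTypeR R).
Notation mu1 := (@lebesgue_measure R).
Notation I01 := (`[0, 1]%classic : set mR).
Implicit Type t : triangle R.
Notation nondeg := Defs.nondegenerate.

Lemma measurable_reverse (f : mR -> R) : measurable_fun I01 f -> measurable_fun I01 (fun r => f (1 - r)).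
Proof.
move=> mf; apply: (measurable_comp mI01 _ mf); last first.
  by apply: measurable_funTS; apply: measurable_funB; [exact: measurable_cst|exact: measurable_id].
by move=> _ [r /= rI <-]; move: rI; rewrite /= !in_itv /= => /andP[h1 h2]; apply/andP; split; lra.
Qed.

Lemma sqint_reverse (f : mR -> R) : sqint mu1 I01 f -> sqint mu1 I01 (fun r => f (1 - r)).
Proof.
move=> [mf f2]; split; first exact: measurable_reverse.
move/integrableP : f2 => [m2 f2]; apply/integrableP; split.
  by apply/measurable_EFinP; apply: measurable_funX; exact: measurable_reverse.
have mf' : measurable_fun I01 (fun r => `|(f r ^+ 2)%:E|%E) by exact: measurableT_comp m2.
by have := ge0_integral_reverse mf' (fun r _ => abse_ge0 _) => ->.
Qed.

(** The two triangles at an edge may parametrise it in opposite directions, hence the invariance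
    under [r -> 1 - r]. *)
Lemma same_edge_sqint (s s' : side R) (g : pt -> R) : same_edge s s' ->
  sqint mu1 I01 (fun r => g (side_pt s' r)) -> sqint mu1 I01 (fun r => g (side_pt s r)).
Proof.
rewrite same_edge_sym => se g2; case: (boolP (side_src s' == side_src s)) => h.
  rewrite (_ : (fun r => g (side_pt s r)) = (fun r => g (side_pt s' r))) //.
  by apply/funext => r; rewrite (same_edge_side_pt r se) h.
rewrite (_ : (fun r => g (side_pt s r)) = (fun r => g (side_pt s' (1 - r)))); first exact: (sqint_reverse g2).
by apply/funext => r; rewrite (same_edge_side_pt r se) (negbTE h).
Qed.

Lemma same_edge_integral (s s' : side R) (g : pt -> R) : same_edge s s' ->
  measurable_fun I01 (fun r : mR => g (side_pt s' r)) ->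
  \int[mu1]_(r in I01) g (side_pt s r) = \int[mu1]_(r in I01) g (side_pt s' r).
Proof.
rewrite same_edge_sym => se mg; case: (boolP (side_src s' == side_src s)) => h.
  by apply: eq_Rintegral => r _; rewrite (same_edge_side_pt r se) h.
rewrite -(integral_reverse mg).
by apply: eq_Rintegral => r _; rewrite (same_edge_side_pt r se) (negbTE h).
Qed.

(** Both traces are read along the parametrisation of the first side. *)
Definition jump (e : side R * side R) (u : pt -> R) (r : R) : R :=
  trace e.1 u (side_pt e.1 r) - trace e.2 u (side_pt e.1 r).

Variables (Omega : set pt) (T : seq (triangle R)) (u : pt -> R).
Hypotheses (oO : open Omega) (HT : triangulation Omega T) (Hu : H1h T u).

Let nT t : t \in T -> nondeg t. Proof. by case: HT => _ H _ _; exact: H. Qed.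

Lemma sqint_trace s s' : s'.1 \in T -> same_edge s s' -> sqint mu1 I01 (fun r => trace s' u (side_pt s r)).
Proof.
case: s' => t i /= tT se; apply: (@same_edge_sqint _ (t, i) (trace (t, i) u) se).
by apply: sqint_side_trace; [exact: nT|exact: Hu].
Qed.

Lemma same_edge_refl (s : side R) : same_edge s s.
Proof. by rewrite /same_edge !eqxx. Qed.

Lemma sqint_jump e : e \in interior_edges T -> sqint mu1 I01 (jump e u).
Proof.
move=> eT; have [e1T e2T /andP[se _]] := interior_edgesP eT.
by apply: (sqintB mI01); apply: sqint_trace => //; exact: same_edge_refl.
Qed.

(** The weight in the energy cancels the arc length factor, so each edge contributes an integral
    over the unit interval. *)
Lemma jump_energyE : jump_energy T u = \sum_(e <- interior_edges T) \int[mu1]_(r in I01) (jump e u r ^+ 2).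
Proof.
rewrite /jump_energy big_seq [RHS]big_seq; apply: eq_bigr => e eT.
have [e1T _ _] := interior_edgesP eT.
case: e {eT} e1T => -[t i] s' /= tT; rewrite /side_int mulrA mulVf ?mul1r //.
by rewrite gt_eqF // side_len_gt0 //; exact: nT.
Qed.

(** Partners are known for relatively interior points of a side; if an end of the side were in
    [Omega], nearby points of the side would be too. *)
Lemma unpaired_side_outside s r : s.1 \in T -> (forall s', s' \in sides T -> ~~ partner s s') ->
  I01 r -> ~ Omega (side_pt s r).
Proof.
case: s => t i /= tT no; rewrite /= in_itv /= => /andP[r0 r1] Oz.
have cs : continuous (side_pt (t, i) : R -> pt).
  by move=> q; apply: cvgD; [exact: cvg_cst|apply: cvgZr_tmp; exact: cvg_id].
have : nbhs r (side_pt (t, i) @^-1` Omega).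
  by apply: cs; exact: open_nbhs_nbhs.
move=> /nbhs_ballP[e /= e0 eO].
pose h := e / (e + 1); have h0 : 0 < h by rewrite divr_gt0 // addr_gt0.
have h1 : h < 1 by rewrite ltr_pdivrMr ?addr_gt0 // mul1r ltrDl.
have he : h < e by rewrite ltr_pdivrMr ?addr_gt0 //; nra.
(* [r] is pulled slightly towards 1/2, which leaves the ends of the unit interval. *)
pose q := (1 - h) * r + h / 2.
have Oq : Omega (side_pt (t, i) q).
  apply: eO; rewrite -ball_normE /ball_ /= /q.
  have -> : r - ((1 - h) * r + h / 2) = h * (r - 2^-1) by field.
  rewrite normrM gtr0_norm //; apply: le_lt_trans he.
  by rewrite ger_pMr // ler_norml; apply/andP; split; lra.
have [|t' [j [t'T t't se]]] := side_partner_exists oO HT tT _ Oq.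
  by rewrite /q; apply/andP; split; nra.
have /negP[] := no (t', j) ltac:(by rewrite mem_sides).
by rewrite /partner se /= eq_sym.
Qed.

(** Unpaired sides lie outside [Omega], where [phi] vanishes; on the others opposite normal
    coefficients turn the two traces into their difference. *)
Lemma sum_side_integrals (phi : pt -> R) (d : pt) : smooth phi -> (forall x, ~ Omega x -> phi x = 0) ->
  \sum_(t <- T) \sum_i normal_coef (t, i) d * \int[mu1]_(r in I01) (side_trace (t, i) u r * phi (side_pt (t, i) r)) =
  \sum_(e <- interior_edges T) normal_coef e.1 d * \int[mu1]_(r in I01) (jump e u r * phi (side_pt e.1 r)).
Proof.
move=> sphi phi0.
pose a (s : side R) := normal_coef s d * \int[mu1]_(r in I01) (side_trace s u r * phi (side_pt s r)).
have H s : s \in sides T -> (forall s', s' \in sides T -> ~~ partner s s') -> a s = 0.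
  rewrite mem_sides => sT no; rewrite /a (@eq_Rintegral _ _ _ mu1 I01 (cst 0)).
    by rewrite /Rintegral integral0 mulr0.
  by move=> r /set_mem rI; rewrite phi0 ?mulr0 //; exact: unpaired_side_outside.
rewrite (sum_paired_sides HT H) big_seq [RHS]big_seq; apply: eq_bigr => e eT.
have [e1T e2T pe] := interior_edgesP eT; have se : same_edge e.1 e.2 by case/andP: pe.
rewrite /a (partner_normal_coef HT d e1T e2T pe).
have t1 := sqint_trace e1T (same_edge_refl e.1); have t2 := sqint_trace e2T se.
have t2' := sqint_trace e2T (same_edge_refl e.2).
have p1 := smooth_sqint_side e.1 sphi; have p2 := smooth_sqint_side e.2 sphi.
have -> : \int[mu1]_(r in I01) (side_trace e.2 u r * phi (side_pt e.2 r)) =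
   \int[mu1]_(r in I01) (trace e.2 u (side_pt e.1 r) * phi (side_pt e.1 r)).
  apply/esym; apply: (@same_edge_integral e.1 e.2 (fun x => trace e.2 u x * phi x)) => //.
  by apply: measurable_funM; [exact: t2'.1|exact: p2.1].
rewrite mulNr -mulrBr -(Rintegral_sub mI01 (sqint_mul mI01 t1 p1) (sqint_mul mI01 t2 p1)).
by congr (_ * _); apply: eq_Rintegral => r _; rewrite /jump /side_trace; ring.
Qed.

Lemma piecewise_green (phi : pt -> R) (d : pt) : smooth phi -> (forall x, ~ Omega x -> phi x = 0) ->
  \int[area]_x (piecewise T u x * 'D_d phi x) =
  - (\sum_(t <- T) \int[area]_(x in open_tri t)
      ((d.1 * (grad (open_tri t) u).1 x + d.2 * (grad (open_tri t) u).2 x) * phi x)) +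
  \sum_(e <- interior_edges T) normal_coef e.1 d * \int[mu1]_(r in I01) (jump e u r * phi (side_pt e.1 r)).
Proof.
move=> sphi phi0; rewrite (integral_piecewise nT); last first.
  move=> t tT; have nt := nT tT; have [u2 _] := Hu tT.
  apply: (sqint_mul (measurable_open_tri nt) u2).
  by apply: smooth_sqint => //; exact: smooth_derive.
rewrite -(sum_side_integrals d sphi phi0) -sumrN -big_split /=.
rewrite big_seq [RHS]big_seq; apply: eq_bigr => t tT.
by apply: green_H1 => //; [exact: nT|exact: Hu].
Qed.

End Jumps.

(** * The Poincare inequality on a parallelogram *)

Section SquarePoincare.
Context {R : realType}.
Notation pt := (R * R)%type.
Notation mR := (measurableTypeR R).
Notation mpt := (mR * mR)%type.
Notation mu1 := (@lebesgue_measure R).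
Notation J01 := (`]0, 1[%classic : set mR).

Definition open_square : set mpt := J01 `*` J01.

Lemma mJ01 : @measurable _ mR J01.
Proof. exact: measurable_itv. Qed.

Lemma mu1_J01 : mu1 J01 = 1%E.
Proof. by rewrite lebesgue_measure_itv /= lte01 oppr0 addr0. Qed.

Lemma measurable_open_square : measurable open_square.
Proof. by apply: measurableX; exact: mJ01. Qed.

Lemma open_square_sub : open_square `<=` unit_square.
Proof. by move=> x [/= h1 h2]; split => /=; apply: subset_itv_oo_cc. Qed.

Lemma abs_increment_le (F f : R -> R) (x x' : R) : continuous f ->
  (forall s, is_derive s (1 : R) F (f s)) -> J01 x -> J01 x' ->
  ((`|F x - F x'|)%:E <= \int[mu1]_(s in J01) (`|f s|)%:E)%E.
Proof.
move=> cf dF.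
have caf : continuous (fun s => `|f s|).
  by move=> s; apply: cvg_norm; exact: cf.
suff H (y z : R) : y < z -> J01 y -> J01 z -> ((`|F z - F y|)%:E <= \int[mu1]_(s in J01) (`|f s|)%:E)%E.
  move=> Jx Jx'; have [xx'|xx'|->] := ltgtP x x'.
  - by rewrite distrC; exact: H.
  - exact: H.
  - by rewrite subrr normr0; apply: integral_ge0 => s _; rewrite lee_fin.
move=> yz Jy Jz; have m (A : set mR) : measurable_fun A (fun s => (`|f s|)%:E).
  by apply: measurable_funTS; apply/measurable_EFinP; exact: continuous_measurable_line.
have mf (A : set mR) : measurable_fun A (fun s => (f s)%:E).
  by apply: measurable_funTS; apply/measurable_EFinP; exact: continuous_measurable_line.
have -> : (`|F z - F y|)%:E = (`|\int[mu1]_(s in `[y, z]) (f s)%:E|)%E.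
  by rewrite (integral_derive_segment yz cf dF).
apply: (@le_trans _ _ (\int[mu1]_(s in `[y, z]) (`|f s|)%:E)%E).
  by apply: le_trans (le_abse_integral _ _ _) _ => //; exact: measurable_itv.
apply: ge0_subset_integral => //.
move: Jy Jz; rewrite /= !in_itv /= => /andP[y0 y1] /andP[z0 z1].
by move=> s /=; rewrite !in_itv /= => /andP[s0 s1]; apply/andP; split; lra.
Qed.

Lemma patch_open_square (f : mpt -> \bar R) x y :
  (f \_ open_square) (x, y) = if (y \in J01) then ((fun s => f (s, y)) \_ J01) x else 0%E.
Proof.
rewrite !patchE; case: (boolP (y \in J01)) => Jy; case: (boolP (x \in J01)) => Jx.
- by rewrite mem_set //; split; exact: set_mem.
- by rewrite memNset // => -[/= h1 h2]; move/negP: Jx; apply; rewrite inE.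
- by rewrite memNset // => -[/= h1 h2]; move/negP: Jy; apply; rewrite inE.
- by rewrite memNset // => -[/= h1 h2]; move/negP: Jy; apply; rewrite inE.
Qed.

(** [v y] is the total variation of the horizontal slice at height [y], made a real number by the
    boundedness of [f] on the square and set to zero for other heights. *)
Lemma slice_variation (F f : mpt -> R) : continuous (f : pt -> R) ->
  (forall y s : R, is_derive s (1 : R) (fun s => F (s, y)) (f (s, y))) ->
  exists v : mR -> R, [/\ measurable_fun setT v, forall y, 0 <= v y,
    forall y x x', J01 y -> J01 x -> J01 x' -> `|F (x, y) - F (x', y)| <= v y &
    (\int[mu1]_(y in J01) (v y)%:E = (\int[area]_(x in open_square) `|f x|)%:E)%E].
Proof.
move=> cf dF.
have caf : continuous (fun x : pt => `|f x|).
  by move=> s; apply: cvg_norm; exact: cf.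
have [M HM] := continuous_bounded_square cf.
have M0 : 0 <= M.
  apply: le_trans (normr_ge0 (f (0, 0))) (HM (0, 0) _).
  by split; rewrite /= in_itv /= lexx ler01.
pose W := (fun z : mpt => (`|f z|)%:E) \_ open_square.
have mW : measurable_fun setT W.
  apply/(measurable_restrictT _ measurable_open_square); apply: measurable_funTS.
  by apply/measurable_EFinP; exact: (continuous_measurable_plane caf).
have W0 z : (0 <= W z)%E by rewrite /W patchE; case: ifP => // _; rewrite lee_fin.
pose w y : \bar R := (\int[mu1]_x W (x, y))%E.
have wE y : J01 y -> w y = (\int[mu1]_(s in J01) (`|f (s, y)|)%:E)%E.
  move=> Jy; rewrite [RHS]integral_mkcond; apply: eq_integral => x _.
  by rewrite /W patch_open_square mem_set.
have wE0 y : ~ J01 y -> w y = 0%E.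
  move=> Jy; rewrite /w (eq_integral (cst 0%E)) ?integral0 // => x _.
  by rewrite /W patch_open_square memNset.
have mw : measurable_fun setT w.
  by apply: (measurable_fun_fubini_tonelli_G (m1 := mu1)).
have w0 y : (0 <= w y)%E by exact: integral_ge0.
have wfin y : w y \is a fin_num.
  rewrite ge0_fin_numE //; have [Jy|nJy] := pselect (J01 y); last by rewrite wE0.
  rewrite wE //; apply: (@le_lt_trans _ _ (\int[mu1]_(s in J01) M%:E)%E).
    apply: ge0_le_integral => //.
    - apply: measurable_funTS; apply/measurable_EFinP; apply: continuous_measurable_line.
      apply: (@continuous_on_line _ (fun x : pt => `|f x|) (0, y) (1, 0)) => // t.
      by congr (_, _) => /=; rewrite -[_ *: _]/(_ * _); ring.
    move=> s Js; rewrite lee_fin; apply: HM.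
    by apply: open_square_sub; split.
  rewrite integral_cst; last exact: mJ01.
  by rewrite [X in (_ * X)%E]mu1_J01 mule1 ltry.
exists (fun y => fine (w y)); split.
- apply/measurable_EFinP; rewrite (_ : EFin \o _ = w) //.
  by apply/funext => y /=; rewrite fineK.
- by move=> y; apply: fine_ge0.
- move=> y x x' Jy Jx Jx'; rewrite -lee_fin fineK // wE //.
  have := @abs_increment_le (fun s => F (s, y)) (fun s => f (s, y)) x x'; apply => //.
  apply: (@continuous_on_line _ (f : pt -> R) (0, y) (1, 0)) => // t.
  by congr (_, _) => /=; rewrite -[_ *: _]/(_ * _); ring.
rewrite (eq_integral w); last by move=> y _; rewrite fineK.
have sq := sqint_continuous_square measurable_open_square open_square_sub caf.
have fS : (area open_square < +oo)%E.
  apply: (@le_lt_trans _ _ (area unit_square)); last by rewrite unit_square_area ltry.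
  apply: le_measure; rewrite ?inE; [exact: measurable_open_square|exact: (measurableX mI01 mI01)|exact: open_square_sub].
have fi := integrable_fin_num measurable_open_square (sqint_integrable measurable_open_square fS sq).
rewrite /Rintegral fineK // [RHS]integral_mkcond -/W (tonelli_area2 mW W0) [LHS]integral_mkcond.
apply: eq_integral => y _; rewrite patchE; case: ifPn => // /negP yJ.
by rewrite -/(w y) wE0 // => Jy; apply: yJ; rewrite inE.
Qed.

Lemma exists_below_mean (v : mR -> R) (A e : R) : measurable_fun setT v -> (forall y, 0 <= v y) ->
  (\int[mu1]_(y in J01) (v y)%:E = A%:E)%E -> 0 < e -> exists2 y, J01 y & v y <= A + e.
Proof.
move=> mv v0 vA e0; apply: contrapT => H.
have : ((A + e)%:E <= A%:E)%E.
  rewrite -vA; apply: (@le_trans _ _ (\int[mu1]_(y in J01) (A + e)%:E)%E).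
    by rewrite integral_cst; [rewrite [X in (_ * X)%E]mu1_J01 mule1|exact: mJ01].
  have A0 : 0 <= A by rewrite -lee_fin -vA; apply: integral_ge0 => y _; rewrite lee_fin.
  apply: ge0_le_integral => //.
  - by move=> y _; rewrite lee_fin addr_ge0 // ltW.
  - by apply: measurable_funTS; apply/measurable_EFinP.
  move=> y Jy; rewrite lee_fin leNgt; apply/negP => lt; apply: H; exists y => //; exact: ltW.
by rewrite lee_fin gerDl leNgt e0.
Qed.

Lemma integral_swap (W : mpt -> \bar R) : measurable_fun setT W -> (forall z, 0 <= W z)%E ->
  (\int[area]_z W (z.2, z.1) = \int[area]_z W z)%E.
Proof.
move=> mW W0; have mW' : measurable_fun setT (fun z : mpt => W (z.2, z.1)).
  by apply: (measurableT_comp mW); exact: measurable_swap.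
by rewrite (tonelli_area mW') // (tonelli_area2 mW).
Qed.

(* Take [c = F (x', y')] on a horizontal and a vertical line of small variation.
   Reaching it from [(x, y)] horizontally first bounds [|F (x, y) - c|] by a function
   of [y] alone, vertically first by a function of [x] alone; the integral of the
   product of the two bounds is a product of one-dimensional integrals. *)
Theorem square_poincare (F f1 f2 : mpt -> R) (e : R) : continuous (F : pt -> R) ->
  continuous (f1 : pt -> R) -> continuous (f2 : pt -> R) ->
  (forall y s : R, is_derive s (1 : R) (fun s => F (s, y)) (f1 (s, y))) ->
  (forall x s : R, is_derive s (1 : R) (fun s => F (x, s)) (f2 (x, s))) -> 0 < e ->
  exists c, \int[area]_(x in open_square) ((F x - c) ^+ 2) <=
    (\int[area]_(x in open_square) `|f1 x| + \int[area]_(x in open_square) `|f2 x| + e) ^+ 2.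
Proof.
move=> cF c1 c2 d1 d2 e0.
have csw : continuous (fun z : pt => (z.2, z.1) : pt).
  move=> z; have : lin 0 (0, 1) (1, 0) = (fun z : pt => (z.2, z.1) : pt).
    by apply/funext => -[x y]; rewrite /lin; congr (_, _) => /=; rewrite -?[_ *: _]/(_ * _); ring.
  by move=> <-; exact: continuous_lin.
have [v1 [m1 p1 b1 i1]] := slice_variation c1 d1.
have c2' : continuous ((fun z : mpt => f2 (z.2, z.1)) : pt -> R).
  by move=> z; apply: (continuous_comp (csw z)); exact: c2.
(* Vertical slices are the horizontal slices of the transposed function. *)
have [v2 [m2 p2 b2 i2]] := @slice_variation (fun z => F (z.2, z.1)) _ c2' d2.
set A := \int[area]_(x in open_square) `|f1 x| in i1 *.
have EB : \int[area]_(x in open_square) `|f2 (x.2, x.1)| = \int[area]_(x in open_square) `|f2 x|.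
  rewrite /Rintegral; congr fine; rewrite [LHS]integral_mkcond [RHS]integral_mkcond.
  rewrite -(@integral_swap ((fun x => (`|f2 x|)%:E) \_ open_square)).
  - apply: eq_integral => -[x y] _; rewrite !patchE /=.
    have -> : ((y, x) \in open_square) = ((x, y) \in open_square); last by [].
    by apply/idP/idP; rewrite !inE => -[].
  - apply/(measurable_restrictT _ measurable_open_square); apply: measurable_funTS.
    apply/measurable_EFinP; apply: measurableT_comp => //; exact: (continuous_measurable_plane c2).
  - by move=> z; rewrite patchE; case: ifP => // _; rewrite lee_fin.
rewrite EB in i2; set B := \int[area]_(x in open_square) `|f2 x| in i2 *.
have A0 : 0 <= A by apply: Rintegral_ge0.
have B0 : 0 <= B by apply: Rintegral_ge0.
have [y' Jy' hy'] := exists_below_mean m1 p1 i1 e0.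
have [x' Jx' hx'] := exists_below_mean m2 p2 i2 e0.
pose c := F (x', y'); exists c.
have bound x y : J01 x -> J01 y -> (F (x, y) - c) ^+ 2 <= (v1 y + (B + e)) * (v2 x + (A + e)).
  move=> Jx Jy.
  have h1 : `|F (x, y) - c| <= v1 y + (B + e).
    apply: le_trans (ler_distD (F (x', y)) _ _) _; apply: lerD; first exact: b1.
    by apply: le_trans (b2 x' y y' Jx' Jy Jy') hx'.
  have h2 : `|F (x, y) - c| <= v2 x + (A + e).
    apply: le_trans (ler_distD (F (x, y')) _ _) _; apply: lerD; first exact: (b2 x y y' Jx Jy Jy').
    by apply: le_trans (b1 y' x x' Jy' Jx Jx') hy'.
  by rewrite -real_normK ?num_real // expr2; apply: ler_pM.
pose p := (fun y : mR => (v1 y + (B + e))%:E) \_ J01.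
pose q := (fun x : mR => (v2 x + (A + e))%:E) \_ J01.
have mp : measurable_fun setT p.
  apply/(measurable_restrictT _ mJ01); apply: measurable_funTS; apply/measurable_EFinP.
  by apply: measurable_funD.
have mq : measurable_fun setT q.
  apply/(measurable_restrictT _ mJ01); apply: measurable_funTS; apply/measurable_EFinP.
  by apply: measurable_funD.
have pp y : (0 <= p y)%E.
  by rewrite /p patchE; case: ifP => // _; rewrite lee_fin !addr_ge0 // ltW.
have qq x : (0 <= q x)%E.
  by rewrite /q patchE; case: ifP => // _; rewrite lee_fin !addr_ge0 // ltW.
have ip : (\int[mu1]_y p y = (A + B + e)%:E)%E.
  rewrite -integral_mkcond; under eq_integral do rewrite EFinD.
  rewrite ge0_integralD //; first last.
  - by move=> y _; rewrite lee_fin addr_ge0 // ltW.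
  - by apply: measurable_funTS; apply/measurable_EFinP.
  - by move=> y _; rewrite lee_fin.
  rewrite i1 integral_cst; last exact: mJ01.
  by rewrite [X in (_ + _ * X)%E]mu1_J01 mule1 -EFinD addrA.
have iq : (\int[mu1]_x q x = (A + B + e)%:E)%E.
  rewrite -integral_mkcond; under eq_integral do rewrite EFinD.
  rewrite ge0_integralD //; first last.
  - by move=> y _; rewrite lee_fin addr_ge0 // ltW.
  - by apply: measurable_funTS; apply/measurable_EFinP.
  - by move=> y _; rewrite lee_fin.
  rewrite i2 integral_cst; last exact: mJ01.
  by rewrite [X in (_ + _ * X)%E]mu1_J01 mule1 -EFinD; congr EFin; ring.
have mpq : measurable_fun setT (fun z : mpt => (q z.1 * p z.2)%E).
  apply: emeasurable_funM; first exact: (measurableT_comp mq measurable_fst).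
  exact: (measurableT_comp mp measurable_snd).
have cFc : continuous (fun x : pt => F x - c) by move=> x; apply: cvgB; [exact: cF|exact: cvg_cst].
have sq := sqint_continuous_square measurable_open_square open_square_sub cFc.
rewrite -lee_fin -(integral_sqintE measurable_open_square sq) [leLHS]integral_mkcond.
apply: (@le_trans _ _ (\int[area]_z (q z.1 * p z.2))%E).
  apply: ge0_le_integral => //.
  - by move=> z _; rewrite patchE; case: ifP => // _; rewrite lee_fin sqr_ge0.
  - apply/(measurable_restrictT _ measurable_open_square); apply/measurable_EFinP.
    by apply: measurable_funX; exact: sq.1.
  move=> -[x y] _; rewrite patchE; case: ifPn => [/set_mem [/= Jx Jy]|_]; last by rewrite mule_ge0.
  by rewrite /q /p !patchE !mem_set // -EFinM lee_fin mulrC bound.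
rewrite (tonelli_area mpq); last by move=> z; rewrite mule_ge0.
have E x : (\int[mu1]_y (q (x, y).1 * p (x, y).2) = (A + B + e)%:E * q x)%E.
  by rewrite /= ge0_integralZl // ip muleC.
under eq_integral do rewrite E.
rewrite ge0_integralZl // ?iq -?EFinM -?expr2 //.
by rewrite lee_fin !addr_ge0 // ltW.
Qed.

End SquarePoincare.

(** * Affine transport to parallelograms *)

Section Parallelogram.
Context {R : realType}.
Notation pt := (R * R)%type.
Notation mR := (measurableTypeR R).
Notation mpt := (mR * mR)%type.

Definition para (o a b : pt) : set mpt :=
  [set x | exists s r : R, [/\ 0 < s < 1, 0 < r < 1 & x = o + s *: a + r *: b]].

Lemma lin_para o a b : cross a b != 0 -> lin o a b @^-1` para o a b = open_square.
Proof.
move=> ab; apply/seteqP; split => x /=.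
  move=> [s [r [h1 h2 E]]]; have -> : x = (s, r) by apply: (lin_inj (o := o) ab).
  by split; rewrite /= in_itv.
by case; rewrite /= !in_itv /= => h1 h2; exists x.1, x.2.
Qed.

Lemma paraP o a b x : cross a b != 0 ->
  para o a b x <-> 0 < cross (x - o) b / cross a b < 1 /\ 0 < cross (x - o) a / cross b a < 1.
Proof.
move=> ab; have E : cross a (x - o) / cross a b = cross (x - o) a / cross b a.
  have -> : cross b a = - cross a b by rewrite /cross; ring.
  by rewrite invrN mulrN -mulNr; congr (_ / _); rewrite /cross; ring.
rewrite -E; split; last first.
  by move=> [h1 h2]; exists (cross (x - o) b / cross a b), (cross a (x - o) / cross a b); rewrite -[RHS]/(lin o a b (_, _)) lin_coords.
move=> [s [r [h1 h2 ->]]]; rewrite -[X in X - o]/(lin o a b (s, r)).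
by rewrite cross_coord1 cross_coord2 !mulfK.
Qed.

Lemma continuous_coord o a b : continuous (fun x : pt => cross (x - o) b / cross a b).
Proof. by apply: differentiable_continuous_plane => x; apply: smooth_differentiable; exact: smooth_coord1. Qed.

Lemma open_para o a b : cross a b != 0 -> open (para o a b : set pt).
Proof.
move=> ab; pose i1 (x : pt) := cross (x - o) b / cross a b; pose i2 (x : pt) := cross (x - o) a / cross b a.
have -> : (para o a b : set pt) = (i1 @^-1` [set t : R | 0 < t] `&` i1 @^-1` [set t : R | t < 1]) `&`
   (i2 @^-1` [set t : R | 0 < t] `&` i2 @^-1` [set t : R | t < 1]).
  apply/seteqP; split => x.
    by move/(paraP _ _ ab) => [/andP[h1 h2] /andP[h3 h4]].
  by move=> [[h1 h2] [h3 h4]]; apply/(paraP _ _ ab); split; apply/andP.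
apply: openI; apply: openI; apply: open_comp => [x _|]; try exact: open_gt; try exact: open_lt;
  exact: continuous_coord.
Qed.

Lemma para_convex o a b (x z : pt) (e : R) : cross a b != 0 -> 0 < e < 1 ->
  para o a b x -> para o a b z -> para o a b ((1 - e) *: x + e *: z).
Proof.
move=> ab /andP[e0 e1] [s [r [/andP[s0 s1] /andP[r0 r1] ->]]] [s' [r' [/andP[s0' s1'] /andP[r0' r1'] ->]]].
exists ((1 - e) * s + e * s'), ((1 - e) * r + e * r'); split; try by (apply/andP; split; nra).
case: o a b {ab} => o1 o2 [a1 a2] [b1 b2]; congr (_, _) => /=; rewrite -?[_ *: _]/(_ * _); ring.
Qed.

Lemma area_open_square_fin : (area (@open_square R) < +oo)%E.
Proof.
apply: (@le_lt_trans _ _ (area unit_square)); last by rewrite unit_square_area ltry.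
apply: le_measure; rewrite ?inE; [exact: measurable_open_square|exact: (measurableX mI01 mI01)|exact: open_square_sub].
Qed.

Lemma para_fin o a b : cross a b != 0 -> (area (para o a b) < +oo)%E.
Proof.
move=> ab; have mT := open_measurable_plane (open_para (o := o) ab).
have := @ge0_integral_lin_on _ o a b _ (cst 1%E) ab mT (measurable_cst _) (fun _ _ => lee01).
rewrite lin_para // -[X in (_ = _ * X)%E]/(\int[area]_(x in open_square) cst 1 x)%E integral_cst //.
rewrite integral_cst ?mul1e //; last exact: measurable_open_square.
by move=> ->; rewrite lte_mul_pinfty // area_open_square_fin.
Qed.

Lemma para_center o a b : para o a b (o + 2^-1 *: a + 2^-1 *: b).
Proof. by exists 2^-1, 2^-1; split => //; apply/andP; split; lra. Qed.

Lemma sqint_continuous_para o a b (f : pt -> R) : cross a b != 0 -> continuous f ->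
  sqint area (para o a b) f.
Proof.
move=> ab cf; have mT := open_measurable_plane (open_para (o := o) ab).
have [M HM] := continuous_bounded_square (f := f \o lin o a b)
  (fun x => continuous_comp (@continuous_lin _ o a b x) (cf _)).
apply: (@sqint_bounded _ _ _ area _ mT M) => //; first exact: para_fin.
  by apply: measurable_funTS; exact: continuous_measurable_plane.
move=> _ [s [r [/andP[s0 s1] /andP[r0 r1] ->]]]; have := HM (s, r); apply.
by split; rewrite /= in_itv /=; apply/andP; split; exact: ltW.
Qed.

(** Under [lin o a b] the partial derivatives become derivatives along [a] and [b]; each integral
    carries the Jacobian once, which explains the inverse factors inside the square. *)
Lemma para_poincare_smooth o a b (w : pt -> R) (e : R) : cross a b != 0 -> smooth w -> 0 < e ->
  exists c, \int[area]_(x in para o a b) ((w x - c) ^+ 2) <= `|cross a b| *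
    (`|cross a b|^-1 * \int[area]_(x in para o a b) `|'D_a w x| +
     `|cross a b|^-1 * \int[area]_(x in para o a b) `|'D_b w x| + e) ^+ 2.
Proof.
move=> ab sw e0; have mT := open_measurable_plane (open_para (o := o) ab).
have cw := smooth_continuous sw; have cD v := continuous_smooth_derive (v := v) sw.
have d0 : 0 < `|cross a b| by rewrite normr_gt0.
have cl (f : pt -> R) : continuous f -> continuous ((f \o lin o a b) : pt -> R).
  by move=> cf x; apply: continuous_comp; [exact: continuous_lin|exact: cf].
have d1 (y s : R) : is_derive s (1 : R) (fun s => (w \o lin o a b) (s, y)) (('D_a w \o lin o a b) (s, y)).
  have := line_derive (o + y *: b) a s (fun z => smooth_differentiable z sw).
  rewrite /lin /= (addrAC o) => H.
  by rewrite (_ : (fun s => _) = (fun s : R => w (o + y *: b + s *: a))) //; apply/funext => z; rewrite addrAC.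
have d2 (x s : R) : is_derive s (1 : R) (fun s => (w \o lin o a b) (x, s)) (('D_b w \o lin o a b) (x, s)).
  exact: (line_derive (o + x *: a) b s (fun z => smooth_differentiable z sw)).
have [c Hc] := square_poincare (cl _ cw) (cl _ (cD a)) (cl _ (cD b)) d1 d2 e0.
have I (f : pt -> R) : continuous f ->
    \int[area]_(x in para o a b) f x = `|cross a b| * \int[area]_(x in open_square) f (lin o a b x).
  move=> cf; have fi := sqint_integrable mT (para_fin o ab) (sqint_continuous_para o ab cf).
  by have [_ ->] := integral_lin_on o ab mT fi; rewrite lin_para.
exists c; rewrite !I.
- have aux (d X A B : R) : 0 < d -> X <= (A + B + e) ^+ 2 -> d * X <= d * (d^-1 * (d * A) + d^-1 * (d * B) + e) ^+ 2.
    by move=> dd h; rewrite !mulKf ?gt_eqF // ler_pM2l.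
  by apply: aux d0 _.
- by move=> x; apply: cvg_norm; exact: cD.
- by move=> x; apply: cvg_norm; exact: cD.
- rewrite (_ : (fun x => (w x - c) ^+ 2) = (fun x => (w x - c) * (w x - c))); last by apply/funext => x; rewrite expr2.
  by move=> x; apply: cvgM; apply: cvgB; try exact: cvg_cst; exact: cw.
Qed.

End Parallelogram.

(** * Total variation of mollified piecewise functions *)

Section Variation.
Context {R : realType}.
Notation pt := (R * R)%type.
Notation mR := (measurableTypeR R).
Notation mpt := (mR * mR)%type.
Notation mu1 := (@lebesgue_measure R).
Notation I01 := (`[0, 1]%classic : set mR).

Definition dir_grad (t : triangle R) (u : pt -> R) (v : pt) (x : pt) : R :=
  v.1 * (grad (open_tri t) u).1 x + v.2 * (grad (open_tri t) u).2 x.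

(** The factor of each jump integral dominates [normal_coef]; the length restores arc length from
    the unit parameter interval. *)
Definition broken_variation (T : seq (triangle R)) (u : pt -> R) (v : pt) : R :=
  \sum_(t <- T) \int[area]_(x in open_tri t) `|dir_grad t u v x| +
  \sum_(e <- interior_edges T) (`|v.1| + `|v.2|) * side_len e.1 * \int[mu1]_(r in I01) `|jump e u r|.

Lemma integral_sum_in d (X : measurableType d) (mu : {measure set X -> \bar R}) (I : eqType) (s : seq I) (F : I -> X -> \bar R) :
  (forall i, i \in s -> measurable_fun setT (F i)) -> (forall i, i \in s -> forall x, (0 <= F i x)%E) ->
  [/\ measurable_fun setT (fun x => \sum_(i <- s) F i x)%E, (forall x, 0 <= \sum_(i <- s) F i x)%E &
  (\int[mu]_x (\sum_(i <- s) F i x) = \sum_(i <- s) \int[mu]_x F i x)%E].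
Proof.
elim: s => [|i s IH] mF F0.
  split; [|by move=> x; rewrite big_nil|rewrite big_nil].
    by under eq_fun do rewrite big_nil; exact: measurable_cst.
  by under eq_integral do rewrite big_nil; rewrite integral0.
have iS : i \in i :: s by rewrite inE eqxx.
have sub j : j \in s -> j \in i :: s by move=> js; rewrite inE js orbT.
have [m1 p1 E1] := IH (fun j js => mF j (sub j js)) (fun j js => F0 j (sub j js)).
split.
- by under eq_fun do rewrite big_cons; apply: emeasurable_funD => //; exact: mF.
- by move=> x; rewrite big_cons adde_ge0 // F0.
rewrite big_cons -E1 -ge0_integralD //; try exact: mF.
- by apply: eq_integral => x _; rewrite big_cons.
- by move=> x _; exact: F0.
Qed.

Lemma cross_le_norm (p v : pt) : `|cross p v| <= Num.sqrt (p.1 ^+ 2 + p.2 ^+ 2) * (`|v.1| + `|v.2|).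
Proof.
have k (x y : R) : `|x| <= Num.sqrt (x ^+ 2 + y ^+ 2).
  by rewrite -sqrtr_sqr ler_wsqrtr // lerDl sqr_ge0.
have k1 := k p.1 p.2; have k2 := k p.2 p.1; rewrite addrC in k2.
rewrite /cross; apply: le_trans (ler_normB _ _) _; rewrite !normrM mulrDr addrC.
by apply: lerD; apply: ler_wpM2r.
Qed.

Lemma normal_coef_le (s : side R) (v : pt) : `|normal_coef s v| <= side_len s * (`|v.1| + `|v.2|).
Proof.
rewrite /normal_coef normrM normrN; apply: (@le_trans _ _ (1 * `|cross (side_tgt s - side_src s) v|)).
  by apply: ler_wpM2r => //; rewrite normr_sg lern1 leq_b1.
rewrite mul1r; apply: le_trans (cross_le_norm _ _) _; apply: ler_wpM2r; first by rewrite addr_ge0.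
rewrite /side_len /Defs.edist le_eqVlt; apply/orP; left; apply/eqP; congr (Num.sqrt _).
by rewrite /=; ring.
Qed.

Variables (Omega : set pt) (T : seq (triangle R)) (u : pt -> R).
Hypotheses (oO : open Omega) (HT : triangulation Omega T) (Hu : H1h T u).
Variables (o a b : pt) (rad : R).
Hypotheses (ab : cross a b != 0) (QO : para o a b `<=` Omega) (rad0 : 0 < rad).
Notation z0 := (o + 2^-1 *: a + 2^-1 *: b).
Notation Q := (para o a b).
Hypothesis ballQ : forall z : pt, `|z - z0| <= rad -> Q z.

Let nT t : t \in T -> Defs.nondegenerate t. Proof. by case: HT => _ H _ _; exact: H. Qed.
Let mQ : measurable Q. Proof. exact: (open_measurable_plane (open_para (o := o) ab)). Qed.
Let fQ : (area Q < +oo)%E. Proof. exact: para_fin. Qed.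
Let convQ (x z : pt) (e : R) : 0 < e < 1 -> Q x -> Q z -> Q ((1 - e) *: x + e *: z).
Proof. exact: para_convex. Qed.

Lemma sqint_piecewise_on (A : set mpt) : measurable A -> sqint area A (piecewise T u).
Proof.
move=> mA; have [m2 i2] := sqint_piecewise nT (fun t tT => (Hu tT).1).
split; first exact: measurable_funTS.
exact: (integrableS measurableT mA (@subsetT _ A) i2).
Qed.

Lemma sqint_dir_grad t v : t \in T -> sqint area (open_tri t) (dir_grad t u v).
Proof.
move=> tT; have mt := measurable_open_tri (nT tT); have [g1 g2 _ _] := gradP (Hu tT).
by apply: (sqintD mt); apply: (sqintZ mt).
Qed.

(** The kernel around [mcen z0 n x] is taken as test function in Green's formula: it vanishes off
    the parallelogram, hence off [Omega]. Being nonnegative, it can stay outside the moduli. *)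
Lemma moll_derive_abs_le (n : nat) (v x : pt) (phi : pt -> R) : Q x ->
  phi = cutoff (meps n * rad) (mcen z0 n x) ->
  `|'D_v (moll Q z0 rad n (piecewise T u)) x| <=
  \sum_(t <- T) \int[area]_(y in open_tri t) (`|dir_grad t u v y| * phi y) +
  \sum_(e <- interior_edges T) (`|v.1| + `|v.2|) * side_len e.1 * \int[mu1]_(r in I01) (`|jump e u r| * phi (side_pt e.1 r)).
Proof.
move=> Qx phiE; have gi := sqint_integrable mQ fQ (sqint_piecewise_on mQ).
have sphi : smooth phi by rewrite phiE; exact: smooth_cutoff.
have phiQ y : ~ Q y -> phi y = 0.
  move=> nQ; apply/eqP; apply: contrapT => /negP h; apply: nQ.
  by rewrite phiE in h; exact: (cutoff_in rad0 convQ ballQ Qx h).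
have [_ _ sup] := moll_test rad0 convQ ballQ n Qx; rewrite -phiE in sup.
have dphiQ y : ~ Q y -> 'D_v phi y = 0.
  by move=> nQ; apply: derive_eq0_off_support => /sup.
rewrite moll_derive // -phiE.
have -> : \int[area]_(y in Q) (piecewise T u y * 'D_v phi y) = \int[area]_y (piecewise T u y * 'D_v phi y).
  rewrite /Rintegral [in LHS]integral_mkcond; congr fine; apply: eq_integral => y _.
  rewrite patchE; case: ifPn => // /negP yQ; rewrite dphiQ ?mulr0 // => Qy.
  by apply: yQ; rewrite inE.
rewrite (piecewise_green oO HT Hu v sphi); last by move=> y nO; apply: phiQ => /QO.
rewrite normrM normrN [`|1 - _|]ger0_norm; last by rewrite ltW // mscale_gt0.
apply: (@le_trans _ _ (1 * (\sum_(t <- T) \int[area]_(y in open_tri t) (`|dir_grad t u v y| * phi y) +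
  \sum_(e <- interior_edges T) (`|v.1| + `|v.2|) * side_len e.1 * \int[mu1]_(r in I01) (`|jump e u r| * phi (side_pt e.1 r)))));
  last by rewrite mul1r.
apply: ler_pM => //; first by rewrite ltW // mscale_gt0.
  by have /andP[e0 _] := @meps_itv R n; rewrite lerBlDr lerDl ltW.
apply: le_trans (ler_normD _ _) _; rewrite normrN; apply: lerD.
  apply: le_trans (ler_norm_sum _ _ _) _; rewrite big_seq [leRHS]big_seq; apply: ler_sum => t tT.
  have mt := measurable_open_tri (nT tT).
  have p2 := smooth_sqint (nT tT) sphi; have g2 := sqint_dir_grad v tT.
  have i1 := sqint_mul mt g2 p2; have i2 := integrable_abs_R i1.
  apply: le_trans (abs_Rintegral_le mt i1 i2 _) _; first by [].
  rewrite le_eqVlt; apply/orP; left; apply/eqP; apply: eq_Rintegral => y _.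
  by rewrite normrM [`|phi y|]ger0_norm // phiE cutoff_ge0.
apply: le_trans (ler_norm_sum _ _ _) _; rewrite big_seq [leRHS]big_seq; apply: ler_sum => e eT.
have j2 := sqint_jump HT Hu eT; have p2 := smooth_sqint_side e.1 sphi.
have i1 := sqint_mul mI01 j2 p2; have i2 := integrable_abs_R i1.
rewrite normrM; apply: ler_pM => //; first by rewrite mulrC normal_coef_le.
apply: le_trans (abs_Rintegral_le mI01 i1 i2 _) _; first by [].
rewrite le_eqVlt; apply/orP; left; apply/eqP; apply: eq_Rintegral => y _.
by rewrite normrM [`|phi _|]ger0_norm // phiE cutoff_ge0.
Qed.

Lemma measurable_integral_cutoff (n : nat) (g : mpt -> \bar R) : measurable_fun setT g -> (forall y, 0 <= g y)%E ->
  measurable_fun setT (fun x : mpt => \int[area]_y (g y * (cutoff (meps n * rad) (mcen z0 n x) y)%:E))%E.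
Proof.
move=> mg g0; apply: (@measurable_area_partial _ _ _ (fun z : mpt * mpt => g z.1 * (cutoff (meps n * rad) (mcen z0 n z.2) z.1)%:E)%E).
  apply: emeasurable_funM; first exact: measurableT_comp mg measurable_fst.
  apply/measurable_EFinP.
  have := measurable_cutoff2 (meps n * rad) (1 - meps n) (meps n *: z0) (@measurable_id _ mpt setT).
  by move=> /measurableT_comp/(_ (@measurable_swap _ _ mpt mpt)); exact.
by move=> z; rewrite mule_ge0 // lee_fin cutoff_ge0.
Qed.

Lemma measurable_integral_cutoff_line (n : nat) (gam : mR -> mpt) (g : mR -> \bar R) : measurable_fun setT gam ->
  measurable_fun setT g -> (forall y, 0 <= g y)%E ->
  measurable_fun setT (fun x : mpt => \int[mu1]_y (g y * (cutoff (meps n * rad) (mcen z0 n x) (gam y))%:E))%E.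
Proof.
move=> mgam mg g0.
apply: (@measurable_fun_fubini_tonelli_F _ _ _ _ _ mu1 (fun z : mpt * mR => g z.2 * (cutoff (meps n * rad) (mcen z0 n z.1) (gam z.2))%:E)%E).
  apply: emeasurable_funM; first exact: measurableT_comp mg measurable_snd.
  by apply/measurable_EFinP; exact: measurable_cutoff2.
by move=> z; rewrite mule_ge0 // lee_fin cutoff_ge0.
Qed.

Lemma patch_integral d (X : measurableType d) (mu : {measure set X -> \bar R}) (A : set X) (f h : X -> R) :
  measurable A -> mu.-integrable A (EFin \o (fun y => f y * h y)) ->
  (\int[mu]_(y in A) (f y * h y))%:E = (\int[mu]_y (((EFin \o f) \_ A) y * (h y)%:E))%E.
Proof.
move=> mA fh; rewrite /Rintegral fineK; last exact: integrable_fin_num.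
rewrite integral_mkcond; apply: eq_integral => y _; rewrite !patchE; case: ifP => _ //.
by rewrite mul0e.
Qed.

(** Integration over the centre of the kernel gives every area and edge term the same factor
    [(1 - meps n) ^- 2], at most 4 for every [n]. *)
Lemma integral_moll_derive_le (n : nat) (v : pt) :
  \int[area]_(x in Q) `|'D_v (moll Q z0 rad n (piecewise T u)) x| <= 4 * broken_variation T u v.
Proof.
pose gt t := (EFin \o (fun y => `|dir_grad t u v y|)) \_ (open_tri t : set mpt).
pose ge (e : side R * side R) := (EFin \o (fun r => `|jump e u r|)) \_ I01.
pose At t (x : mpt) := (\int[area]_y (gt t y * (cutoff (meps n * rad) (mcen z0 n x) y)%:E))%E.
pose M (e : side R * side R) := (`|v.1| + `|v.2|) * side_len e.1.
pose Be e (x : mpt) := ((M e)%:E * \int[mu1]_r (ge e r * (cutoff (meps n * rad) (mcen z0 n x) (side_pt e.1 r))%:E))%E.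
have M0 e : 0 <= M e by rewrite mulr_ge0 ?addr_ge0 // sqrtr_ge0.
have mgt t : t \in T -> measurable_fun setT (gt t).
  move=> tT; apply/(measurable_restrictT _ (measurable_open_tri (nT tT))); apply/measurable_EFinP.
  by apply: measurableT_comp => //; exact: (sqint_dir_grad v tT).1.
have gt0 t y : (0 <= gt t y)%E by rewrite /gt patchE; case: ifP => // _; rewrite lee_fin.
have mge e : e \in interior_edges T -> measurable_fun setT (ge e).
  move=> eT; apply/(measurable_restrictT _ mI01); apply/measurable_EFinP.
  by apply: measurableT_comp => //; exact: (sqint_jump HT Hu eT).1.
have ge0 e y : (0 <= ge e y)%E by rewrite /ge patchE; case: ifP => // _; rewrite lee_fin.
have mgam (s : side R) : measurable_fun setT (side_pt s : mR -> mpt).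
  rewrite (_ : side_pt s = (fun r => lin (side_src s) (side_tgt s - side_src s) 0 (r, 0))); last first.
    by apply/funext => r; rewrite /lin /side_pt /= scaler0 addr0.
  apply: (measurableT_comp (measurable_lin _ _ _)).
  by apply/measurable_fun_pairP; split; [exact: measurable_id|exact: measurable_cst].
have k0 := @mscale_gt0 R n; have s0 := mrad_gt0 rad0 n.
have k4 : (1 - meps n) ^- 2 <= 4 :> R.
  rewrite -[leRHS]invrK lef_pV2 ?posrE ?exprn_gt0 //.
  have := @meps_le R n; nra.
have At0 t x : (0 <= At t x)%E by apply: integral_ge0 => y _; rewrite mule_ge0 // lee_fin cutoff_ge0.
have Be0 e x : (0 <= Be e x)%E.
  by rewrite /Be mule_ge0 ?lee_fin //; apply: integral_ge0 => y _; rewrite mule_ge0 // lee_fin cutoff_ge0.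
have mAt t : t \in T -> measurable_fun setT (At t) by move=> tT; apply: measurable_integral_cutoff => //; exact: mgt.
have mBe e : e \in interior_edges T -> measurable_fun setT (Be e).
  by move=> eT; apply: measurable_funeM; apply: measurable_integral_cutoff_line => //; exact: mge.
have [mA A0 EA] := integral_sum_in area mAt (fun t _ => At0 t).
have [mB B0 EB] := integral_sum_in area mBe (fun e _ => Be0 e).
have sw : smooth (moll Q z0 rad n (piecewise T u)).
  by apply: moll_smooth => //; exact: (sqint_integrable mQ fQ (sqint_piecewise_on mQ)).
have cD := continuous_smooth_derive (v := v) sw.
have iD := sqint_integrable mQ fQ (sqint_continuous_para o ab cD).
rewrite -lee_fin /Rintegral fineK; last by apply: integrable_fin_num => //; exact: integrable_abs_R.
apply: (@le_trans _ _ (\int[area]_x (\sum_(t <- T) At t x + \sum_(e <- interior_edges T) Be e x))%E).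
  rewrite [leLHS]integral_mkcond; apply: ge0_le_integral => //.
  - by move=> x _; rewrite patchE; case: ifP => // _; rewrite lee_fin.
  - apply/(measurable_restrictT _ mQ); apply: measurable_funTS; apply/measurable_EFinP.
    by apply: measurableT_comp => //; exact: (continuous_measurable_plane cD).
  - exact: emeasurable_funD.
  move=> x _; rewrite patchE; case: ifPn => [/set_mem Qx|_]; last exact: adde_ge0.
  have := @moll_derive_abs_le n v x _ Qx erefl; rewrite -lee_fin => /le_trans; apply.
  rewrite EFinD -!sumEFin le_eqVlt; apply/orP; left; apply/eqP.
  have sphi : smooth (cutoff (meps n * rad) (mcen z0 n x)) by exact: smooth_cutoff.
  congr (_ + _)%E; rewrite big_seq [RHS]big_seq; apply: eq_bigr => i iT.
    have mt := measurable_open_tri (nT iT).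
    rewrite (patch_integral mt) //.
    apply: (sqint_mul mt); last exact: smooth_sqint (nT iT) sphi.
    have [m2 g2] := sqint_dir_grad v iT; split; first exact: measurableT_comp.
    by move: g2; congr (_.-integrable _ _); apply/funext => y; rewrite real_normK ?num_real.
  rewrite EFinM -/(M i) (patch_integral mI01) //.
  apply: (sqint_mul mI01); last exact: (smooth_sqint_side i.1 sphi).
  have [m2 g2] := sqint_jump HT Hu iT; split; first exact: measurableT_comp.
  by move: g2; congr (_.-integrable _ _); apply/funext => y; rewrite real_normK ?num_real.
rewrite ge0_integralD // EA EB /broken_variation mulrDr EFinD; apply: leeD.
  rewrite mulr_sumr -sumEFin big_seq [leRHS]big_seq; apply: lee_sum => t tT.
  rewrite /At (tonelli_cutoff (meps n *: z0) (@tonelli_area_area R) k0 s0 (@measurable_id _ _ setT) (mgt t tT) (gt0 t)).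
  have mt := measurable_open_tri (nT tT).
  have i1 := integrable_abs_R (sqint_integrable mt (open_tri_fin (nT tT)) (sqint_dir_grad v tT)).
  rewrite -integral_mkcond EFinM /Rintegral fineK; last by apply: integrable_fin_num.
  by apply: lee_wpmul2r; [apply: integral_ge0 => y _; rewrite lee_fin|rewrite lee_fin].
rewrite mulr_sumr -sumEFin big_seq [leRHS]big_seq; apply: lee_sum => e eT.
rewrite /Be ge0_integralZl //; first last.
- by rewrite lee_fin.
- by move=> x _; apply: integral_ge0 => y _; rewrite mule_ge0 // lee_fin cutoff_ge0.
- by apply: measurable_integral_cutoff_line => //; exact: mge.
rewrite (tonelli_cutoff (meps n *: z0) (@tonelli_area_swap R _ _ mu1) k0 s0 (mgam e.1) (mge e eT) (ge0 e)).
have i1 := integrable_abs_R (sqint_integrable mI01 I01_fin (sqint_jump HT Hu eT)).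
rewrite -integral_mkcond mulrCA -/(M e) [leRHS]EFinM.
apply: lee_wpmul2l; first by rewrite lee_fin.
rewrite EFinM /Rintegral fineK; last by apply: integrable_fin_num.
by apply: lee_wpmul2r; [apply: integral_ge0 => y _; rewrite lee_fin|rewrite lee_fin].
Qed.

End Variation.

(** * The variation bounded by the energy *)

Section EnergyBound.
Context {R : realType}.
Notation pt := (R * R)%type.
Notation mR := (measurableTypeR R).
Notation mu1 := (@lebesgue_measure R).
Notation I01 := (`[0, 1]%classic : set mR).
Notation nondeg := Defs.nondegenerate.

Definition energy (T : seq (triangle R)) (u : pt -> R) : R := grad_energy T u + jump_energy T u.

Variables (Omega : set pt) (T : seq (triangle R)) (u : pt -> R) (K W : R).
Hypotheses (oO : open Omega) (HT : triangulation Omega T) (Hu : H1h T u).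
Hypotheses (TK : shape_const T <= K) (TW : \sum_(t <- T) tri_area t <= W).

Let nT t : t \in T -> nondeg t. Proof. by case: HT => _ H _ _; exact: H. Qed.

Lemma grad_energy_ge0 : 0 <= grad_energy T u.
Proof. by apply: sumr_ge0 => t _; rewrite addr_ge0 //; exact: sqnorm_ge0. Qed.

Lemma jump_energy_ge0 : 0 <= jump_energy T u.
Proof.
rewrite (jump_energyE u HT); apply: sumr_ge0 => e _.
by apply: Rintegral_ge0 => r _; exact: sqr_ge0.
Qed.

Lemma energy_ge0 : 0 <= energy T u.
Proof. by rewrite addr_ge0 // ?grad_energy_ge0 ?jump_energy_ge0. Qed.

(** Young's inequality, integrated; the weight [l] stays free so that one choice can later be made
    for all triangles and edges together. *)
Lemma double_integral_abs_le d (X : measurableType d) (mu : {measure set X -> \bar R}) (A : set X) (f : X -> R) (l : R) :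
  measurable A -> (mu A < +oo)%E -> sqint mu A f -> 0 < l ->
  2 * \int[mu]_(x in A) `|f x| <= l * \int[mu]_(x in A) (f x ^+ 2) + fine (mu A) / l.
Proof.
move=> mA fA f2 l0; have fi := integrable_abs_R (sqint_integrable mA fA f2).
have ci : mu.-integrable A (EFin \o cst (l^-1)).
  apply: (sqint_integrable mA fA); apply: (@sqint_bounded _ _ _ mu A mA (l^-1)) => // x _.
  by rewrite ger0_norm // invr_ge0 ltW.
have qi := integrable_scale_R mA l f2.2.
have := Rintegral_cst mu mA (l^-1); rewrite [l^-1 * _]mulrC => <-.
rewrite -(Rintegral_scale mA 2 fi) -(Rintegral_scale mA l f2.2) -(Rintegral_add mA qi ci).
apply: le_Rintegral => //; first exact: (integrable_scale_R mA 2 fi).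
  exact: (integrable_sum_R mA qi ci).
move=> x _; rewrite -(ler_pM2l l0) mulrDr divff ?gt_eqF //.
have -> : l * (l * f x ^+ 2) = (l * `|f x|) ^+ 2 by rewrite exprMn real_normK ?num_real //; ring.
have := sqr_ge0 (l * `|f x| - 1); lra.
Qed.

Lemma sum_dir_grad_le v : \sum_(t <- T) \int[area]_(x in open_tri t) (dir_grad t u v x ^+ 2) <=
  2 * (v.1 ^+ 2 + v.2 ^+ 2) * grad_energy T u.
Proof.
rewrite /grad_energy mulr_sumr big_seq [leRHS]big_seq; apply: ler_sum => t tT.
have mt := measurable_open_tri (nT tT); have [g1 g2 _ _] := gradP (Hu tT).
have := sq_integralD_le mt (sqintZ mt v.1 g1) (sqintZ mt v.2 g2).
have Ez (c : R) (f : pt -> R) : sqint area (open_tri t) f ->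
   \int[area]_(x in open_tri t) ((c * f x) ^+ 2) = c ^+ 2 * L2sq (open_tri t) f.
  by move=> [_ f2]; rewrite -(Rintegral_scale mt _ f2); apply: eq_Rintegral => x _; rewrite exprMn.
rewrite !Ez // => h; apply: le_trans h _; rewrite /grad_sq.
have aux (p q c1 c2 : R) : 0 <= p -> 0 <= q -> 0 <= c1 -> 0 <= c2 ->
    2 * (c1 * p) + 2 * (c2 * q) <= 2 * (c1 + c2) * (p + q).
  by move=> p0 q0 c10 c20; have := mulr_ge0 c10 q0; have := mulr_ge0 c20 p0; lra.
by apply: aux; rewrite ?sqr_ge0 //; exact: sqnorm_ge0.
Qed.

(** Three sides per triangle, each with squared length at most [4 * K ^+ 2] times the area. *)
Lemma sum_side_len_sq_le : \sum_(e <- interior_edges T) side_len e.1 ^+ 2 <= 12 * K ^+ 2 * W.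
Proof.
apply: le_trans (sum_interior_edges_le HT (a := fun s => side_len s ^+ 2) _) _.
  by move=> s _; exact: sqr_ge0.
apply: (@le_trans _ _ (\sum_(t <- T) 12 * K ^+ 2 * tri_area t)).
  rewrite big_seq [leRHS]big_seq; apply: ler_sum => t tT.
  rewrite (sum_ord3 _ 0).
  have h i := side_len_sq_le i TK tT (nT tT).
  have := h 0; have := h (0 + 1); have := h (0 + 2%:R); lra.
by rewrite -mulr_sumr ler_wpM2l // mulr_ge0 ?sqr_ge0.
Qed.

(** The first factor comes from the squares of gradient and jumps, the second from the areas and the
    squared edge lengths. *)
Definition variation_cst (v : pt) : R :=
  (2 * (v.1 ^+ 2 + v.2 ^+ 2) + (`|v.1| + `|v.2|)) * ((1 + 12 * (`|v.1| + `|v.2|) * K ^+ 2) * W).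

(** Cauchy-Schwarz over all triangles and edges at once, obtained as the discriminant of a family of
    Young inequalities with a common weight. *)
Lemma variation_sq_le v : broken_variation T u v ^+ 2 <= variation_cst v * energy T u.
Proof.
set m := `|v.1| + `|v.2|; have m0 : 0 <= m by rewrite addr_ge0.
have W0 : 0 <= W by apply: le_trans TW; apply: sumr_ge0 => t _; exact: tri_area_ge0.
pose X := 2 * (v.1 ^+ 2 + v.2 ^+ 2) * grad_energy T u + m * jump_energy T u.
pose Y := (1 + 12 * m * K ^+ 2) * W.
have X0 : 0 <= X.
  by rewrite addr_ge0 // mulr_ge0 // ?grad_energy_ge0 ?jump_energy_ge0 // mulr_ge0 // addr_ge0 ?sqr_ge0.
have Y0 : 0 <= Y by rewrite mulr_ge0 // addr_ge0 // mulr_ge0 ?sqr_ge0 // mulr_ge0.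
have V0 : 0 <= broken_variation T u v.
  rewrite addr_ge0 //; apply: sumr_ge0 => i _; first by apply: Rintegral_ge0.
  by rewrite !mulr_ge0 ?sqrtr_ge0 //; apply: Rintegral_ge0.
(* Young's inequality with a free weight [l]. *)
have key l : 0 < l -> 2 * broken_variation T u v <= l * X + Y / l.
  move=> l0; rewrite /broken_variation mulrDr.
  have h1 : 2 * (\sum_(t <- T) \int[area]_(x in open_tri t) `|dir_grad t u v x|) <=
      l * (2 * (v.1 ^+ 2 + v.2 ^+ 2) * grad_energy T u) + W / l.
    apply: (@le_trans _ _ (l * (\sum_(t <- T) \int[area]_(x in open_tri t) (dir_grad t u v x ^+ 2)) + (\sum_(t <- T) tri_area t) / l)).
      rewrite !mulr_sumr mulr_suml -big_split /= big_seq [leRHS]big_seq; apply: ler_sum => t tT.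
      exact: (double_integral_abs_le (measurable_open_tri (nT tT)) (open_tri_fin (nT tT)) (sqint_dir_grad HT Hu v tT) l0).
    apply: lerD; first by apply: ler_wpM2l (sum_dir_grad_le v); exact: ltW.
    by apply: ler_wpM2r => //; rewrite invr_ge0 ltW.
  have h2 : 2 * (\sum_(e <- interior_edges T) m * side_len e.1 * \int[mu1]_(r in I01) `|jump e u r|) <=
      l * (m * jump_energy T u) + (12 * m * K ^+ 2 * W) / l.
    apply: (@le_trans _ _ (l * (m * \sum_(e <- interior_edges T) \int[mu1]_(r in I01) (jump e u r ^+ 2)) +
       m * (\sum_(e <- interior_edges T) side_len e.1 ^+ 2) / l)).
      rewrite !mulr_sumr mulr_suml -big_split /= big_seq [leRHS]big_seq; apply: ler_sum => e eT.
      have j2 := sqint_jump HT Hu eT; have [e1T _ _] := interior_edgesP eT.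
      have len0 : 0 < side_len e.1 by case: (e.1) e1T => t i /= tT; apply: side_len_gt0; exact: nT.
      (* With the weight [l / |e|], multiplication by [|e|] leaves the squared jump with factor [l],
         as in the energy, and [|e| ^+ 2 / l]. *)
      have := double_integral_abs_le mI01 I01_fin j2 (divr_gt0 l0 len0).
      rewrite [fine _](_ : _ = 1); last exact: (congr1 fine mu1_I01).
      rewrite mul1r invf_div.
      move: (\int[mu1]_(r in I01) `|jump e u r|) (\int[mu1]_(r in I01) (jump e u r ^+ 2)) len0 => p q len0.
      move: (side_len e.1) len0 => len len0 h.
      have -> : 2 * (m * len * p) = m * len * (2 * p) by ring.
      have -> : l * (m * q) + m * len ^+ 2 / l = m * len * (l / len * q + len / l).
        by field; rewrite !gt_eqF.
      by apply: ler_wpM2l => //; rewrite mulr_ge0 // ltW.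
    rewrite -(jump_energyE u HT) lerD2l; apply: ler_wpM2r; first by rewrite invr_ge0 ltW.
    have := ler_wpM2l m0 sum_side_len_sq_le; congr (_ <= _); ring.
  have := lerD h1 h2; congr (_ <= _); rewrite /X /Y; ring.
have : broken_variation T u v ^+ 2 <= X * Y.
  (* For [s <= 0] all three terms are nonnegative; for [s > 0] the Young bound with weight [s] is
     multiplied by [s]. *)
  apply: (discriminant_le X0) => s; have [s0|s0] := ltrP 0 s; last first.
    have h : 2 * broken_variation T u v * s <= 0 by rewrite mulr_ge0_le0 // mulr_ge0.
    have := mulr_ge0 X0 (sqr_ge0 s); lra.
  have := ler_wpM2l (ltW s0) (key s s0).
  have -> : s * (s * X + Y / s) = X * s ^+ 2 + Y by field; rewrite gt_eqF.
  lra.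
move/le_trans; apply; rewrite /variation_cst -/m -/Y mulrAC; apply: ler_wpM2r => //.
rewrite /X /energy.
have := mulr_ge0 m0 grad_energy_ge0.
have := mulr_ge0 (addr_ge0 (sqr_ge0 v.1) (sqr_ge0 v.2)) jump_energy_ge0.
move: (grad_energy T u) (jump_energy T u) (v.1 ^+ 2 + v.2 ^+ 2) => p q c; lra.
Qed.

End EnergyBound.

(** [X] is the squared distance of the mollification to a constant, [Y] that of the function to its
    mollification, [IA] and [IB] the L^1 norms of the derivatives. The slack is [Num.sqrt M], so
    that its square is again [M]; 16 is the square of the factor 4 lost in the variation. *)
Lemma poincare_arith (R : rcfType) (k M E Ca Cb IA IB Va Vb X Y : R) :
  0 < k -> 0 < M -> 0 <= E <= M -> 0 <= IA -> 0 <= IB -> IA <= 4 * Va -> IB <= 4 * Vb ->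
  Va ^+ 2 <= Ca * E -> Vb ^+ 2 <= Cb * E -> X <= k * (k^-1 * IA + k^-1 * IB + Num.sqrt M) ^+ 2 -> Y <= M ->
  2 * Y + 2 * X <= (2 + 2 * (k * (3 * (16 * k ^- 2 * `|Ca| + 16 * k ^- 2 * `|Cb| + 1)))) * M.
Proof.
move=> k0 M0 /andP[E0 EM] Na Nb Va4 Vb4 Sa Sb HX HY.
have le_norm C V : V ^+ 2 <= C * E -> V ^+ 2 <= `|C| * M.
  by move/le_trans; apply; apply: le_trans (ler_wpM2r E0 (ler_norm C)) _; exact: ler_wpM2l.
have bound I V Cv : 0 <= I -> I <= 4 * V -> V ^+ 2 <= Cv * E -> (k^-1 * I) ^+ 2 <= 16 * k ^- 2 * `|Cv| * M.
  move=> I0 IV /le_norm VC; have h : I ^+ 2 <= 16 * (`|Cv| * M).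
    apply: (@le_trans _ _ ((4 * V) ^+ 2)); first by rewrite lerXn2r ?nnegrE // (le_trans I0).
    have -> : (4 * V) ^+ 2 = 16 * V ^+ 2 by ring.
    by rewrite ler_pM2l.
  have -> : 16 * k ^- 2 * `|Cv| * M = k ^- 2 * (16 * (`|Cv| * M)) by ring.
  by rewrite exprMn exprVn; apply: ler_wpM2l => //; rewrite invr_ge0 sqr_ge0.
have B1 := bound _ _ _ Na Va4 Sa; have B2 := bound _ _ _ Nb Vb4 Sb.
have B3 := sqr_sqrtr (ltW M0).
have three (x y z : R) : (x + y + z) ^+ 2 <= 3 * (x ^+ 2 + y ^+ 2 + z ^+ 2).
  have := sqr_ge0 (x - y); have := sqr_ge0 (x - z); have := sqr_ge0 (y - z); nra.
have h2 : X <= k * (3 * (16 * k ^- 2 * `|Ca| + 16 * k ^- 2 * `|Cb| + 1)) * M.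
  apply: le_trans HX _; rewrite -!mulrA ler_pM2l //.
  apply: le_trans (three _ _ _) _; rewrite ler_pM2l //.
  move: B1 B2; rewrite B3 -!mulrA => B1 B2.
  apply: le_trans (lerD (lerD B1 B2) (lexx M)) _.
  by rewrite le_eqVlt; apply/orP; left; apply/eqP; ring.
by rewrite [leRHS]mulrDl; apply: lerD; [rewrite ler_pM2l|rewrite -mulrA ler_pM2l].
Qed.

(** * Sets with a mesh-independent Poincare inequality *)

Section PoincareSets.
Context {R : realType}.
Notation pt := (R * R)%type.
Notation mR := (measurableTypeR R).
Notation mpt := (mR * mR)%type.

Variables (Omega : set pt) (K W : R).
Hypotheses (oO : open Omega).
Hypothesis TW : forall T, triangulation Omega T -> \sum_(t <- T) tri_area t <= W.

(* Any [M] above the energy is allowed, so that a vanishing energy needs no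
   separate argument when approximating. *)
Definition poincare (U : set mpt) : Prop :=
  [/\ measurable U, (area U < +oo)%E & exists C, 0 <= C /\
    forall T, triangulation Omega T -> shape_const T <= K -> forall u, H1h T u ->
    forall M, energy T u < M ->
    exists c, \int[area]_(x in U) ((piecewise T u x - c) ^+ 2) <= C * M].

Lemma sqint_cst (A : set mpt) (c : R) : measurable A -> (area A < +oo)%E -> sqint area A (cst c).
Proof. by move=> mA fA; apply: (@sqint_bounded _ _ _ area A mA `|c|). Qed.

(** A single mollification suffices. Since [M] is positive, its index can be chosen with error at
    most [M]; the index depends on [T] and [u], the constant does not. *)
Lemma poincare_para o a b : cross a b != 0 -> para o a b `<=` Omega -> poincare (para o a b).
Proof.
move=> ab QO; have mQ := open_measurable_plane (open_para (o := o) ab); have fQ := para_fin o ab.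
have [rad [rad0 ballQ]] := open_inner_ball (open_para (o := o) ab) (para_center o a b).
pose k := `|cross a b|; have k0 : 0 < k by rewrite normr_gt0.
pose Ca := variation_cst K W a; pose Cb := variation_cst K W b.
pose C := 2 + 2 * (k * (3 * (16 * k ^- 2 * `|Ca| + 16 * k ^- 2 * `|Cb| + 1))).
split => //; exists C; split.
  have nn (z : R) : 0 <= 16 * k ^- 2 * `|z| by rewrite !mulr_ge0 // invr_ge0 sqr_ge0.
  rewrite /C; apply: addr_ge0 => //; apply: mulr_ge0 => //; apply: mulr_ge0; first exact: ltW.
  by apply: mulr_ge0 => //; rewrite !addr_ge0.
move=> T HT TK u Hu M EM.
have E0 := energy_ge0 u HT; have M0 : 0 < M by exact: le_lt_trans EM.
have EE : 0 <= energy T u <= M by rewrite E0 ltW.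
have g2 := sqint_piecewise_on HT Hu mQ.
pose m n := moll (para o a b) (o + 2^-1 *: a + 2^-1 *: b) rad n (piecewise T u).
have cv : moll_cvg (para o a b) (o + 2^-1 *: a + 2^-1 *: b) rad (piecewise T u).
  by apply: moll_cvg_sqint => // x z e; exact: para_convex.
have [n _ /(_ n (leqnn n)) /= Hn] := proj1 (cvgr0Pnorm_le _) cv M M0.
have sm : smooth (m n) by apply: moll_smooth => //; exact: (sqint_integrable mQ fQ g2).
have m2 : sqint area (para o a b) (m n) by apply: sqint_continuous_para => //; exact: smooth_continuous.
have e0 : 0 < Num.sqrt M by rewrite sqrtr_gt0.
have [c Hc] := para_poincare_smooth o ab sm e0.
exists c.
have c2 := sqint_cst c mQ fQ.
have := sq_integralD_le mQ (sqintB mQ g2 m2) (sqintB mQ m2 c2).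
have -> : \int[area]_(x in para o a b) ((piecewise T u x - m n x + (m n x - cst c x)) ^+ 2) =
   \int[area]_(x in para o a b) ((piecewise T u x - c) ^+ 2).
  by apply: eq_Rintegral => x _; rewrite addrA subrK.
move/le_trans; apply.
have h1 : \int[area]_(x in para o a b) ((piecewise T u x - m n x) ^+ 2) <= M.
  apply: le_trans (le_trans (ler_norm _) Hn); rewrite le_eqVlt; apply/orP; left; apply/eqP.
  by apply: eq_Rintegral => x _; rewrite -sqrrN opprB.
have Va := integral_moll_derive_le oO HT Hu ab QO rad0 ballQ n a.
have Vb := integral_moll_derive_le oO HT Hu ab QO rad0 ballQ n b.
have Sa := variation_sq_le HT Hu TK (TW HT) a; have Sb := variation_sq_le HT Hu TK (TW HT) b.
have Na : 0 <= \int[area]_(x in para o a b) `|'D_a (m n) x| by apply: Rintegral_ge0.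
have Nb : 0 <= \int[area]_(x in para o a b) `|'D_b (m n) x| by apply: Rintegral_ge0.
exact: (poincare_arith k0 M0 EE Na Nb Va Vb Sa Sb Hc h1).
Qed.

(** On the overlap both constants approximate the same function, so their squared difference is at
    most a multiple of [M] over the area of the overlap; the constant of [U] then serves on [V] as
    well. *)
Lemma poincare_union U V : poincare U -> poincare V -> (0 < area (U `&` V))%E -> poincare (U `|` V).
Proof.
move=> [mU fU [CU [CU0 HU]]] [mV fV [CV [CV0 HV]]] UV0.
have mUV : measurable (U `|` V) by exact: measurableU.
have mI : measurable (U `&` V) by exact: measurableI.
have fUV : (area (U `|` V) < +oo)%E.
  by apply: le_lt_trans (measureU2 _ mU mV) _; exact: lte_add_pinfty.
have fI : (area (U `&` V) < +oo)%E.
  by apply: le_lt_trans fU; apply: le_measure; rewrite ?inE //; exact: subIsetl.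
pose al := fine (area (U `&` V)); pose be := fine (area V).
have al0 : 0 < al by rewrite fine_gt0 // UV0 fI.
have be0 : 0 <= be by exact/fine_ge0/measure_ge0.
split => //; exists (CU + 2 * CV + 4 * (CU + CV) * (be / al)); split.
  by rewrite !addr_ge0 ?mulr_ge0 ?addr_ge0 ?invr_ge0 // ltW.
move=> T HT TK u Hu M EM.
have [c Hc] := HU T HT TK u Hu M EM; have [d Hd] := HV T HT TK u Hu M EM.
have M0 : 0 < M by apply: le_lt_trans EM; exact: (energy_ge0 u HT).
exists c; have S A := sqint_piecewise_on HT Hu (A := A).
have D A (e : R) : measurable A -> (area A < +oo)%E -> sqint area A (fun x => piecewise T u x - e).
  by move=> mA fA; apply: (sqintB mA); [exact: S|exact: sqint_cst].
have sub (A B : set mpt) e : measurable A -> measurable B -> (area B < +oo)%E -> A `<=` B ->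
    \int[area]_(x in A) ((piecewise T u x - e) ^+ 2) <= \int[area]_(x in B) ((piecewise T u x - e) ^+ 2).
  move=> mA mB fB AB; have fA : (area A < +oo)%E by apply: le_lt_trans fB; apply: le_measure; rewrite ?inE.
  rewrite -lee_fin -!integral_sqintE //; try exact: D.
  by apply: ge0_subset_integral => //; [exact: (measurable_int _ (D B e mB fB).2)|move=> x _; rewrite lee_fin sqr_ge0].
have cst_int (A : set mpt) (e : R) : measurable A -> \int[area]_(x in A) (cst e x) = e * fine (area A).
  by move=> mA; rewrite Rintegral_cst.
have h1 : (c - d) ^+ 2 * al <= 2 * (CU * M) + 2 * (CV * M).
  have := sq_integralD_le mI (D _ d mI fI) (sqintZ mI (-1) (D _ c mI fI)).
  rewrite (@eq_Rintegral _ _ _ area (U `&` V) (cst ((c - d) ^+ 2))); last by move=> x _ /=; ring.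
  rewrite cst_int // => /le_trans; apply.
  rewrite (@eq_Rintegral _ _ _ area (U `&` V) (fun x => (piecewise T u x - c) ^+ 2) (fun x => (-1 * (piecewise T u x - c)) ^+ 2)); last by move=> x _ /=; ring.
  rewrite addrC; apply: lerD; rewrite ler_pM2l //.
    by apply: le_trans (sub _ U c mI mU fU (@subIsetl _ _ _)) Hc.
  by apply: le_trans (sub _ V d mI mV fV (@subIsetr _ _ _)) Hd.
have h2 : \int[area]_(x in V) ((piecewise T u x - c) ^+ 2) <= 2 * (CV * M) + 2 * ((d - c) ^+ 2 * be).
  have := sq_integralD_le mV (D _ d mV fV) (sqint_cst (d - c) mV fV).
  rewrite (@eq_Rintegral _ _ _ area V (fun x => (piecewise T u x - c) ^+ 2)); last by move=> x _ /=; ring.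
  move/le_trans; apply; apply: lerD; rewrite ler_pM2l //.
  by rewrite -(cst_int V ((d - c) ^+ 2) mV).
have h3 : \int[area]_(x in U `|` V) ((piecewise T u x - c) ^+ 2) <=
   \int[area]_(x in U) ((piecewise T u x - c) ^+ 2) + \int[area]_(x in V) ((piecewise T u x - c) ^+ 2).
  have mD : measurable (V `\` U) by exact: measurableD.
  have E : U `|` V = U `|` (V `\` U).
    apply/seteqP; split => x; last by case=> [|[]]; [left|right].
    by have [|nU] := pselect (U x); [left|case=> [//|Vx]; right].
  have mF := measurable_int _ (D (U `|` V) c mUV fUV).2.
  rewrite -lee_fin EFinD -!integral_sqintE //; try exact: D.
  rewrite E in mF *; rewrite ge0_integral_setU //.
  - rewrite leeD2l //; apply: ge0_subset_integral => //; last by move=> x _; rewrite lee_fin sqr_ge0.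
    exact: (measurable_int _ (D V c mV fV).2).
  - by move=> x _; rewrite lee_fin sqr_ge0.
  - by rewrite disj_set2E; apply/eqP; rewrite -subset0 => x [Ux []].
have h4 : (c - d) ^+ 2 <= (2 * (CU * M) + 2 * (CV * M)) / al by rewrite ler_pdivlMr.
have h5 := ler_wpM2r be0 h4.
have h6 : (2 * (CU * M) + 2 * (CV * M)) / al * be = 2 * (CU + CV) * (be / al) * M by ring.
have h7 : (d - c) ^+ 2 = (c - d) ^+ 2 by ring.
apply: le_trans h3 _; rewrite h7 in h2; rewrite h6 in h5.
apply: le_trans (lerD Hc h2) _.
move: ((c - d) ^+ 2 * be) h5 => q h5.
have -> : (CU + 2 * CV + 4 * (CU + CV) * (be / al)) * M = CU * M + (2 * (CV * M) + 2 * (2 * (CU + CV) * (be / al) * M)) by ring.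
by rewrite !lerD2l ler_pM2l.
Qed.

End PoincareSets.

(** * From parallelograms to the domain *)

Section Chaining.
Context {R : realType}.
Notation pt := (R * R)%type.
Notation mR := (measurableTypeR R).
Notation mpt := (mR * mR)%type.
Notation nondeg := Defs.nondegenerate.

(** Three such parallelograms cover the open triangle and share its centroid, so a triangle inherits
    the inequality through two unions. *)
Definition half_para (t : triangle R) (i : 'I_3) : set mpt :=
  para (t i) (2^-1 *: edge1 t i) (2^-1 *: edge2 t i).

Lemma half_para_cross t i : nondeg t -> cross ((2^-1 : R) *: edge1 t i) ((2^-1 : R) *: edge2 t i) != 0.
Proof.
move=> nt; have -> : cross ((2^-1 : R) *: edge1 t i) ((2^-1 : R) *: edge2 t i) = 4^-1 * tri_det t.
  by rewrite -(tri_detE t i) /cross /= -?[_ *: _]/(_ * _); field.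
by rewrite mulf_neq0 ?tri_det_neq0 // invr_eq0 pnatr_eq0.
Qed.

Lemma half_paraP t i x : nondeg t ->
  half_para t i x <-> 0 < bary t (i + 1) x < 2^-1 /\ 0 < bary t (i + 2%:R) x < 2^-1.
Proof.
move=> nt; have v := bary_vertices nt; have [F1 F2 F3 F4] := ord3_shift i.
have co s r : t i + s *: (2^-1 *: edge1 t i) + r *: (2^-1 *: edge2 t i) =
   \sum_j (if j == i then 1 - s / 2 - r / 2 else if j == i + 1 then s / 2 else r / 2) *: t j.
  have [n1 n2 n3] := ord3_neq i.
  rewrite (sum_ord3 _ i) eqxx (negbTE n1) eqxx (negbTE n2) [i + 2%:R == _]eq_sym (negbTE n3) /edge1 /edge2.
  case: (t i) (t (i + 1)) (t (i + 2%:R)) => a1 a2 [b1 b2] [c1 c2].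
  by congr (_, _) => /=; rewrite -?[_ *: _]/(_ * _); field.
have [n1 n2 n3] := ord3_neq i.
split.
  move=> [s [r [/andP[s0 s1] /andP[r0 r1] ->]]]; rewrite co.
  rewrite !bary_combination // ?(sum_ord3 _ i) ?eqxx ?(negbTE n1) ?eqxx ?(negbTE n2) ?[i + 2%:R == _]eq_sym ?(negbTE n3); try ring.
  by split; apply/andP; split; lra.
move=> [/andP[s0 s1] /andP[r0 r1]]; exists (2 * bary t (i + 1) x), (2 * bary t (i + 2%:R) x).
split; try (by apply/andP; split; lra).
rewrite co -{1}(bary_decomp x nt) !(sum_ord3 _ i) eqxx (negbTE n1) eqxx (negbTE n2) [i + 2%:R == _]eq_sym (negbTE n3).
have := sum_bary x nt; rewrite (sum_ord3 _ i) => E.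
by congr (_ *: _ + _ *: _ + _ *: _); lra.
Qed.

Lemma half_para_sub t i : nondeg t -> half_para t i `<=` open_tri t.
Proof.
move=> nt x /(half_paraP _ _ nt) [/andP[h1 h2] /andP[h3 h4]]; apply/(open_triP _ nt) => j.
have := sum_bary x nt; rewrite (sum_ord3 _ i) => E.
by case: (ord3_split i j) => ->; lra.
Qed.

(** At most one barycentric coordinate reaches 1/2; if one does, the parallelogram at its vertex
    contains the point, and otherwise any of the three does. *)
Lemma open_tri_half_para t : nondeg t ->
  open_tri t = half_para t 0 `|` half_para t 1 `|` half_para t 2%:R.
Proof.
move=> nt; apply/seteqP; split => [x|x [[]|]]; try exact: half_para_sub.
move/(open_triP _ nt) => H; have := sum_bary x nt; rewrite (sum_ord3 _ 0) !ord3_addE => E.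
have H0 := H 0; have H1 := H 1; have H2 := H 2%:R.
have [l1|l1] := ltP (bary t 1 x) 2^-1; last first.
  left; right; apply/(half_paraP _ _ nt); rewrite !ord3_addE; split; apply/andP; split; lra.
have [l2|l2] := ltP (bary t 2%:R x) 2^-1; last first.
  right; apply/(half_paraP _ _ nt); rewrite !ord3_addE; split; apply/andP; split; lra.
by left; left; apply/(half_paraP _ _ nt); rewrite !ord3_addE; split; apply/andP; split.
Qed.

Lemma half_para_center t i : nondeg t -> half_para t i (\sum_j 3^-1 *: t j).
Proof.
move=> nt; apply/(half_paraP _ _ nt); rewrite !bary_combination //; try by rewrite (sum_ord3 _ 0); field.
by split; apply/andP; split; lra.
Qed.

Variables (Omega : set pt) (K W : R).
Hypotheses (oO : open Omega).
Hypothesis TW : forall T, triangulation Omega T -> \sum_(t <- T) tri_area t <= W.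

Notation poincare := (poincare Omega K).

Lemma poincare_overlap (U V : set pt) : open U -> open V -> (U `&` V) !=set0 ->
  poincare U -> poincare V -> poincare (U `|` V).
Proof.
by move=> oU oV UV pU pV; apply: poincare_union => //; apply: open_area_gt0 => //; exact: openI.
Qed.

Lemma poincare_tri t : nondeg t -> open_tri t `<=` Omega -> poincare (open_tri t).
Proof.
move=> nt tO; rewrite open_tri_half_para //.
have o1 i : open (half_para t i : set pt) by apply: open_para; exact: half_para_cross.
have p1 i : poincare (half_para t i).
  apply: (@poincare_para _ Omega K W oO TW (t i) (2^-1 *: edge1 t i) (2^-1 *: edge2 t i)); first exact: half_para_cross.
  by apply: subset_trans tO; exact: half_para_sub.
have c i := half_para_center i nt.
apply: poincare_overlap => //; first exact: openU.
  by exists (\sum_j 3^-1 *: t j); split => //; left.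
by apply: poincare_overlap => //; exists (\sum_j 3^-1 *: t j).
Qed.

Lemma poincare_neighborhood x : Omega x -> exists U : set pt, [/\ open U, U x, U `<=` Omega & poincare U].
Proof.
move=> Ox; have [r [r0 rO]] := open_inner_ball oO Ox.
pose o : pt := (x.1 - r / 2, x.2 - r / 2).
have ab : cross ((r, 0) : pt) ((0, r) : pt) != 0.
  by rewrite /cross /= mul0r subr0 mulf_neq0 // gt_eqF.
have sub : para o (r, 0) (0, r) `<=` Omega.
  move=> _ [s [q [/andP[s0 s1] /andP[q0 q1] ->]]]; apply: rO.
  have -> : o + s *: ((r, 0) : pt) + q *: ((0, r) : pt) - x = ((s - 2^-1) * r, (q - 2^-1) * r).
    rewrite /o [X in _ - X]surjective_pairing.
    by congr (_, _) => /=; rewrite -?[_ *: _]/(_ * _); field.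
  have b (z : R) : 0 < z -> z < 1 -> `|(z - 2^-1) * r| <= r.
    move=> z0 z1; rewrite normrM (gtr0_norm r0) ger_pMl // ler_norml; apply/andP; split; lra.
  by rewrite /Num.norm /= ge_max !b.
exists (para o (r, 0) (0, r)); split => //; first exact: open_para.
  exists 2^-1, 2^-1; split; try by (apply/andP; split; lra).
  by rewrite [LHS]surjective_pairing; congr (_, _) => /=; rewrite -?[_ *: _]/(_ * _); field.
exact: (@poincare_para _ Omega K W oO TW).
Qed.

Hypothesis cO : connected Omega.

(** Connectedness: the points that share an admissible open set with the triangle form an open set,
    and so do the other points of [Omega], since a small parallelogram around a point extends every
    admissible set that it meets. *)
Lemma poincare_reach t x : nondeg t -> open_tri t `<=` Omega -> Omega x ->
  exists U : set pt, [/\ open U, U x, open_tri t `<=` U & poincare U].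
Proof.
move=> nt tO Ox.
pose good := [set x | exists U : set pt, [/\ open U, U x, open_tri t `<=` U & poincare U]].
suff : Omega `&` good = Omega by move=> E; have [] : (Omega `&` good) x by rewrite E.
have ogood : open good.
  rewrite openE => y [U [oU Uy tU pU]]; apply: filterS (open_nbhs_nbhs (conj oU Uy)).
  by move=> z Uz; exists U.
have obad : open (Omega `\` good).
  rewrite openE => y [Oy ny]; have [S [oS Sy SO pS]] := poincare_neighborhood Oy.
  apply: filterS (open_nbhs_nbhs (conj oS Sy)) => z Sz; split; first exact: SO.
  move=> [U [oU Uz tU pU]]; apply: ny; exists (U `|` S); split.
  - exact: openU.
  - by right.
  - by move=> w /tU; left.
  - by apply: poincare_overlap => //; exists z.
have tc := open_tri_center t.
apply: cO.
- exists (\sum_i 3^-1 *: t i); split; first exact: tO.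
  by exists (open_tri t); split => //; [exact: open_open_tri|exact: poincare_tri].
- by exists good.
exists (~` (Omega `\` good)); first exact: open_closedC.
by apply/seteqP; split => y [Oy gy]; split => //; [move=> []|apply: contrapT => ny; exact: gy].
Qed.

(** The list will be the decomposition that defines the polygon, so the number of unions, and with
    it the constant, is independent of the mesh. *)
Lemma poincare_all_tri (P : seq (triangle R)) t0 : (forall t, t \in t0 :: P -> nondeg t) ->
  (forall t, t \in t0 :: P -> open_tri t `<=` Omega) ->
  exists U : set pt, [/\ open U, poincare U & forall t, t \in t0 :: P -> open_tri t `<=` U].
Proof.
elim: P => [|t P IH] nP PO.
  exists (open_tri t0); have t0P : t0 \in [:: t0] by rewrite inE.
  split; [exact/open_open_tri/nP|by apply: poincare_tri; [exact: nP|exact: PO]|].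
  by move=> t; rewrite inE => /eqP ->.
have sub t' : t' \in t0 :: P -> t' \in [:: t0, t & P].
  by rewrite !inE => /orP[->|->]; rewrite ?orbT.
have [U [oU pU HU]] := IH (fun t' h => nP t' (sub t' h)) (fun t' h => PO t' (sub t' h)).
have tP : t \in [:: t0, t & P] by rewrite !inE eqxx orbT.
have t0P : t0 \in [:: t0, t & P] by rewrite inE eqxx.
have nt := nP t tP; have nt0 := nP t0 t0P.
have [V [oV Vx tV pV]] := poincare_reach nt0 (PO t0 t0P) (PO t tP _ (open_tri_center t)).
have c0 := open_tri_center t0.
exists (U `|` V `|` open_tri t); split.
- by apply: openU; [exact: openU|exact: open_open_tri].
- apply: poincare_overlap => //; [exact: openU|exact: open_open_tri| | |].
  + by exists (\sum_i 3^-1 *: t i); split; [right|exact: open_tri_center].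
  + apply: poincare_overlap => //; exists (\sum_i 3^-1 *: t0 i); split; last exact: tV.
    by apply: HU c0; rewrite inE eqxx.
  + by apply: poincare_tri => //; exact: PO.
move=> t'; rewrite !inE => /or3P[/eqP ->|/eqP ->|t'P] x xt.
- by left; right; exact: tV.
- by right.
- by left; left; apply: (HU t') => //; rewrite inE t'P orbT.
Qed.

End Chaining.

Import HBNNSimple.

(** * Constants and the semi-norm *)

Section Constants.
Context {R : realType}.
Notation pt := (R * R)%type.
Notation mR := (measurableTypeR R).
Notation mpt := (mR * mR)%type.
Notation mu1 := (@lebesgue_measure R).
Notation I01 := (`[0, 1]%classic : set mR).
Notation nondeg := Defs.nondegenerate.
Implicit Type t : triangle R.

Lemma integral_derive_test t (phi : pt -> R) v : nondeg t -> test_function (open_tri t) phi ->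
  \int[area]_(x in open_tri t) 'D_v phi x = 0.
Proof.
move=> nt [sphi _ sup]; rewrite green_smooth // big1 // => i _.
rewrite /side_avg (@eq_Rintegral _ _ _ mu1 I01 (cst 0)); first by rewrite /Rintegral integral0 mulr0.
move=> r _; apply/eqP; apply: contrapT => /negP h.
by apply: (side_pt_notin (i := i) (r := r) nt); apply: sup; apply: subset_closure.
Qed.

Lemma integral_sub_cst t (u phi : pt -> R) c v : nondeg t -> L2 (open_tri t) u ->
  test_function (open_tri t) phi ->
  \int[area]_(x in open_tri t) ((u x - c) * 'D_v phi x) = \int[area]_(x in open_tri t) (u x * 'D_v phi x).
Proof.
move=> nt u2 tphi; have mt := measurable_open_tri nt; have [sphi _ _] := tphi.
have d2 := smooth_sqint nt (smooth_derive v sphi).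
have i1 := sqint_mul mt u2 d2.
have i2 := integrable_scale_R mt c (sqint_integrable mt (open_tri_fin nt) d2).
rewrite (@eq_Rintegral _ _ _ area (open_tri t) (fun x => u x * 'D_v phi x - c * 'D_v phi x)); last by move=> x _; rewrite mulrBl.
rewrite (Rintegral_sub mt i1 i2) (Rintegral_scale mt _ (sqint_integrable mt (open_tri_fin nt) d2)).
by rewrite integral_derive_test // mulr0 subr0.
Qed.

Lemma weak_grad_sub_cst t (u : pt -> R) c G : nondeg t -> L2 (open_tri t) u ->
  weak_grad (open_tri t) (fun x => u x - c) G <-> weak_grad (open_tri t) u G.
Proof.
move=> nt u2; split=> -[g1 g2 w1 w2]; split => // phi tphi.
- by rewrite -w1 // integral_sub_cst.
- by rewrite -w2 // integral_sub_cst.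
- by rewrite integral_sub_cst // w1.
- by rewrite integral_sub_cst // w2.
Qed.

Lemma L2_sub_cst t (u : pt -> R) c : nondeg t -> L2 (open_tri t) u -> L2 (open_tri t) (fun x => u x - c).
Proof.
move=> nt u2; have mt := measurable_open_tri nt.
by apply: (sqintB mt u2); apply: sqint_cst => //; exact: open_tri_fin.
Qed.

Lemma H1_sub_cst t (u : pt -> R) c : nondeg t -> H1 (open_tri t) u -> H1 (open_tri t) (fun x => u x - c).
Proof.
move=> nt [u2 [G HG]]; split; first exact: L2_sub_cst.
by exists G; apply/weak_grad_sub_cst.
Qed.

(** Both gradients are selected by [xget] from the same set, so they are equal everywhere and not
    merely almost everywhere. *)
Lemma grad_sub_cst t (u : pt -> R) c : nondeg t -> L2 (open_tri t) u ->
  grad (open_tri t) (fun x => u x - c) = grad (open_tri t) u.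
Proof.
move=> nt u2; rewrite /grad; congr (xget _ _); apply/funext => G; apply/propext.
exact: weak_grad_sub_cst.
Qed.

Lemma H1_cst t c : nondeg t -> H1 (open_tri t) (cst c).
Proof.
move=> nt; have mt := measurable_open_tri nt; have ft := open_tri_fin nt.
split; first exact: sqint_cst.
exists (cst 0, cst 0); split => /=; try exact: sqint_cst.
all: move=> phi tphi; have [sphi _ _] := tphi.
all: rewrite (Rintegral_scale mt c); last (apply: (sqint_integrable mt ft); apply: smooth_sqint => //; exact: smooth_derive).
all: rewrite integral_derive_test // mulr0 (@eq_Rintegral _ _ _ area (open_tri t) (cst 0)); last by move=> x _; rewrite /= mul0r.
all: by rewrite /Rintegral integral0 oppr0.
Qed.

Lemma H1_approx_sub_cst t (u : pt -> R) c v : nondeg t -> L2 (open_tri t) u -> H1_approx t u v ->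
  H1_approx t (fun x => u x - c) (fun n x => v n x - c).
Proof.
move=> nt u2 [sv c0 c1 c2].
have sc : smooth (fun _ : pt => c) by exact: smooth_cst.
have D e n : 'D_e (fun x => v n x - c) = 'D_e (v n).
  apply/funext => x; rewrite (deriveB_plane _ _ (sv n) sc).
  by rewrite [X in _ - X](_ : _ = 0) ?subr0 //; exact: derive_cst.
split.
- by move=> n; exact: smoothB.
- apply: cvg_trans c0; apply: near_eq_cvg; apply: nearW => n.
  by apply: eq_Rintegral => x _; congr (_ ^+ 2); ring.
- have E : (fun n => sqdist area (open_tri t) ('D_e1 (fun x => v n x - c)) (grad (open_tri t) u).1) =
      (fun n => sqdist area (open_tri t) ('D_e1 (v n)) (grad (open_tri t) u).1).
    by apply/funext => n; rewrite (D e1 n).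
  by rewrite (grad_sub_cst c nt u2) E.
- have E : (fun n => sqdist area (open_tri t) ('D_e2 (fun x => v n x - c)) (grad (open_tri t) u).2) =
      (fun n => sqdist area (open_tri t) ('D_e2 (v n)) (grad (open_tri t) u).2).
    by apply/funext => n; rewrite (D e2 n).
  by rewrite (grad_sub_cst c nt u2) E.
Qed.

(** The trace of [u - c] is selected afresh and may differ on a null set from that of [u] minus [c];
    both are limits of the shifted approximations, so their L^2 distance vanishes. *)
Lemma side_trace_sub_cst t i (u : pt -> R) c : nondeg t -> H1 (open_tri t) u ->
  sqdist mu1 I01 (side_trace (t, i) (fun x => u x - c)) (fun r => side_trace (t, i) u r - c) = 0.
Proof.
move=> nt hu; have hc := H1_sub_cst c nt hu.
have [v va] := H1_approx_exists nt hu; have vc := H1_approx_sub_cst c nt hu.1 va.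
have [sv _ _ _] := va; have [svc _ _ _] := vc.
have ci := sqint_side_trace i nt hu.
apply: (sqdist_limit_unique mI01 (fun n => smooth_sqint_side (t, i) (svc n)) (sqint_side_trace i nt hc) _
  (side_trace_cvg i nt hc vc)).
  by apply: (sqintB mI01 ci); apply: (@sqint_bounded _ _ _ mu1 I01 mI01 `|c|) => //; exact: I01_fin.
apply: cvg_trans (side_trace_cvg i nt hu va); apply: near_eq_cvg; apply: nearW => n.
by apply: eq_Rintegral => r _; congr (_ ^+ 2); ring.
Qed.

(* [w] stands for an arbitrary member of [H1h], which may be non-measurable on the
   union of the sides; so only an inequality is claimed. *)
Lemma integral_sq_ae_le (A N : set mpt) (w h : pt -> R) : measurable A -> measurable N -> area N = 0%E ->
  sqint area A h -> (forall x, A x -> ~ N x -> w x = h x) ->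
  L2sq A w <= \int[area]_(x in A) (h x ^+ 2).
Proof.
move=> mA mN N0 h2 wh.
have mh : measurable_fun setT ((fun x => (h x ^+ 2)%:E) \_ A).
  by apply/(measurable_restrictT _ mA); exact: (measurable_int _ h2.2).
have le : (\int[area]_(x in A) (w x ^+ 2)%:E <= \int[area]_(x in A) (h x ^+ 2)%:E)%E.
  (* The integral of a nonnegative function, measurable or not, is the supremum over the simple
     functions below it; each of these is measurable and almost everywhere below [h ^+ 2]. *)
  rewrite [leLHS]integral_mkcond ge0_integralTE; last first.
    by move=> x; rewrite patchE; case: ifP => // _; rewrite lee_fin sqr_ge0.
  apply: ge_ereal_sup => _ [g gw <-].
  rewrite -integralT_nnsfun [leRHS]integral_mkcond.
  apply: ae_ge0_le_integral => //.
  - by move=> x _; rewrite lee_fin; exact: fun_ge0.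
  - exact/measurable_EFinP.
  - by move=> x _; rewrite patchE; case: ifP => // _; rewrite lee_fin sqr_ge0.
  exists N; split => // x /= H; apply: contrapT => nN; apply: H => _.
  apply: le_trans (gw x) _; rewrite !patchE; case: ifPn => // /set_mem Ax.
  by rewrite wh.
rewrite /L2sq /Rintegral; apply: fine_le => //.
- rewrite ge0_fin_numE; last by apply: integral_ge0 => x _; rewrite lee_fin sqr_ge0.
  by apply: le_lt_trans le _; rewrite (integral_sqintE mA h2) ltry.
- by rewrite (integral_sqintE mA h2).
Qed.

(** [N] is the union of the finitely many lines that carry the sides. *)
Lemma null_boundary (T : seq (triangle R)) : (forall t, t \in T -> nondeg t) ->
  exists N : set mpt, [/\ measurable N, area N = 0%E &
    forall x t, t \in T -> closed_tri t x -> ~ N x -> open_tri t x].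
Proof.
elim: T => [|t T IH] nT; first by exists set0; split => //; exact: measure0.
have nt : nondeg t by apply: nT; rewrite inE eqxx.
have [N [mN N0 HN]] := IH (fun t' h => nT t' (mem_behead (s := t :: T) h)).
pose B i : set mpt := [set x : mpt | bary t i x = 0].
have mB i : measurable (B i).
  have cb : closed (B i : set pt).
    have -> : B i = bary t i @^-1` [set z : R | z = 0] by [].
    by apply: closed_comp; last exact: closed_eq; move=> x _; exact: continuous_bary.
  by rewrite -[B i]setCK; apply: measurableC; apply: open_measurable_plane; exact: closed_openC.
have B0 i : area (B i) = 0%E by exact: area_bary0.
have m01 : measurable (B 0 `|` B 1) by exact: measurableU.
have m012 : measurable (B 0 `|` B 1 `|` B 2%:R) by exact: measurableU.
exists (B 0 `|` B 1 `|` B 2%:R `|` N); split.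
- exact: measurableU.
- by rewrite !measureU0.
move=> x t'; rewrite inE => /orP[/eqP -> | t'T] xt nx; last by apply: (HN x t') => // Nx; apply: nx; right.
apply/(open_triP _ nt) => i; rewrite lt_neqAle (closed_triP _ nt).1 // andbT eq_sym.
apply/eqP => bi; apply: nx; left; elim/ord3_cases: i bi => bi; [by left; left|by left; right|by right].
Qed.

Lemma piecewise_eq (T : seq (triangle R)) (u : pt -> R) t x : uniq T -> t \in T ->
  (forall t t', t \in T -> t' \in T -> t != t' -> open_tri t `&` open_tri t' = set0) ->
  open_tri t x -> piecewise T u x = u x.
Proof.
move=> uT tT dT xt; rewrite /piecewise (bigD1_seq t) //= indicE mem_set // mul1r.
rewrite big_seq_cond big1 ?addr0 // => t' /andP[t'T ne].
rewrite indicE memNset ?mul0r // => xt'.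
have : (open_tri t' `&` open_tri t) x by [].
by rewrite dT.
Qed.

Lemma sub_shift_shift (a b a' b' k : R) : a - b - (a' - b') = (a - (a' - k)) + -1 * (b - (b' - k)).
Proof. ring. Qed.

Variables (Omega : set pt) (T : seq (triangle R)) (u : pt -> R) (c : R).
Hypotheses (oO : open Omega) (HT : triangulation Omega T) (Hu : H1h T u).

Let nT t : t \in T -> nondeg t. Proof. by case: HT => _ H _ _; exact: H. Qed.
Let uc := fun x => u x - c.

Lemma H1h_sub_cst : H1h T uc.
Proof. by move=> t tT; apply: H1_sub_cst; [exact: nT|exact: Hu]. Qed.

Lemma grad_energy_sub_cst : grad_energy T uc = grad_energy T u.
Proof.
apply: eq_big_seq => t tT.
by rewrite /grad_sq (grad_sub_cst c (nT tT) (Hu tT).1).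
Qed.

Lemma sqdist_trace_sub_cst s s' : s'.1 \in T -> same_edge s s' ->
  \int[mu1]_(r in I01) ((trace s' uc (side_pt s r) - (trace s' u (side_pt s r) - c)) ^+ 2) = 0.
Proof.
case: s' => t i /= tT se; rewrite -[RHS](side_trace_sub_cst i c (nT tT) (Hu tT)).
apply: (@same_edge_integral _ s (t, i) (fun x => (trace (t, i) uc x - (trace (t, i) u x - c)) ^+ 2) se).
apply: measurable_funX; apply: measurable_funB.
  exact: (sqint_side_trace i (nT tT) (H1h_sub_cst tT)).1.
by apply: measurable_funB => //; exact: (sqint_side_trace i (nT tT) (Hu tT)).1.
Qed.

(** The constant cancels in the jump only up to null sets, so the two jumps are compared in L^2,
    where functions at distance zero have the same norm. *)
Lemma jump_energy_sub_cst : jump_energy T uc = jump_energy T u.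
Proof.
rewrite (jump_energyE uc HT) (jump_energyE u HT); apply: eq_big_seq => e eT.
have [e1T e2T /andP[se _]] := interior_edgesP eT.
have j1 := sqint_jump HT H1h_sub_cst eT; have j2 := sqint_jump HT Hu eT.
apply: (sqdist0_integral_sq mI01 j1 j2); apply/eqP; rewrite eq_le sqdist_ge0 andbT.
have r1 := same_edge_refl e.1.
have sc : sqint mu1 I01 (cst c) by apply: (@sqint_bounded _ _ _ mu1 I01 mI01 `|c|) => //; exact: I01_fin.
have n1 := sqintB mI01 (sqint_trace HT H1h_sub_cst e1T r1) (sqintB mI01 (sqint_trace HT Hu e1T r1) sc).
have n2 := sqintB mI01 (sqint_trace HT H1h_sub_cst e2T se) (sqintB mI01 (sqint_trace HT Hu e2T se) sc).
have z1 := sqdist_trace_sub_cst e1T r1; have z2 := sqdist_trace_sub_cst e2T se.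
have := sq_integralD_le mI01 n1 (sqintZ mI01 (-1) n2).
rewrite z1 (@eq_Rintegral _ _ _ mu1 I01
  (fun r => (trace e.2 uc (side_pt e.1 r) - (trace e.2 u (side_pt e.1 r) - c)) ^+ 2)
  (fun r => (-1 * (trace e.2 uc (side_pt e.1 r) - (trace e.2 u (side_pt e.1 r) - c))) ^+ 2)); last first.
  by move=> r _; rewrite mulN1r sqrrN.
rewrite z2 !mulr0 addr0; apply: le_trans; rewrite le_eqVlt; apply/orP; left; apply/eqP.
apply: eq_Rintegral => r _; rewrite /jump.
exact: (congr1 (fun z => z ^+ 2) (sub_shift_shift _ _ _ _ c)).
Qed.

End Constants.

(** * The inequality modulo constants on a polygonal domain *)

Section PolygonalDomain.
Context {R : realType}.
Notation pt := (R * R)%type.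
Notation mR := (measurableTypeR R).
Notation mpt := (mR * mR)%type.
Notation nondeg := Defs.nondegenerate.

Lemma H1_scale t (u : pt -> R) (k : R) : nondeg t -> H1 (open_tri t) u -> H1 (open_tri t) (fun x => k * u x).
Proof.
move=> nt [u2 [G [g1 g2 w1 w2]]]; have mt := measurable_open_tri nt.
have scale (w psi : pt -> R) : L2 (open_tri t) w -> smooth psi ->
    \int[area]_(x in open_tri t) (k * w x * psi x) = k * \int[area]_(x in open_tri t) (w x * psi x).
  move=> w2' sp; rewrite -(Rintegral_scale mt k (sqint_mul mt w2' (smooth_sqint nt sp))).
  by apply: eq_Rintegral => x _; rewrite mulrA.
split; first exact: (sqintZ mt k u2).
exists (fun x => k * G.1 x, fun x => k * G.2 x); split => /=.
- exact: (sqintZ mt k g1).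
- exact: (sqintZ mt k g2).
- move=> phi tphi; have [sphi _ _] := tphi.
  by rewrite (scale u _ u2 (smooth_derive e1 sphi)) (scale _ _ g1 sphi) (w1 phi tphi) mulrN.
- move=> phi tphi; have [sphi _ _] := tphi.
  by rewrite (scale u _ u2 (smooth_derive e2 sphi)) (scale _ _ g2 sphi) (w2 phi tphi) mulrN.
Qed.

Lemma polygon_fin (P : seq (triangle R)) : (forall t, t \in P -> nondeg t) ->
  (area ((\bigcup_(t in [set` P]) closed_tri t) : set mpt) < +oo)%E.
Proof.
move=> nP; have [N [mN N0 HN]] := null_boundary nP.
have mC : measurable ((\bigcup_(t in [set` P]) closed_tri t) : set mpt).
  rewrite -[X in measurable X]setCK; apply: measurableC; apply: open_measurable_plane.
  by apply: closed_openC; exact: closed_bigcup_tri.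
have fin (Q : seq (triangle R)) : {subset Q <= P} -> measurable ((\bigcup_(t in [set` Q]) open_tri t) : set mpt) /\
    (area ((\bigcup_(t in [set` Q]) open_tri t) : set mpt) < +oo)%E.
  elim: Q => [|t Q IH] QP.
    by rewrite bigcup_seq big_nil; split => //; rewrite measure0 ltry.
  have [mQ fQ] : measurable ((\bigcup_(t in [set` Q]) open_tri t) : set mpt) /\
      (area ((\bigcup_(t in [set` Q]) open_tri t) : set mpt) < +oo)%E.
    by apply: IH => s sQ; apply: QP; rewrite inE sQ orbT.
  have nt : nondeg t by apply: nP; apply: QP; rewrite inE eqxx.
  have mt := measurable_open_tri nt.
  rewrite bigcup_seq in mQ fQ; rewrite bigcup_seq big_cons; split; first exact: measurableU.
  by apply: le_lt_trans (measureU2 area mt mQ) _; apply: lte_add_pinfty => //; exact: open_tri_fin.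
have [mO fO] := fin P (fun t tP => tP).
apply: (@le_lt_trans _ _ (area ((\bigcup_(t in [set` P]) open_tri t) `|` N))).
  apply: le_measure; rewrite ?inE //; first exact: measurableU.
  move=> x [t tP xt]; have [Nx|nx] := pselect (N x); first by right.
  by left; exists t => //; exact: (HN x t).
have fN : (area N < +oo)%E by rewrite N0 ltry.
exact: (le_lt_trans (measureU2 area mO mN) (lte_add_pinfty fO fN)).
Qed.

(** [U] contains the open triangles of [P], hence [Omega] up to a null set, and off the sides of the
    mesh [u] is [piecewise T u]. The area of the closed polygon bounds the total area of every
    triangulation, which provides a single [W]; [a] is the area of [Omega]. *)
Lemma poincare_L2sq (Omega : set pt) (K : R) : polygonal_domain Omega ->
  exists C a, [/\ 0 <= C, 0 <= a & forall T, triangulation Omega T -> shape_const T <= K ->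
    forall u, H1h T u -> forall M, energy T u < M -> exists c,
      L2sq Omega (fun x => u x - c) <= C * M /\ L2sq Omega u <= 2 * (C * M) + 2 * (c ^+ 2 * a)].
Proof.
move=> hO; case: hO => O0 cO; case=> P nP OE.
have oO : open Omega by rewrite OE; exact: open_interior.
have closP : closed (\bigcup_(t in [set` P]) closed_tri t) by exact: closed_bigcup_tri.
have clO : closure Omega `<=` \bigcup_(t in [set` P]) closed_tri t.
  by rewrite [X in _ `<=` X](closure_id _).1 //; apply: closure_subset; rewrite OE; exact: interior_subset.
have OP x : Omega x -> exists2 t, t \in P & closed_tri t x.
  by move=> Ox; have [t tP xt] := clO x (subset_closure Ox); exists t.
pose Wd : set mpt := \bigcup_(t in [set` P]) closed_tri t.
have mW : measurable Wd.
  by rewrite -[Wd]setCK; apply: measurableC; apply: open_measurable_plane; exact: closed_openC.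
have fW : (area Wd < +oo)%E := polygon_fin nP.
have mO : measurable (Omega : set mpt) by exact: open_measurable_plane.
have fO : (area (Omega : set mpt) < +oo)%E.
  by apply: le_lt_trans fW; apply: le_measure; rewrite ?inE //.
have finW : area Wd \is a fin_num by rewrite ge0_fin_numE.
have TW T : triangulation Omega T -> \sum_(t <- T) tri_area t <= fine (area Wd).
  move=> HT; have [uT nT _ CT] := HT.
  rewrite -lee_fin fineK // -sumEFin.
  apply: (sum_tri_area_le uT nT (triangulation_disjoint HT) mW) => t tT x xt.
  apply: clO; rewrite -CT; exists t => //.
  by apply/(closed_triP _ (nT t tT)) => i; apply/ltW/(open_triP _ (nT t tT)).1.
have PO t : t \in P -> open_tri t `<=` Omega.
  move=> tP; rewrite OE -open_subsetE; last exact/open_open_tri/nP.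
  move=> x xt; exists t => //.
  by apply/(closed_triP _ (nP t tP)) => i; apply/ltW/(open_triP _ (nP t tP)).1.
have [U [[mU fU [C [C0 HC]]] PU]] : exists U : set mpt, poincare Omega K U /\
    forall t, t \in P -> open_tri t `<=` U.
  case EP : P nP PO OP => [|t0 Q] nQ QO OQ; first by have [x /OQ []] := O0.
  have [U [_ pU PU]] := @poincare_all_tri _ Omega K _ oO TW cO Q t0 nQ QO.
  by exists U.
exists C, (fine (area (Omega : set mpt))); split => //.
move=> T HT sT u Hu M EM; have [uT nT _ _] := HT.
have [c Hc] := HC T HT sT u Hu M EM; exists c.
have [N1 [mN1 N10 HN1]] := null_boundary nP.
have [N2 [mN2 N20 HN2]] := null_boundary nT.
pose g := piecewise T u.
have gu x : Omega x -> ~ N2 x -> u x = g x.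
  move=> Ox nx; have [t tT xt] := triangulation_covers HT Ox.
  rewrite /g (piecewise_eq u uT tT (triangulation_disjoint HT)) //.
  exact: (HN2 x t).
have sc A : measurable A -> (area A < +oo)%E -> sqint area A (fun x : mpt => g x - c).
  move=> mA fA; apply: (sqintB mA (sqint_piecewise_on HT Hu mA)).
  exact: (sqint_cst c mA fA).
have gO : \int[area]_(x in (Omega : set mpt)) ((g x - c) ^+ 2) <= C * M.
  apply: le_trans Hc.
  have sO := sc _ mO fO; have sU := sc _ mU fU.
  rewrite -lee_fin -(integral_sqintE mO sO) -(integral_sqintE mU sU).
  have ge0 x : (0 <= ((g x - c) ^+ 2)%:E)%E by rewrite lee_fin sqr_ge0.
  rewrite (ge0_negligible_integral mN1 mO (measurable_int _ sO.2) (fun x _ => ge0 x) N10).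
  have sub : (Omega : set mpt) `\` N1 `<=` U.
    move=> x [Ox nx]; have [t tP xt] := OP x Ox.
    by apply: (PU t tP); exact: (HN1 x t).
  apply: ge0_subset_integral => //; first exact: measurableD.
  exact: (measurable_int _ sU.2).
split.
  apply: le_trans gO; apply: (integral_sq_ae_le mO mN2 N20 (sc _ mO fO)) => x Ox nx.
  by rewrite (gu x Ox nx).
apply: le_trans (integral_sq_ae_le mO mN2 N20 (sqint_piecewise_on HT Hu mO) gu) _.
have := sq_integralD_le mO (sc _ mO fO) (sqint_cst c mO fO).
rewrite (_ : (fun x => (g x - c + cst c x) ^+ 2) = (fun x => g x ^+ 2)); last first.
  by apply/funext => x; rewrite /= subrK.
have -> : \int[area]_(x in (Omega : set mpt)) (cst c x ^+ 2) = c ^+ 2 * fine (area (Omega : set mpt)).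
  by rewrite -(Rintegral_cst area mO).
by move=> H; apply: le_trans H _; rewrite lerD2r ler_pM2l.
Qed.

End PolygonalDomain.

(** * Eliminating the constant through the semi-norm *)

Section FinalBound.
Context {R : realType}.

(** To be read with [n] the semi-norm of 1, [F] that of [u], and [k] the factor bounding the
    semi-norm by the norm. Squaring the first estimate bounds [c ^+ 2] by a multiple of
    [M + F ^+ 2], to be inserted in the second. *)
Lemma constant_part_bound (L C0 M a c k n F : R) : 0 < n -> 0 <= C0 -> 0 <= M -> 0 <= a ->
  `|c| * n <= F + k * Num.sqrt ((C0 + 1) * M) ->
  L <= 2 * (C0 * M) + 2 * (c ^+ 2 * a) ->
  L <= (2 * C0 + 4 * a * (k ^+ 2 * (C0 + 1) + 1) / n ^+ 2) * (M + F ^+ 2).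
Proof.
move=> n0 C00 M0 a0 H Lle; set s := Num.sqrt _ in H.
have s2 : s ^+ 2 = (C0 + 1) * M by rewrite sqr_sqrtr // mulr_ge0 // addr_ge0.
have n2 : 0 < n ^+ 2 by rewrite exprn_gt0.
have B : c ^+ 2 * n ^+ 2 <= 2 * F ^+ 2 + 2 * (k ^+ 2 * ((C0 + 1) * M)).
  rewrite -s2 -(real_normK (num_real c)) -exprMn.
  have : (`|c| * n) ^+ 2 <= (F + k * s) ^+ 2.
    by rewrite ler_pXn2r ?nnegrE ?(le_trans _ H) // mulr_ge0 // ltW.
  move/le_trans; apply; have := sqr_ge0 (F - k * s); nra.
have B' : c ^+ 2 <= 2 * (k ^+ 2 * (C0 + 1) + 1) / n ^+ 2 * (M + F ^+ 2).
  rewrite mulrAC ler_pdivlMr //; apply: le_trans B _.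
  have := sqr_ge0 F; have : 0 <= k ^+ 2 * (C0 + 1) by rewrite mulr_ge0 ?sqr_ge0 // addr_ge0.
  rewrite (mulrA (k ^+ 2)); set z := k ^+ 2 * (C0 + 1) => z0 F0.
  have := mulr_ge0 z0 F0; nra.
apply: le_trans Lle _.
have := ler_wpM2r a0 B'; have := mulr_ge0 C00 (sqr_ge0 F); set q := _ / n ^+ 2.
rewrite (_ : 4 * a * _ / _ = 2 * a * q); last by rewrite /q; field; rewrite gt_eqF.
nra.
Qed.

(** Removes the strict inequality between energy and [M]: the excess [d] is chosen so that [C * d]
    is smaller than the assumed gap. *)
Lemma le_mul_limit (L C E F : R) : 0 <= C -> (forall M, E < M -> L <= C * (M + F)) -> L <= C * (E + F).
Proof.
move=> C0 H; rewrite leNgt; apply/negP => lt.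
have C1 : 0 < C + 1 by rewrite ltr_wpDl.
pose d := (L - C * (E + F)) / (C + 1).
have d0 : 0 < d by rewrite divr_gt0 // subr_gt0.
have Ed : d * (C + 1) = L - C * (E + F) by rewrite /d divfK // gt_eqF.
have := H (E + d); rewrite ltrDl => /(_ d0); nra.
Qed.

End FinalBound.

(* [f T] is the semi-norm on the piecewise H^1 space subordinated to [T].  The
   family ranges over all triangulations of [Omega] with shape regularity
   constant at most [K], and its members have the same value at a constant. *)
Theorem theorem4p1 (R : realType) (Omega : set (R * R)) (K : R)
  (f : seq (triangle R) -> (R * R -> R) -> R)
  (hOmega : polygonal_domain Omega)
  (hsemi : forall T, triangulation Omega T -> shape_const T <= K ->
     seminorm_on (H1h T) (f T))
  (hsame : forall T T', triangulation Omega T -> shape_const T <= K ->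
     triangulation Omega T' -> shape_const T' <= K ->
     forall c : R, f T (cst c) = f T' (cst c))
  (hbound : exists C : R, forall T, triangulation Omega T ->
     shape_const T <= K ->
     forall u, H1h T u -> f T u <= C * H1h_norm Omega T u)
  (hconst : forall T, triangulation Omega T -> shape_const T <= K ->
     forall c : R, f T (cst c) = 0 <-> c = 0) :
  exists C : R, forall T, triangulation Omega T -> shape_const T <= K ->
    forall u, H1h T u ->
      L2sq Omega u <=
        C * (grad_energy T u + jump_energy T u + (f T u) ^+ 2).
Proof.
(* A reference mesh is required to read off the semi-norm of 1; if there is no admissible mesh, any
   constant will do. *)
have [[T0 [HT0 sT0]]|no] := pselect (exists T, triangulation Omega T /\ shape_const T <= K); last first.
  by exists 0 => T HT sT; case: no; exists T.
have [C1 HC1] := hbound; have [C0 [a [C00 a0 HC0]]] := poincare_L2sq K hOmega.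
have Hcst T c : triangulation Omega T -> H1h T (cst c).
  by move=> [_ nT _ _] t tT; exact/H1_cst/nT.
(* By [hsame] this is also the semi-norm of 1 for every other admissible mesh, so the final constant
   may contain its inverse. *)
pose n := f T0 (cst 1).
have [subad homog] := hsemi _ HT0 sT0.
(* Nonnegativity follows from [0 = f (1 - 1) <= 2 * f 1], and [hconst] makes it strict. *)
have n0 : 0 < n.
  rewrite lt_neqAle; apply/andP; split.
    by apply/eqP => /esym /(hconst _ HT0 sT0) /eqP; rewrite oner_eq0.
  have h1 := Hcst T0 1 HT0.
  have : f T0 (cst 1 \+ (fun x => -1 * cst 1 x)) <= n + f T0 (fun x => -1 * cst 1 x).
    apply: subad => //; rewrite (_ : (fun x => _) = cst (-1)); first exact: Hcst.
    by apply/funext => x; rewrite /= mulr1.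
  rewrite homog // normrN1 mul1r (_ : _ \+ _ = cst 0); last by apply/funext => x /=; rewrite mulr1 subrr.
  by rewrite (hconst _ HT0 sT0 0).2 // -mulr2n pmulrn_lge0.
(* [C1] might be negative; monotonicity in the norm asks for a nonnegative factor. *)
pose k := Num.max C1 0; have k0 : 0 <= k by rewrite le_max lexx orbT.
exists (2 * C0 + 4 * a * (k ^+ 2 * (C0 + 1) + 1) / n ^+ 2) => T HT sT u Hu.
apply: le_mul_limit.
  rewrite addr_ge0 ?mulr_ge0 ?invr_ge0 ?sqr_ge0 //.
  by rewrite addr_ge0 // mulr_ge0 ?sqr_ge0 // addr_ge0.
move=> M EM; have [c [Hc Lu]] := HC0 T HT sT u Hu M EM.
have M0 : 0 <= M by apply: ltW; apply: le_lt_trans EM; exact: energy_ge0 u HT.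
apply: (constant_part_bound n0 C00 M0 a0 _ Lu).
have [sub hom] := hsemi _ HT sT.
pose uc x := u x - c; have Huc : H1h T uc by exact: H1h_sub_cst HT Hu.
(* Gradient and jump energies do not see the constant, so the squared norm of [u - c] is at most
   [C0 * M] plus the energy of [u], which is below [M]. *)
have fuc : f T uc <= k * Num.sqrt ((C0 + 1) * M).
  apply: le_trans (HC1 T HT sT uc Huc) _.
  apply: (@le_trans _ _ (k * H1h_norm Omega T uc)).
    by apply: ler_wpM2r; [exact: sqrtr_ge0|rewrite le_max lexx].
  apply: ler_wpM2l => //; apply: ler_wsqrtr.
  rewrite -addrA (grad_energy_sub_cst c HT Hu) (jump_energy_sub_cst c HT Hu) mulrDl mul1r.
  by apply: lerD => //; exact: ltW.
have -> : `|c| * n = f T (cst c).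
  rewrite /n (hsame _ _ HT0 sT0 HT sT) -(hom c _ (Hcst T 1 HT)); congr (f T _).
  by apply/funext => x; rewrite /= mulr1.
have Hm : H1h T (fun x => -1 * uc x).
  by move=> t tT; apply: H1_scale; [case: HT => _ nT _ _; exact: nT|exact: Huc].
have -> : cst c = u \+ (fun x => -1 * uc x) by apply/funext => x; rewrite /= mulN1r /uc opprB addrC subrK.
apply: le_trans (sub _ _ Hu Hm) _; rewrite hom // normrN1 mul1r.
by rewrite lerD2l.
Qed.
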